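(* There exist numerical constants $C_0\in(0,1)$, $C_1$ and $C_2$ such that the following holds. Let $f_c\ge 10^3$ be an integer, $\lambda_c=1/f_c$, and let $T=\{t_j\}\subset\mathbb{T}$ satisfy $\Delta(T)\ge 1.26/f_c$. Then for any sign pattern $v\in\mathbb{C}^{|T|}$ with $|v_j|=1$ for all $j$, there exists a low-pass trigonometric polynomial $$q(t)=\sum_{k=-f_c}^{f_c}c_k e^{i2\pi kt},\qquad c_k\in\mathbb{C},$$ obeying $$q(t_j)=v_j,\quad t_j\in T,\qquad\qquad |q(t)|<1,\quad t\in\mathbb{T}\setminus T,$$ and, in addition, $$1-C_1f_c^2(t-t_j)^2\ \le\ |q(t)|\ \le\ 1-C_2f_c^2(t-t_j)^2,\qquad |t-t_j|\le C_0\lambda_c,\quad t_j\in T.$$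
   Context: $\mathbb{T}$ is the circle obtained by identifying the endpoints of $[0,1]$; $|t-t'|$ denotes the wrap-around distance on $\mathbb{T}$ (so $(t-t_j)^2$ is the square of this distance). For $T\subset\mathbb{T}$, the minimum separation is $\Delta(T)=\inf_{t,t'\in T,\ t\ne t'}|t-t'|$. ''Numerical constants'' are absolute constants, not depending on $f_c$, $T$ or $v$. *)

(* Defs.v *)
From Stdlib Require Import Reals ZArith.
From Coquelicot Require Import Coquelicot.

Open Scope R_scope.

(* Each point of the circle is represented by its unique representative in
   [0, 1), the endpoint 1 of [0, 1] being identified with 0. *)
Definition circle (t : R) : Prop := 0 <= t < 1.

(* This is the wrap-around distance only for representatives in [0, 1). *)
Definition wrap_dist (t t' : R) : R :=
  Rmin (Rabs (t - t')) (1 - Rabs (t - t')).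

(* Infimum in the extended reals: it is [p_infty] when [T] has at most one
   point. *)
Definition min_separation (T : R -> Prop) : Rbar :=
  Glb_Rbar (fun d : R =>
    exists t t' : R, T t /\ T t' /\ t <> t' /\ d = wrap_dist t t').

(* e^{i x} *)
Definition expi (x : R) : C := (cos x, sin x).

(* sum_{k = -fc}^{fc} c_k e^{i 2 pi k t}, summed over j = k + fc from 0 to
   2 fc; only the values of [c] on [-fc, fc] matter. *)
Definition trig_poly (fc : nat) (c : Z -> C) (t : R) : C :=
  sum_n (fun j : nat =>
    let k := (Z.of_nat j - Z.of_nat fc)%Z in
    (c k * expi (2 * PI * IZR k * t))%C) (2 * fc).

(* Main.v *)
(** The interpolant is [q(t) = sum_j a_j k(t - t_j) + g_j k'(t - t_j)], where [k]
    is a product of Dirichlet kernels of lengths [3N], [4N], [5N] with [6N] close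
    to [fc], and the coefficients solve [q(t_j) = v_j], [q'(t_j) = 0].  In the
    variable [z = 2 pi N t] the nodes are at least [168/128] apart and [k] is
    nearly [(sin z + sin 2z + sin 3z - sin 6z) / (30 z^3)], whatever [fc] is.
    Splitting the line into bins of length [168/128], each containing at most
    one node, bounds every sum of [|k^(i)(z - z_j)|] by values of a decreasing
    envelope; in particular the linear system is diagonally dominant.  Since
    [|q|] is the supremum of [Re (w q)] over unit [w], all estimates are real.
    Next to a node, [Re (w q)] is compared with [k] by integrating a bound on
    the second derivative of the difference twice; elsewhere the triangle
    inequality suffices.  The envelope decays like [z^-3] beyond [z = 8], and
    below it is tabulated by certified fixed-point arithmetic. *)

Require Import Defs.
From Stdlib Require Import Reals ZArith List Lra Lia Psatz Classical ClassicalEpsilon FinFun.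
From Coquelicot Require Import Coquelicot.
Import ListNotations.

Open Scope R_scope.

(** * Finite sums over lists *)

(** The hypothesis leaves little room. For [fc = 1000] and [N = 166] the separation in the variable
    [z] is about 1.314, and 168/128 is the largest multiple of the cell length 1/128 below it.

    Unequal lengths 3, 4, 5 spread the zeros of the three Dirichlet factors, which damps the side
    lobes, while the product of their sines still expands into only four sines. One table serves
    every [N], because the kernel differs from its limit by a small relative error, added once to
    each entry.

    At a node the triangle inequality cannot give [|q| < 1]: the coefficients may be as large as
    1.028. There the curvature of the kernel has to beat the curvature of everything else, hence the
    comparison of second derivatives.

    For a unit [w], the real function [Re (w q)] interpolates [Re (w v_j)], of which only
    [|Re (w v_j)| <= 1] is known. So the real estimates take data [r] with [|r| <= 1]; the lower
    bound near a node is claimed only where [r = 1], which is the case [w = conj v_j]. The systems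
    for the real and imaginary parts are solved once, and linearity gives all rotations. *)

Definition lsum {A : Type} (f : A -> R) (l : list A) : R :=
  fold_right (fun x s => f x + s) 0 l.

Lemma lsum_app {A} (f : A -> R) l l' : lsum f (l ++ l') = lsum f l + lsum f l'.
Proof. induction l as [|x l IH]; simpl; [lra|]. rewrite IH; lra. Qed.

Lemma lsum_ext {A} (f g : A -> R) l :
  (forall x, In x l -> f x = g x) -> lsum f l = lsum g l.
Proof.
  induction l as [|x l IH]; simpl; intros H; [reflexivity|].
  rewrite (H x) by auto. rewrite IH by auto. reflexivity.
Qed.

Lemma lsum_le {A} (f g : A -> R) l :
  (forall x, In x l -> f x <= g x) -> lsum f l <= lsum g l.
Proof.
  induction l as [|x l IH]; simpl; intros H; [lra|].
  apply Rplus_le_compat; auto.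
Qed.

Lemma lsum_scal {A} (c : R) (f : A -> R) l :
  lsum (fun x => c * f x) l = c * lsum f l.
Proof. induction l as [|x l IH]; simpl; [lra|]. rewrite IH; lra. Qed.

Lemma lsum_plus {A} (f g : A -> R) l :
  lsum (fun x => f x + g x) l = lsum f l + lsum g l.
Proof. induction l as [|x l IH]; simpl; [lra|]. rewrite IH; lra. Qed.

Lemma lsum_abs {A} (f : A -> R) l : Rabs (lsum f l) <= lsum (fun x => Rabs (f x)) l.
Proof.
  induction l as [|x l IH]; simpl; [rewrite Rabs_R0; lra|].
  eapply Rle_trans; [apply Rabs_triang|lra].
Qed.

Lemma lsum_nonneg {A} (f : A -> R) l : (forall x, In x l -> 0 <= f x) -> 0 <= lsum f l.
Proof.
  induction l as [|x l IH]; simpl; intros H; [lra|].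
  apply Rplus_le_le_0_compat; auto.
Qed.

Lemma lsum_map {A B} (f : B -> R) (g : A -> B) l :
  lsum f (map g l) = lsum (fun x => f (g x)) l.
Proof. induction l as [|x l IH]; simpl; [reflexivity|]. now rewrite IH. Qed.

Lemma lsum_flat_map {A B} (f : B -> R) (g : A -> list B) l :
  lsum f (flat_map g l) = lsum (fun x => lsum f (g x)) l.
Proof.
  induction l as [|x l IH]; simpl; [reflexivity|]. now rewrite lsum_app, IH.
Qed.

Lemma lsum_seq_S (f : nat -> R) n : lsum f (seq 0 (S n)) = lsum f (seq 0 n) + f n.
Proof. rewrite seq_S, lsum_app. simpl. lra. Qed.

(** * Cosine sums and Dirichlet kernels *)

(* The pair [(w, m)] stands for [w * cos (m u)]. *)
Definition cos_sum := list (R * Z).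

Definition ceval (l : cos_sum) (u : R) : R :=
  lsum (fun p => fst p * cos (IZR (snd p) * u)) l.

Definition moment (k : nat) (l : cos_sum) : R :=
  lsum (fun p => fst p * IZR (snd p) ^ k) l.

(** The rule [cos a * cos b = (cos (a + b) + cos (a - b)) / 2], applied to every pair of terms. *)
Definition cprod (l l' : cos_sum) : cos_sum :=
  flat_map (fun p => flat_map (fun p' =>
    [(fst p * fst p' / 2, (snd p + snd p')%Z);
     (fst p * fst p' / 2, (snd p - snd p')%Z)]) l') l.

(** The function [sin (M u) / (M sin u)] as a cosine sum: equal weights at the frequencies
    [-(M - 1), -(M - 3), ..., M - 1]. *)
Definition dirichlet (M : nat) : cos_sum :=
  map (fun j => (/ INR M, (2 * Z.of_nat j - Z.of_nat M + 1)%Z)) (seq 0 M).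

Lemma lsum_cprod (f : R * Z -> R) l l' :
  lsum f (cprod l l') = lsum (fun p => lsum (fun p' =>
    f (fst p * fst p' / 2, (snd p + snd p')%Z)
    + f (fst p * fst p' / 2, (snd p - snd p')%Z)) l') l.
Proof.
  unfold cprod. rewrite lsum_flat_map. apply lsum_ext; intros p _.
  rewrite lsum_flat_map. apply lsum_ext; intros p' _. simpl. lra.
Qed.

Lemma ceval_cprod l l' u : ceval (cprod l l') u = ceval l u * ceval l' u.
Proof.
  unfold ceval at 1. rewrite lsum_cprod. unfold ceval at 1.
  rewrite Rmult_comm, <- lsum_scal. apply lsum_ext; intros p _.
  unfold ceval. rewrite Rmult_comm, <- lsum_scal. apply lsum_ext; intros p' _. simpl.
  rewrite plus_IZR, minus_IZR, Rmult_plus_distr_r, Rmult_minus_distr_r,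
    cos_plus, cos_minus. lra.
Qed.

Lemma moment0_cprod l l' : moment 0 (cprod l l') = moment 0 l * moment 0 l'.
Proof.
  unfold moment at 1. rewrite lsum_cprod. unfold moment at 1.
  rewrite Rmult_comm, <- lsum_scal. apply lsum_ext; intros p _.
  unfold moment. rewrite Rmult_comm, <- lsum_scal. apply lsum_ext; intros p' _. simpl. lra.
Qed.

Lemma moment2_cprod l l' :
  moment 2 (cprod l l') = moment 2 l * moment 0 l' + moment 0 l * moment 2 l'.
Proof.
  unfold moment at 1. rewrite lsum_cprod.
  rewrite (Rmult_comm (moment 2 l)), (Rmult_comm (moment 0 l) (moment 2 l')).
  unfold moment at 2 4. rewrite <- !lsum_scal, <- lsum_plus.
  apply lsum_ext; intros p _.
  unfold moment.
  rewrite (Rmult_comm (lsum _ l')), (Rmult_comm (lsum _ l') (fst p * _)), <- !lsum_scal, <- lsum_plus.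
  apply lsum_ext; intros p' _. simpl. rewrite plus_IZR, minus_IZR. field.
Qed.

(** In [(m + m')^4 + (m - m')^4] the terms odd in [m'] cancel, so no odd moment appears; the 6 is
    the middle binomial coefficient. *)
Lemma moment4_cprod l l' :
  moment 4 (cprod l l') = moment 4 l * moment 0 l' + 6 * (moment 2 l * moment 2 l')
                          + moment 0 l * moment 4 l'.
Proof.
  transitivity (moment 0 l' * moment 4 l + 6 * moment 2 l' * moment 2 l
                + moment 4 l' * moment 0 l); [|ring].
  unfold moment at 1. rewrite lsum_cprod.
  unfold moment at 2 4 6. rewrite <- !lsum_scal, <- !lsum_plus.
  apply lsum_ext; intros p _.
  transitivity (fst p * IZR (snd p) ^ 4 * moment 0 l'
    + 6 * (fst p * IZR (snd p) ^ 2) * moment 2 l' + (fst p * IZR (snd p) ^ 0) * moment 4 l');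
    [|ring].
  unfold moment. rewrite <- !lsum_scal, <- !lsum_plus.
  apply lsum_ext; intros p' _. simpl. rewrite plus_IZR, minus_IZR. field.
Qed.

Definition frequencies_in (P : Z -> Prop) (l : cos_sum) : Prop :=
  forall p, In p l -> P (snd p).

Definition nonneg_weights (l : cos_sum) : Prop := forall p, In p l -> 0 <= fst p.

Lemma in_cprod p l l' : In p (cprod l l') ->
  exists q q', In q l /\ In q' l' /\ fst p = fst q * fst q' / 2 /\
    (snd p = snd q + snd q' \/ snd p = snd q - snd q')%Z.
Proof.
  unfold cprod. intros H. apply in_flat_map in H as [q [Hq H]].
  apply in_flat_map in H as [q' [Hq' H]]. exists q, q'.
  simpl in H. destruct H as [<-|[<-|[]]]; simpl; auto.
Qed.

Lemma nonneg_cprod l l' :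
  nonneg_weights l -> nonneg_weights l' -> nonneg_weights (cprod l l').
Proof.
  intros H H' p Hp. destruct (in_cprod _ _ _ Hp) as (q & q' & Hq & Hq' & -> & _).
  specialize (H q Hq). specialize (H' q' Hq').
  assert (0 <= fst q * fst q') by (apply Rmult_le_pos; auto). lra.
Qed.

Lemma degree_cprod l l' a b :
  frequencies_in (fun m => Z.abs m <= a)%Z l ->
  frequencies_in (fun m => Z.abs m <= b)%Z l' ->
  frequencies_in (fun m => Z.abs m <= a + b)%Z (cprod l l').
Proof.
  intros H H' p Hp. destruct (in_cprod _ _ _ Hp) as (q & q' & Hq & Hq' & _ & E).
  specialize (H q Hq). specialize (H' q' Hq'). cbv beta in *. lia.
Qed.

Lemma parity_cprod l l' a b :
  frequencies_in (fun m => exists k, m = 2 * k + a)%Z l ->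
  frequencies_in (fun m => exists k, m = 2 * k + b)%Z l' ->
  frequencies_in (fun m => exists k, m = 2 * k + (a + b))%Z (cprod l l').
Proof.
  intros H H' p Hp. destruct (in_cprod _ _ _ Hp) as (q & q' & Hq & Hq' & _ & E).
  destruct (H q Hq) as [k Hk]. destruct (H' q' Hq') as [k' Hk'].
  destruct E as [-> | ->]; [exists (k + k')%Z|exists (k - k' - b)%Z]; lia.
Qed.

Lemma lsum_dirichlet (f : R * Z -> R) M :
  lsum f (dirichlet M)
  = lsum (fun j => f (/ INR M, (2 * Z.of_nat j - Z.of_nat M + 1)%Z)) (seq 0 M).
Proof. apply lsum_map. Qed.

Lemma IZR_dirichlet_freq j M :
  IZR (2 * Z.of_nat j - Z.of_nat M + 1) = 2 * INR j - (INR M - 1).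
Proof. rewrite plus_IZR, minus_IZR, mult_IZR, <- !INR_IZR_INZ. ring. Qed.

(** Multiplied by [2 sin u], each cosine becomes a difference of two sines and the sum
    telescopes. *)
Lemma sum_cos_arith c u n :
  2 * sin u * lsum (fun j => cos ((2 * INR j - c) * u)) (seq 0 n)
  = sin ((2 * INR n - 1 - c) * u) + sin ((1 + c) * u).
Proof.
  induction n as [|n IH].
  - simpl. replace ((2 * 0 - 1 - c) * u) with (- ((1 + c) * u)) by ring.
    rewrite sin_neg. ring.
  - rewrite lsum_seq_S, Rmult_plus_distr_l, IH, S_INR.
    replace ((2 * (INR n + 1) - 1 - c) * u) with ((2 * INR n - c) * u + u) by ring.
    replace ((2 * INR n - 1 - c) * u) with ((2 * INR n - c) * u - u) by ring.
    rewrite sin_plus, sin_minus. ring.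
Qed.

Lemma ceval_dirichlet M u : (0 < M)%nat ->
  INR M * sin u * ceval (dirichlet M) u = sin (INR M * u).
Proof.
  intros HM. assert (0 < INR M) by (apply lt_0_INR; lia).
  unfold ceval. rewrite lsum_dirichlet. cbn [fst snd].
  rewrite (lsum_ext _ (fun j => / INR M * cos ((2 * INR j - (INR M - 1)) * u)))
    by (intros; now rewrite IZR_dirichlet_freq).
  rewrite lsum_scal.
  pose proof (sum_cos_arith (INR M - 1) u M) as E.
  replace ((2 * INR M - 1 - (INR M - 1)) * u) with (INR M * u) in E by ring.
  replace ((1 + (INR M - 1)) * u) with (INR M * u) in E by ring.
  apply (Rmult_eq_reg_l 2); [|lra].
  transitivity (2 * sin u * lsum (fun j => cos ((2 * INR j - (INR M - 1)) * u)) (seq 0 M)).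
  - field. lra.
  - rewrite E. ring.
Qed.

Lemma sum_arith_pow2 c n :
  lsum (fun j => (2 * INR j - c) ^ 2) (seq 0 n)
  = INR n * c ^ 2 - 2 * c * INR n * (INR n - 1)
    + 4 * (INR n * (INR n - 1) * (2 * INR n - 1) / 6).
Proof.
  induction n as [|n IH]; [simpl; field|].
  rewrite lsum_seq_S, IH, S_INR. field.
Qed.

(** The binomial expansion of the summand, with the closed forms of the sums of [j], [j^2], [j^3]
    and [j^4]. *)
Lemma sum_arith_pow4 c n :
  lsum (fun j => (2 * INR j - c) ^ 4) (seq 0 n)
  = INR n * c ^ 4 - 4 * c ^ 3 * INR n * (INR n - 1)
    + 24 * c ^ 2 * (INR n * (INR n - 1) * (2 * INR n - 1) / 6)
    - 32 * c * (INR n * (INR n - 1) / 2) ^ 2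
    + 16 * (INR n * (INR n - 1) * (2 * INR n - 1) * (3 * INR n ^ 2 - 3 * INR n - 1) / 30).
Proof.
  induction n as [|n IH]; [simpl; field|].
  rewrite lsum_seq_S, IH, S_INR. field.
Qed.

Lemma moment_dirichlet k M :
  moment k (dirichlet M)
  = / INR M * lsum (fun j => (2 * INR j - (INR M - 1)) ^ k) (seq 0 M).
Proof.
  unfold moment. rewrite lsum_dirichlet. cbn [fst snd]. rewrite <- lsum_scal.
  apply lsum_ext; intros. now rewrite IZR_dirichlet_freq.
Qed.

Lemma moment0_dirichlet M : (0 < M)%nat -> moment 0 (dirichlet M) = 1.
Proof.
  intros HM. assert (0 < INR M) by (apply lt_0_INR; lia).
  rewrite moment_dirichlet.
  assert (E : forall n, lsum (fun j => (2 * INR j - (INR M - 1)) ^ 0) (seq 0 n) = INR n).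
  { induction n as [|n IH]; [reflexivity|]. rewrite lsum_seq_S, IH, S_INR. simpl. ring. }
  rewrite E. field. lra.
Qed.

Lemma moment2_dirichlet M : (0 < M)%nat -> moment 2 (dirichlet M) = (INR M ^ 2 - 1) / 3.
Proof.
  intros HM. assert (0 < INR M) by (apply lt_0_INR; lia).
  rewrite moment_dirichlet, sum_arith_pow2. field. lra.
Qed.

Lemma moment4_dirichlet M : (0 < M)%nat ->
  moment 4 (dirichlet M) = (INR M ^ 2 - 1) * (3 * INR M ^ 2 - 7) / 15.
Proof.
  intros HM. assert (0 < INR M) by (apply lt_0_INR; lia).
  rewrite moment_dirichlet, sum_arith_pow4. field. lra.
Qed.

Lemma nonneg_dirichlet M : nonneg_weights (dirichlet M).
Proof.
  intros p Hp. apply in_map_iff in Hp as (j & <- & Hj). simpl.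
  apply in_seq in Hj. left. apply Rinv_0_lt_compat, lt_0_INR. lia.
Qed.

Lemma degree_dirichlet M :
  frequencies_in (fun m => Z.abs m <= Z.of_nat M - 1)%Z (dirichlet M).
Proof.
  intros p Hp. apply in_map_iff in Hp as (j & <- & Hj). cbn [snd].
  apply in_seq in Hj. lia.
Qed.

Lemma parity_dirichlet M :
  frequencies_in (fun m => exists k, m = 2 * k + (1 - Z.of_nat M))%Z (dirichlet M).
Proof.
  intros p Hp. apply in_map_iff in Hp as (j & <- & Hj). cbn [snd]. exists (Z.of_nat j). lia.
Qed.

(** * The interpolation kernel *)

(* Product of Dirichlet kernels of lengths [3N], [4N], [5N]; the factor
   [dirichlet 2 = cos] makes all frequencies even. *)
Definition ker (N : nat) : cos_sum :=
  cprod (cprod (dirichlet (3 * N)) (dirichlet (5 * N)))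
        (cprod (dirichlet (4 * N)) (dirichlet 2)).

Lemma nonneg_ker N : nonneg_weights (ker N).
Proof. repeat apply nonneg_cprod; apply nonneg_dirichlet. Qed.

Lemma degree_ker N :
  frequencies_in (fun m => Z.abs m <= 2 * (6 * Z.of_nat N - 1))%Z (ker N).
Proof.
  intros p Hp.
  assert (H := degree_cprod _ _ _ _
     (degree_cprod _ _ _ _ (degree_dirichlet (3 * N)) (degree_dirichlet (5 * N)))
     (degree_cprod _ _ _ _ (degree_dirichlet (4 * N)) (degree_dirichlet 2)) p Hp).
  cbv beta in H |- *. lia.
Qed.

Lemma even_ker N : frequencies_in (fun m => exists k, m = 2 * k)%Z (ker N).
Proof.
  intros p Hp.
  assert (H := parity_cprod _ _ _ _
     (parity_cprod _ _ _ _ (parity_dirichlet (3 * N)) (parity_dirichlet (5 * N)))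
     (parity_cprod _ _ _ _ (parity_dirichlet (4 * N)) (parity_dirichlet 2)) p Hp).
  destruct H as [k Hk]. exists (k + 1 - 6 * Z.of_nat N)%Z. lia.
Qed.

Lemma moment0_ker N : (0 < N)%nat -> moment 0 (ker N) = 1.
Proof.
  intros HN. unfold ker. rewrite !moment0_cprod, !moment0_dirichlet by lia. ring.
Qed.

(** The value is exact: the three long factors contribute [(M^2 - 1) / 3] each, and their three
    [-1/3] cancel against the second moment 1 of [dirichlet 2]. Hence the second derivative at 0 is
    the same for every [N]. *)
Lemma moment2_ker N : (0 < N)%nat -> moment 2 (ker N) = 50 * INR N ^ 2 / 3.
Proof.
  intros HN. unfold ker.
  rewrite !moment2_cprod, !moment0_cprod, !moment0_dirichlet, !moment2_dirichlet by lia.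
  rewrite !mult_INR. simpl. field.
Qed.

Lemma moment4_ker N : (166 <= N)%nat -> moment 4 (ker N) <= 70528 / 100 * INR N ^ 4.
Proof.
  intros HN. unfold ker.
  rewrite !moment4_cprod, !moment2_cprod, !moment0_cprod, !moment0_dirichlet,
    !moment2_dirichlet, !moment4_dirichlet by lia.
  rewrite !mult_INR. simpl INR.
  assert (H : 166 <= INR N) by (replace 166 with (INR 166) by (simpl; lra); apply le_INR; lia).
  set (x := INR N) in *.
  assert (Hx : 166 ^ 2 <= x ^ 2) by (apply pow_incr; lra).
  set (y := x ^ 2) in *.
  replace (x ^ 4) with (y ^ 2) by (unfold y; ring).
  (* The exact fourth moment; its leading coefficient 705.07 is rounded up so that division by [2^4]
     gives 44.08. *)
  match goal with |- ?a <= _ => replace a with (10576 / 15 * y ^ 2 - 8 / 5)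
    by (unfold y; field) end.
  nra.
Qed.

(** * Elementary trigonometric inequalities *)

(** Drives the ladder of Taylor inequalities below: each one is the derivative of the next. *)
Lemma nonneg_from_derive (f f' : R -> R) :
  f 0 = 0 -> (forall x, is_derive f x (f' x)) -> (forall x, 0 <= x -> 0 <= f' x) ->
  forall x, 0 <= x -> 0 <= f x.
Proof.
  intros H0 Hd Hp x Hx. destruct Hx as [Hx| <-]; [|lra].
  destruct (MVT_gen f 0 x f') as (c & Hc & E).
  - intros; apply Hd.
  - intros y _. apply continuity_pt_filterlim.
    apply (ex_derive_continuous (K := R_AbsRing) (V := R_NormedModule)).
    eexists; apply Hd.
  - rewrite Rmin_left, Rmax_right in Hc by lra.
    assert (0 <= f' c * (x - 0)) by (apply Rmult_le_pos; [apply Hp|]; lra). lra.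
Qed.

Lemma sin_le_id x : 0 <= x -> 0 <= x - sin x.
Proof.
  apply (nonneg_from_derive (fun x => x - sin x) (fun x => 1 - cos x)).
  - rewrite sin_0; lra.
  - intros y. auto_derive; auto; lra.
  - intros y _. pose proof (COS_bound y). lra.
Qed.

Lemma cos_ge2_pos x : 0 <= x -> 0 <= cos x - (1 - x ^ 2 / 2).
Proof.
  apply (nonneg_from_derive (fun x => cos x - (1 - x ^ 2 / 2)) (fun x => x - sin x)).
  - rewrite cos_0; lra.
  - intros y. auto_derive; auto; field.
  - apply sin_le_id.
Qed.

Lemma sin_ge3 x : 0 <= x -> 0 <= sin x - (x - x ^ 3 / 6).
Proof.
  apply (nonneg_from_derive (fun x => sin x - (x - x ^ 3 / 6))
    (fun x => cos x - (1 - x ^ 2 / 2))).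
  - rewrite sin_0; lra.
  - intros y. auto_derive; auto; field.
  - apply cos_ge2_pos.
Qed.

Lemma cos_le4_pos x : 0 <= x -> 0 <= (1 - x ^ 2 / 2 + x ^ 4 / 24) - cos x.
Proof.
  apply (nonneg_from_derive (fun x => (1 - x ^ 2 / 2 + x ^ 4 / 24) - cos x)
    (fun x => sin x - (x - x ^ 3 / 6))).
  - rewrite cos_0; lra.
  - intros y. auto_derive; auto; field.
  - apply sin_ge3.
Qed.

Lemma sin_le5 x : 0 <= x -> 0 <= (x - x ^ 3 / 6 + x ^ 5 / 120) - sin x.
Proof.
  apply (nonneg_from_derive (fun x => (x - x ^ 3 / 6 + x ^ 5 / 120) - sin x)
    (fun x => (1 - x ^ 2 / 2 + x ^ 4 / 24) - cos x)).
  - rewrite sin_0; lra.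
  - intros y. auto_derive; auto; field.
  - apply cos_le4_pos.
Qed.

Lemma cos_ge6 x : 0 <= x -> 0 <= cos x - (1 - x ^ 2 / 2 + x ^ 4 / 24 - x ^ 6 / 720).
Proof.
  apply (nonneg_from_derive (fun x => cos x - (1 - x ^ 2 / 2 + x ^ 4 / 24 - x ^ 6 / 720))
    (fun x => (x - x ^ 3 / 6 + x ^ 5 / 120) - sin x)).
  - rewrite cos_0; lra.
  - intros y. auto_derive; auto; field.
  - apply sin_le5.
Qed.

Lemma sin_ge7 x : 0 <= x -> 0 <= sin x - (x - x ^ 3 / 6 + x ^ 5 / 120 - x ^ 7 / 5040).
Proof.
  apply (nonneg_from_derive (fun x => sin x - (x - x ^ 3 / 6 + x ^ 5 / 120 - x ^ 7 / 5040))
    (fun x => cos x - (1 - x ^ 2 / 2 + x ^ 4 / 24 - x ^ 6 / 720))).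
  - rewrite sin_0; lra.
  - intros y. auto_derive; auto; field.
  - apply cos_ge6.
Qed.

Lemma cos_ge2 x : 1 - x ^ 2 / 2 <= cos x.
Proof.
  destruct (Rle_lt_dec 0 x) as [H|H].
  - pose proof (cos_ge2_pos x H). lra.
  - pose proof (cos_ge2_pos (- x)). rewrite cos_neg in H0.
    replace ((- x) ^ 2) with (x ^ 2) in H0 by ring. lra.
Qed.

Lemma cos_le4 x : cos x <= 1 - x ^ 2 / 2 + x ^ 4 / 24.
Proof.
  destruct (Rle_lt_dec 0 x) as [H|H].
  - pose proof (cos_le4_pos x H). lra.
  - pose proof (cos_le4_pos (- x)). rewrite cos_neg in H0.
    replace ((- x) ^ 2) with (x ^ 2) in H0 by ring.
    replace ((- x) ^ 4) with (x ^ 4) in H0 by ring. lra.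
Qed.

Lemma abs_sin_le x : Rabs (sin x) <= Rabs x.
Proof.
  assert (P : forall y, 0 <= y -> Rabs (sin y) <= y).
  { intros y Hy. pose proof (sin_le_id y Hy).
    pose proof (sin_le_id y Hy). apply Rabs_le. split; [|lra].
    pose proof (nonneg_from_derive (fun x => x + sin x) (fun x => 1 + cos x)) as Q.
    assert (0 <= y + sin y); [|lra]. apply Q; auto.
    - rewrite sin_0; lra.
    - intros z. auto_derive; auto; lra.
    - intros z _. pose proof (COS_bound z). lra. }
  destruct (Rle_lt_dec 0 x) as [H|H].
  - rewrite (Rabs_pos_eq x) by auto. auto.
  - rewrite <- (Rabs_Ropp x), <- (Rabs_Ropp (sin x)), <- sin_neg.
    rewrite (Rabs_pos_eq (- x)) by lra. apply P; lra.
Qed.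

Lemma cos_plus_nPI n x : cos (x + INR n * PI) = (-1) ^ n * cos x.
Proof.
  induction n as [|n IH]; [simpl; rewrite Rmult_0_l, Rplus_0_r; ring|].
  rewrite S_INR. replace (x + (INR n + 1) * PI) with (x + INR n * PI + PI) by ring.
  rewrite neg_cos, IH. simpl. ring.
Qed.

Lemma cos_period_Z (n : Z) x : cos (x + 2 * IZR n * PI) = cos x.
Proof.
  destruct (Z.le_gt_cases 0 n) as [H|H].
  - rewrite <- (Z2Nat.id n H), <- INR_IZR_INZ. apply cos_period.
  - rewrite <- (cos_period (x + 2 * IZR n * PI) (Z.to_nat (- n))).
    f_equal. rewrite INR_IZR_INZ, Z2Nat.id, opp_IZR by lia. ring.
Qed.

(** * Derivatives of the kernel *)

Lemma is_derive_lsum {A} (f : A -> R -> R) (f' : A -> R) l z :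
  (forall x, In x l -> is_derive (f x) z (f' x)) ->
  is_derive (fun z => lsum (fun x => f x z) l) z (lsum f' l).
Proof.
  induction l as [|x l IH]; simpl; intros H.
  - apply (is_derive_const (V := R_NormedModule)).
  - apply (is_derive_plus (V := R_NormedModule)); auto.
Qed.

(* [K N k] is the [k]-th derivative of the kernel in the variable
   [z = 2 PI N t], in which frequencies lie in [-6, 6]. *)
Definition K (N k : nat) (z : R) : R :=
  lsum (fun p => fst p * (IZR (snd p) / (2 * INR N)) ^ k
          * cos (IZR (snd p) / (2 * INR N) * z + INR k * (PI / 2))) (ker N).

Lemma is_derive_K N k z : is_derive (K N k) z (K N (S k) z).
Proof.
  unfold K. apply is_derive_lsum. intros p _.
  set (th := IZR (snd p) / (2 * INR N)).
  auto_derive; auto.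
  rewrite S_INR. replace (th * z + (INR k + 1) * (PI / 2))
    with (th * z + INR k * (PI / 2) + PI / 2) by field.
  rewrite (cos_plus _ (PI / 2)), cos_PI2, sin_PI2. simpl. ring.
Qed.

Lemma K_opp N k z : K N k (- z) = (-1) ^ k * K N k z.
Proof.
  unfold K. rewrite <- lsum_scal. apply lsum_ext. intros p _.
  set (th := IZR (snd p) / (2 * INR N)).
  replace (th * - z + INR k * (PI / 2)) with (- (th * z - INR k * (PI / 2))) by ring.
  rewrite cos_neg.
  replace (th * z + INR k * (PI / 2)) with (th * z - INR k * (PI / 2) + INR k * PI) by field.
  rewrite cos_plus_nPI.
  replace ((-1) ^ k * (fst p * th ^ k * ((-1) ^ k * cos (th * z - INR k * (PI / 2)))))
    with ((-1 * -1) ^ k * (fst p * th ^ k * cos (th * z - INR k * (PI / 2))))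
    by (rewrite Rpow_mult_distr; ring).
  replace (-1 * -1) with 1 by ring. rewrite pow1. ring.
Qed.

Lemma abs_K_opp N k z : Rabs (K N k (- z)) = Rabs (K N k z).
Proof. rewrite K_opp, Rabs_mult, pow_1_abs. ring. Qed.

Lemma abs_K_abs N k z : Rabs (K N k (Rabs z)) = Rabs (K N k z).
Proof. unfold Rabs at 2. destruct (Rcase_abs z); [apply abs_K_opp|reflexivity]. Qed.

Lemma K_period N k (n : Z) z : (0 < N)%nat -> K N k (z + 2 * PI * INR N * IZR n) = K N k z.
Proof.
  intros HN. assert (0 < INR N) by (apply lt_0_INR; lia).
  unfold K. apply lsum_ext. intros p Hp. f_equal.
  destruct (even_ker N p Hp) as [m E]. rewrite E, mult_IZR.
  rewrite <- (cos_period_Z (m * n) (2 * IZR m / (2 * INR N) * z + INR k * (PI / 2))).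
  f_equal. rewrite mult_IZR. field. lra.
Qed.

Definition scaled_moment (N k : nat) : R := moment k (ker N) / (2 * INR N) ^ k.

Lemma lsum_scaled_moment N k : (0 < N)%nat ->
  lsum (fun p => fst p * (IZR (snd p) / (2 * INR N)) ^ k) (ker N) = scaled_moment N k.
Proof.
  intros HN. assert (0 < INR N) by (apply lt_0_INR; lia).
  unfold scaled_moment. transitivity (/ (2 * INR N) ^ k * moment k (ker N)); [|field; apply pow_nonzero; lra].
  unfold moment. rewrite <- lsum_scal.
  apply lsum_ext. intros p _. unfold Rdiv. rewrite Rpow_mult_distr, pow_inv. ring.
Qed.

Lemma scaled_moment0 N : (0 < N)%nat -> scaled_moment N 0 = 1.
Proof. intros. unfold scaled_moment. rewrite moment0_ker by auto. simpl. field. Qed.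

Lemma scaled_moment2 N : (0 < N)%nat -> scaled_moment N 2 = 25 / 6.
Proof.
  intros. assert (0 < INR N) by (apply lt_0_INR; lia).
  unfold scaled_moment. rewrite moment2_ker by auto. field. lra.
Qed.

Lemma scaled_moment4 N : (166 <= N)%nat -> scaled_moment N 4 <= 4408 / 100.
Proof.
  intros. assert (0 < INR N) by (apply lt_0_INR; lia).
  unfold scaled_moment. apply (Rmult_le_reg_r ((2 * INR N) ^ 4)); [apply pow_lt; lra|].
  unfold Rdiv. rewrite Rmult_assoc, Rinv_l, Rmult_1_r by (apply pow_nonzero; lra).
  eapply Rle_trans; [apply moment4_ker; auto|].
  rewrite Rpow_mult_distr. apply Req_le. field.
Qed.

Lemma K_at_0 N : (0 < N)%nat -> K N 0 0 = 1.
Proof.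
  intros HN. rewrite <- (scaled_moment0 N HN), <- lsum_scaled_moment by auto.
  unfold K. apply lsum_ext. intros p _. simpl INR.
  rewrite Rmult_0_r, Rmult_0_l, Rplus_0_l, cos_0. ring.
Qed.

Lemma K1_at_0 N : K N 1 0 = 0.
Proof.
  pose proof (K_opp N 1 0) as E. rewrite Ropp_0 in E. simpl in E. lra.
Qed.

Lemma K2_at_0 N : (0 < N)%nat -> K N 2 0 = - (25 / 6).
Proof.
  intros HN. rewrite <- (scaled_moment2 N HN), <- lsum_scaled_moment by auto.
  replace (- lsum (fun p => fst p * (IZR (snd p) / (2 * INR N)) ^ 2) (ker N))
    with (-1 * lsum (fun p => fst p * (IZR (snd p) / (2 * INR N)) ^ 2) (ker N)) by ring.
  rewrite <- lsum_scal. unfold K. apply lsum_ext. intros p _.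
  replace (IZR (snd p) / (2 * INR N) * 0 + INR 2 * (PI / 2)) with PI by (simpl INR; lra).
  rewrite cos_PI. ring.
Qed.

(* The weights are nonnegative, so each derivative of the kernel is largest at
   [0], where it is a moment of the frequencies. *)
Lemma K_termwise N (f g : R * Z -> R) :
  (forall p, Rabs (f p) <= g p) ->
  Rabs (lsum (fun p => fst p * f p) (ker N)) <= lsum (fun p => fst p * g p) (ker N).
Proof.
  intros H. eapply Rle_trans; [apply lsum_abs|]. apply lsum_le. intros p Hp.
  pose proof (nonneg_ker N p Hp).
  rewrite Rabs_mult, (Rabs_pos_eq (fst p)) by auto. apply Rmult_le_compat_l; auto.
Qed.

Lemma abs_K_le N k z (g : R -> R) :
  (forall th, Rabs (th ^ k) * Rabs (cos (th * z + INR k * (PI / 2))) <= g th) ->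
  Rabs (K N k z) <= lsum (fun p => fst p * g (IZR (snd p) / (2 * INR N))) (ker N).
Proof.
  intros H. unfold K.
  rewrite (lsum_ext _ (fun p => fst p * ((IZR (snd p) / (2 * INR N)) ^ k *
     cos (IZR (snd p) / (2 * INR N) * z + INR k * (PI / 2))))) by (intros; ring).
  apply K_termwise. intros p. rewrite Rabs_mult. apply H.
Qed.

Lemma abs_cos_le x : Rabs (cos x) <= 1.
Proof. apply Rabs_le. apply COS_bound. Qed.

Lemma abs_K2_le N z : (0 < N)%nat -> Rabs (K N 2 z) <= 25 / 6.
Proof.
  intros HN. rewrite <- (scaled_moment2 N HN), <- lsum_scaled_moment by auto.
  apply (abs_K_le N 2 z (fun th => th ^ 2)). intros th.
  pose proof (abs_cos_le (th * z + INR 2 * (PI / 2))).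
  rewrite (Rabs_pos_eq (th ^ 2)) by apply pow2_ge_0. pose proof (pow2_ge_0 th). nra.
Qed.

Lemma pow4_ge_0 x : 0 <= x ^ 4.
Proof. replace (x ^ 4) with ((x ^ 2) ^ 2) by ring. apply pow2_ge_0. Qed.

Lemma abs_K4_le N z : (166 <= N)%nat -> Rabs (K N 4 z) <= 4408 / 100.
Proof.
  intros HN. eapply Rle_trans; [|apply (scaled_moment4 N HN)].
  rewrite <- lsum_scaled_moment by lia.
  apply (abs_K_le N 4 z (fun th => th ^ 4)). intros th.
  pose proof (abs_cos_le (th * z + INR 4 * (PI / 2))).
  pose proof (pow4_ge_0 th). rewrite Rabs_pos_eq by auto. nra.
Qed.

Lemma abs_pow3 x : Rabs (x ^ 3) = Rabs x * x ^ 2.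
Proof.
  replace (x ^ 3) with (x * x ^ 2) by ring. rewrite Rabs_mult, (Rabs_pos_eq (x ^ 2)); auto.
  apply pow2_ge_0.
Qed.

(** Odd absolute moments have no closed form here, so [|th|^3] is bounded by even powers:
    [2/13 * th^2 * (|th| - 13/4)^2 >= 0]. The value 13/4 is close to the optimum, the square root of
    44.08 / (25/6). *)
Lemma abs_K3_le N z : (166 <= N)%nat -> Rabs (K N 3 z) <= 136 / 10.
Proof.
  intros HN.
  apply Rle_trans with (13 / 8 * scaled_moment N 2 + 2 / 13 * scaled_moment N 4).
  2:{ rewrite scaled_moment2 by lia. pose proof (scaled_moment4 N HN). lra. }
  rewrite <- !lsum_scaled_moment by lia.
  rewrite <- !lsum_scal, <- lsum_plus.
  eapply Rle_trans; [apply (abs_K_le N 3 z (fun th => 13 / 8 * th ^ 2 + 2 / 13 * th ^ 4))|].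
  - intros th. pose proof (abs_cos_le (th * z + INR 3 * (PI / 2))).
    rewrite abs_pow3. pose proof (Rabs_pos th). pose proof (pow2_ge_0 th).
    set (c := Rabs (cos _)) in *.
    assert (0 <= c) by apply Rabs_pos.
    assert (E : th ^ 2 = Rabs th ^ 2) by (rewrite RPow_abs, Rabs_pos_eq; auto).
    replace (th ^ 4) with (th ^ 2 * th ^ 2) by ring. rewrite E in *.
    set (t := Rabs th) in *.
    assert (0 <= (t - 13 / 4) ^ 2) by apply pow2_ge_0.
    assert (0 <= t ^ 2 * (t - 13 / 4) ^ 2) by (apply Rmult_le_pos; auto).
    assert (t * t ^ 2 * c <= t * t ^ 2).
    { rewrite <- (Rmult_1_r (t * t ^ 2)) at 2. apply Rmult_le_compat_l; auto.
      apply Rmult_le_pos; auto. }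
    nra.
  - apply Req_le, lsum_ext. intros. ring.
Qed.

(** The third derivative is a sum of sines and vanishes at 0; this is what makes the curvature
    estimate sharp close to a node. *)
Lemma abs_K3_le_abs N z : (166 <= N)%nat -> Rabs (K N 3 z) <= 4408 / 100 * Rabs z.
Proof.
  intros HN.
  apply Rle_trans with (scaled_moment N 4 * Rabs z).
  2:{ apply Rmult_le_compat_r; [apply Rabs_pos|apply scaled_moment4; auto]. }
  rewrite <- lsum_scaled_moment by lia.
  rewrite Rmult_comm, <- lsum_scal.
  eapply Rle_trans; [apply (abs_K_le N 3 z (fun th => th ^ 4 * Rabs z))|].
  - intros th. replace (INR 3 * (PI / 2)) with (3 * (PI / 2)) by (simpl; ring).
    rewrite cos_plus, cos_3PI2, sin_3PI2.
    replace (cos (th * z) * 0 - sin (th * z) * -1) with (sin (th * z)) by ring.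
    pose proof (abs_sin_le (th * z)) as H. rewrite Rabs_mult in H.
    pose proof (Rabs_pos th). pose proof (pow2_ge_0 th).
    rewrite abs_pow3.
    replace (th ^ 4) with ((Rabs th * Rabs th) * th ^ 2)
      by (rewrite <- Rabs_mult, Rabs_pos_eq by apply Rle_0_sqr; ring).
    assert (0 <= Rabs th * th ^ 2) by (apply Rmult_le_pos; auto).
    replace (Rabs th * Rabs th * th ^ 2 * Rabs z)
      with ((Rabs th * th ^ 2) * (Rabs th * Rabs z)) by ring.
    apply Rmult_le_compat_l; auto.
  - apply Req_le, lsum_ext. intros. ring.
Qed.

(** Nonnegative weights allow the Taylor inequality of the cosine to be summed term by term; 25/12
    is half the second moment 25/6. *)
Lemma K0_ge N z : (0 < N)%nat -> 1 - 25 / 12 * z ^ 2 <= K N 0 z.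
Proof.
  intros HN.
  replace (1 - 25 / 12 * z ^ 2) with (scaled_moment N 0 + - (z ^ 2 / 2) * scaled_moment N 2)
    by (rewrite scaled_moment0, scaled_moment2 by auto; field).
  rewrite <- !lsum_scaled_moment, <- lsum_scal, <- lsum_plus by auto.
  unfold K. apply lsum_le. intros p Hp. pose proof (nonneg_ker N p Hp).
  set (th := IZR (snd p) / (2 * INR N)).
  pose proof (cos_ge2 (th * z + INR 0 * (PI / 2))) as C. simpl INR in *.
  rewrite Rmult_0_l, Rplus_0_r in *. simpl pow at 1. simpl pow at 3. rewrite !Rmult_1_r.
  replace (fst p + - (z ^ 2 / 2) * (fst p * th ^ 2)) with (fst p * (1 - (th * z) ^ 2 / 2)) by field.
  apply Rmult_le_compat_l; auto.
Qed.

Lemma K0_le N z : (166 <= N)%nat ->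
  K N 0 z <= 1 - 25 / 12 * z ^ 2 + 4408 / 2400 * z ^ 4.
Proof.
  intros HN.
  apply Rle_trans with (scaled_moment N 0 + - (z ^ 2 / 2) * scaled_moment N 2
    + z ^ 4 / 24 * scaled_moment N 4).
  2:{ rewrite scaled_moment0, scaled_moment2 by lia. pose proof (scaled_moment4 N HN).
      pose proof (pow4_ge_0 z). nra. }
  rewrite <- !lsum_scaled_moment, <- !lsum_scal, <- !lsum_plus by lia.
  unfold K. apply lsum_le. intros p Hp. pose proof (nonneg_ker N p Hp).
  set (th := IZR (snd p) / (2 * INR N)).
  pose proof (cos_le4 (th * z + INR 0 * (PI / 2))) as C. simpl INR in *.
  rewrite Rmult_0_l, Rplus_0_r in *.
  replace (th ^ 0) with 1 by reflexivity. rewrite !Rmult_1_r.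
  replace (fst p + - (z ^ 2 / 2) * (fst p * th ^ 2) + z ^ 4 / 24 * (fst p * th ^ 4))
    with (fst p * (1 - (th * z) ^ 2 / 2 + (th * z) ^ 4 / 24)) by field.
  apply Rmult_le_compat_l; auto.
Qed.

Lemma abs_K0_le N z : (0 < N)%nat -> Rabs (K N 0 z) <= 1.
Proof.
  intros HN. rewrite <- (scaled_moment0 N HN), <- lsum_scaled_moment by auto.
  apply (abs_K_le N 0 z (fun th => th ^ 0)). intros th. simpl pow.
  rewrite Rabs_R1, Rmult_1_l. apply abs_cos_le.
Qed.

(** * Bounds on pi *)

(** If [PI / 4 <= 0.785], monotonicity and [sin (PI / 4) = cos (PI / 4)] give
    [cos 0.785 <= sin 0.785], against the Taylor bounds. The upper bound is the mirror image at
    0.7875. *)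
Lemma PI_lower : 314 / 100 < PI.
Proof.
  destruct (Rlt_le_dec (314 / 100) PI) as [H|H]; [auto|exfalso].
  pose proof PI2_1. pose proof (cos_ge6 (785 / 1000) ltac:(lra)). pose proof (sin_le5 (785 / 1000) ltac:(lra)).
  assert (sin (PI / 4) <= sin (785 / 1000)) by (apply sin_incr_1; lra).
  assert (cos (785 / 1000) <= cos (PI / 4)) by (apply cos_decr_1; lra).
  pose proof sin_cos_PI4. lra.
Qed.

Lemma PI_upper : PI < 315 / 100.
Proof.
  destruct (Rlt_le_dec PI (315 / 100)) as [H|H]; [auto|exfalso].
  pose proof PI2_1. pose proof (sin_ge7 (7875 / 10000) ltac:(lra)). pose proof (cos_le4 (7875 / 10000)).
  assert (sin (7875 / 10000) <= sin (PI / 4)) by (apply sin_incr_1; lra).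
  assert (cos (PI / 4) <= cos (7875 / 10000)) by (apply cos_decr_1; lra).
  pose proof sin_cos_PI4. lra.
Qed.

(** * Closed form of the kernel *)

(* On [0 < z < 2 PI N], [30 * K N 0 z = F 0 z * Gn N 0 z], where [F k] and
   [gam k * Gn N k] are the [k]-th derivatives of [F 0] and [Gn N 0], with
   [gam = 1, -3, 12, -60]: thus [Gn N k] is close to [z ^ -(3 + k)]. *)
Definition F (k : nat) (z : R) : R :=
  sin (z + INR k * (PI / 2)) + 2 ^ k * sin (2 * z + INR k * (PI / 2))
  + 3 ^ k * sin (3 * z + INR k * (PI / 2)) - 6 ^ k * sin (6 * z + INR k * (PI / 2)).

Definition Gn (N k : nat) (z : R) : R :=
  let n := 2 * INR N in
  let s := sin (z / n) in
  let c := cos (z / n) in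
  match k with
  | 0%nat => c / (n * s) ^ 3
  | 1%nat => / (n * s) ^ 4 * (1 - 2 / 3 * s ^ 2)
  | 2%nat => c / (n * s) ^ 5 * (1 - s ^ 2 / 3)
  | _ => / (n * s) ^ 6 * (1 - s ^ 2 + 2 / 15 * s ^ 4)
  end.

Lemma is_derive_F k z : is_derive (F k) z (F (S k) z).
Proof.
  unfold F. auto_derive; auto.
  assert (E : forall y, sin (y + INR (S k) * (PI / 2)) = cos (y + INR k * (PI / 2))).
  { intros y. rewrite S_INR.
    replace (y + (INR k + 1) * (PI / 2)) with (y + INR k * (PI / 2) + PI / 2) by field.
    rewrite sin_plus, cos_PI2, sin_PI2. ring. }
  rewrite !E. simpl. ring.
Qed.

Lemma is_derive_Gn0 N z : (0 < N)%nat -> sin (z / (2 * INR N)) <> 0 ->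
  is_derive (Gn N 0) z (-3 * Gn N 1 z).
Proof.
  intros HN Hs. assert (0 < INR N) by (apply lt_0_INR; lia).
  unfold Gn. auto_derive.
  - repeat apply Rmult_integral_contrapositive_currified; auto; lra.
  - replace (z * / (2 * INR N)) with (z / (2 * INR N)) by reflexivity.
    pose proof (sin2_cos2 (z / (2 * INR N))) as E. unfold Rsqr in E.
    set (s := sin _) in *. set (c := cos _) in *. clearbody s c.
    (* The two sides agree only modulo [s^2 + c^2 = 1]; their difference is exhibited as a multiple
       of [s * s + c * c - 1]. *)
    apply Rminus_diag_uniq.
    match goal with |- ?a = 0 =>
      replace a with ((s * s + c * c - 1) * (-3 / ((2 * INR N) ^ 4 * s ^ 4))) by (field; split; lra)
    end.
    rewrite E. field. split; lra.
Qed.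

Lemma is_derive_Gn1 N z : (0 < N)%nat -> sin (z / (2 * INR N)) <> 0 ->
  is_derive (Gn N 1) z (-4 * Gn N 2 z).
Proof.
  intros HN Hs. assert (0 < INR N) by (apply lt_0_INR; lia).
  unfold Gn. auto_derive.
  - repeat apply Rmult_integral_contrapositive_currified; auto; lra.
  - replace (z * / (2 * INR N)) with (z / (2 * INR N)) by reflexivity.
    set (s := sin _) in *. set (c := cos _) in *. clearbody s c. field. split; lra.
Qed.

Lemma is_derive_Gn2 N z : (0 < N)%nat -> sin (z / (2 * INR N)) <> 0 ->
  is_derive (Gn N 2) z (-5 * Gn N 3 z).
Proof.
  intros HN Hs. assert (0 < INR N) by (apply lt_0_INR; lia).
  unfold Gn. auto_derive.
  - repeat apply Rmult_integral_contrapositive_currified; auto; lra.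
  - replace (z * / (2 * INR N)) with (z / (2 * INR N)) by reflexivity.
    pose proof (sin2_cos2 (z / (2 * INR N))) as E. unfold Rsqr in E.
    set (s := sin _) in *. set (c := cos _) in *. clearbody s c.
    apply Rminus_diag_uniq.
    match goal with |- ?a = 0 =>
      replace a with ((s * s + c * c - 1) * ((-5 / s ^ 6 + / s ^ 4) / (2 * INR N) ^ 6))
        by (field; split; lra)
    end.
    rewrite E. field. split; lra.
Qed.

Lemma sin_scaled_pos N z : (0 < N)%nat -> 0 < z < 2 * PI * INR N ->
  0 < sin (z / (2 * INR N)).
Proof.
  intros HN Hz. assert (0 < INR N) by (apply lt_0_INR; lia).
  apply sin_gt_0.
  - apply Rdiv_lt_0_compat; lra.
  - apply (Rmult_lt_reg_r (2 * INR N)); [lra|].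
    unfold Rdiv. rewrite Rmult_assoc, Rinv_l, Rmult_1_r by lra. lra.
Qed.

Lemma ceval_dirichlet_eq M u : (0 < M)%nat -> sin u <> 0 ->
  ceval (dirichlet M) u = sin (INR M * u) / (INR M * sin u).
Proof.
  intros HM Hs. assert (0 < INR M) by (apply lt_0_INR; lia).
  rewrite <- (ceval_dirichlet M u HM). field. split; lra.
Qed.

(** With [w = z / 2], the identity [4 sin 3w sin 4w sin 5w = sin 2w + sin 4w + sin 6w - sin 12w]
    turns the product of Dirichlet kernels into [F 0]. The 30 is [3 * 4 * 5 * 4 / 8], the 8 coming
    from the cube of [2 N sin (z / (2 N))]. *)
Lemma K0_closed N z : (0 < N)%nat -> 0 < z < 2 * PI * INR N ->
  30 * K N 0 z = F 0 z * Gn N 0 z.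
Proof.
  intros HN Hz. assert (0 < INR N) by (apply lt_0_INR; lia).
  pose proof (sin_scaled_pos N z HN Hz) as Hs.
  set (u := z / (2 * INR N)) in *.
  assert (Hu : z = 2 * INR N * u) by (unfold u; field; lra).
  assert (E : K N 0 z = ceval (ker N) u).
  { unfold K, ceval. apply lsum_ext. intros p _. simpl INR. simpl pow.
    rewrite Rmult_1_r. f_equal. f_equal. unfold u. field. lra. }
  rewrite E. unfold ker. rewrite !ceval_cprod, !ceval_dirichlet_eq by (lia || lra).
  rewrite !mult_INR. replace (INR 3) with 3 by (simpl; ring).
  replace (INR 4) with 4 by (simpl; ring). replace (INR 5) with 5 by (simpl; ring).
  replace (INR 2) with 2 by (simpl; ring).
  rewrite sin_2a.
  unfold F, Gn. fold u. simpl INR. rewrite !Rmult_0_l, !Rplus_0_r. simpl pow.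
  set (w := INR N * u).
  replace (sin z + 1 * sin (2 * z) + 1 * sin (3 * z) - 1 * sin (6 * z))
    with (4 * (sin (3 * w) * sin (5 * w) * sin (4 * w))).
  2:{ replace z with (2 * w) by (unfold w; lra).
      replace (2 * w) with (3 * w + 4 * w - 5 * w) at 1 by ring.
      replace (2 * (2 * w)) with (3 * w + 5 * w - 4 * w) by ring.
      replace (3 * (2 * w)) with (4 * w + 5 * w - 3 * w) by ring.
      replace (6 * (2 * w)) with (3 * w + 4 * w + 5 * w) by ring.
      rewrite !sin_minus, !sin_plus, !cos_plus.
      generalize (sin (3 * w)), (cos (3 * w)), (sin (4 * w)), (cos (4 * w)),
        (sin (5 * w)), (cos (5 * w)). intros. ring. }
  replace (3 * INR N * u) with (3 * w) by (unfold w; ring).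
  replace (4 * INR N * u) with (4 * w) by (unfold w; ring).
  replace (5 * INR N * u) with (5 * w) by (unfold w; ring).
  field. split; lra.
Qed.

Lemma is_derive_eq_on (f g : R -> R) a b z f' g' :
  a < z < b -> (forall y, a < y < b -> f y = g y) ->
  is_derive f z f' -> is_derive g z g' -> f' = g'.
Proof.
  intros Hz E Hf Hg.
  rewrite <- (is_derive_unique f z f' Hf).
  apply is_derive_unique. apply (is_derive_ext_loc g); auto.
  assert (He : 0 < Rmin (z - a) (b - z)) by (apply Rmin_glb_lt; lra).
  exists (mkposreal _ He). intros y Hy. symmetry. apply E.
  change (Rabs (y - z) < Rmin (z - a) (b - z)) in Hy.
  apply Rabs_lt_between in Hy.
  pose proof (Rmin_l (z - a) (b - z)). pose proof (Rmin_r (z - a) (b - z)). lra.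
Qed.

(* The Leibniz formula: [(c, i, j)] stands for [c * F i * Gn j]. *)
Definition leibniz (k : nat) : list (Z * (nat * nat)) :=
  match k with
  | 0%nat => [(1, (0, 0)%nat)]
  | 1%nat => [(1, (1, 0)%nat); (-3, (0, 1)%nat)]
  | 2%nat => [(1, (2, 0)%nat); (-6, (1, 1)%nat); (12, (0, 2)%nat)]
  | _ => [(1, (3, 0)%nat); (-9, (2, 1)%nat); (36, (1, 2)%nat); (-60, (0, 3)%nat)]
  end%Z.

Definition leibniz_sum (N k : nat) (z : R) : R :=
  lsum (fun p => IZR (fst p) * (F (fst (snd p)) z * Gn N (snd (snd p)) z)) (leibniz k).

Lemma is_derive_leibniz N k z : (0 < N)%nat -> (k < 3)%nat -> 0 < z < 2 * PI * INR N ->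
  is_derive (leibniz_sum N k) z (leibniz_sum N (S k) z).
Proof.
  intros HN Hk Hz. pose proof (sin_scaled_pos N z HN Hz) as Hs.
  assert (Hs' : sin (z / (2 * INR N)) <> 0) by lra.
  pose proof (is_derive_Gn0 N z HN Hs') as D0.
  pose proof (is_derive_Gn1 N z HN Hs') as D1.
  pose proof (is_derive_Gn2 N z HN Hs') as D2.
  assert (P : forall c i j g', is_derive (Gn N j) z g' ->
    is_derive (fun z => IZR c * (F i z * Gn N j z)) z
      (IZR c * (F (S i) z * Gn N j z + F i z * g'))).
  { intros c i j g' D. apply (is_derive_scal (fun z => F i z * Gn N j z)).
    apply (is_derive_mult (F i) (Gn N j) z _ _ (is_derive_F i z) D).
    intros; apply Rmult_comm. }
  destruct k as [|[|[|k]]]; [| | |lia]; unfold leibniz_sum, leibniz; cbn [lsum fold_right fst snd].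
  - evar_last.
    + apply (is_derive_plus (V := R_NormedModule)); [apply P, D0|].
      apply (is_derive_const (V := R_NormedModule)).
    + unfold plus, zero; simpl. ring.
  - evar_last.
    + apply (is_derive_plus (V := R_NormedModule)); [apply P, D0|].
      apply (is_derive_plus (V := R_NormedModule)); [apply P, D1|].
      apply (is_derive_const (V := R_NormedModule)).
    + unfold plus, zero; simpl. ring.
  - evar_last.
    + apply (is_derive_plus (V := R_NormedModule)); [apply P, D0|].
      apply (is_derive_plus (V := R_NormedModule)); [apply P, D1|].
      apply (is_derive_plus (V := R_NormedModule)); [apply P, D2|].
      apply (is_derive_const (V := R_NormedModule)).
    + unfold plus, zero; simpl. ring.
Qed.

Lemma K_closed N k z : (0 < N)%nat -> (k <= 3)%nat -> 0 < z < 2 * PI * INR N ->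
  30 * K N k z = leibniz_sum N k z.
Proof.
  intros HN. revert z. induction k as [|k IH]; intros z Hk Hz.
  - rewrite K0_closed by auto. unfold leibniz_sum, leibniz. cbn [lsum fold_right fst snd]. ring.
  - apply (is_derive_eq_on (fun z => 30 * K N k z) (leibniz_sum N k) 0 (2 * PI * INR N) z); auto.
    + intros y Hy. apply IH; [lia|auto].
    + apply (is_derive_scal (K N k)), is_derive_K.
    + apply is_derive_leibniz; auto; lia.
Qed.

Lemma abs_F_le k z : Rabs (F k z) <= 1 + 2 ^ k + 3 ^ k + 6 ^ k.
Proof.
  assert (P : forall a y, 0 <= a -> - a <= a * sin y <= a).
  { intros a y Ha. pose proof (SIN_bound y). split; nra. }
  unfold F.
  pose proof (P 1 (z + INR k * (PI / 2)) ltac:(lra)).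
  pose proof (P (2 ^ k) (2 * z + INR k * (PI / 2)) ltac:(apply pow_le; lra)).
  pose proof (P (3 ^ k) (3 * z + INR k * (PI / 2)) ltac:(apply pow_le; lra)).
  pose proof (P (6 ^ k) (6 * z + INR k * (PI / 2)) ltac:(apply pow_le; lra)).
  apply Rabs_le. lra.
Qed.

(* With [u = z / (2N)], [y = u^2] and [p = u / sin u], all [z^(3+k) * Gn N k z]
   are polynomials in [p], [y] and [cos u]. *)
Lemma Gn_normal N z : (0 < N)%nat -> 0 < z <= PI * INR N ->
  exists p c, let y := (z / (2 * INR N)) ^ 2 in
    1 <= p /\ p * (1 - y / 6) <= 1 /\ y <= p ^ 2 /\ 0 <= c <= 1 /\
    1 - y / 2 <= c <= 1 - y / 2 + y ^ 2 / 24 /\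
    z ^ 3 * Gn N 0 z = p ^ 3 * c /\
    z ^ 4 * Gn N 1 z = p ^ 4 - 2 / 3 * p ^ 2 * y /\
    z ^ 5 * Gn N 2 z = p * (p ^ 4 - p ^ 2 * y / 3) * c /\
    z ^ 6 * Gn N 3 z = p ^ 6 - p ^ 4 * y + 2 / 15 * p ^ 2 * y ^ 2.
Proof.
  intros HN Hz. assert (HN' : 0 < INR N) by (apply lt_0_INR; lia). pose proof PI_RGT_0.
  assert (Hz2 : 0 < z < 2 * PI * INR N) by (split; [lra|]; nra).
  pose proof (sin_scaled_pos N z HN Hz2) as Hs.
  set (u := z / (2 * INR N)) in *.
  assert (Hu : z = 2 * INR N * u) by (unfold u; field; lra).
  assert (Hu0 : 0 < u) by (apply Rdiv_lt_0_compat; lra).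
  assert (Hu1 : u <= PI / 2).
  { apply (Rmult_le_reg_l (2 * INR N)); [lra|]. rewrite <- Hu. lra. }
  pose proof (sin_le_id u ltac:(lra)) as S1. pose proof (sin_ge3 u ltac:(lra)) as S3.
  pose proof (SIN_bound u) as SB.
  exists (u / sin u), (cos u). cbv zeta.
  replace ((u ^ 2) ^ 2) with (u ^ 4) by ring.
  repeat split.
  - apply (Rmult_le_reg_r (sin u)); [auto|]. unfold Rdiv. rewrite Rmult_assoc, Rinv_l; lra.
  - apply (Rmult_le_reg_r (sin u)); [auto|].
    replace (u / sin u * (1 - u ^ 2 / 6) * sin u) with (u - u ^ 3 / 6) by (field; lra). lra.
  - apply (Rmult_le_reg_r (sin u ^ 2)); [apply pow_lt; auto|].
    replace ((u / sin u) ^ 2 * sin u ^ 2) with (u ^ 2) by (field; lra).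
    assert (sin u ^ 2 <= 1) by nra. pose proof (pow2_ge_0 u). nra.
  - apply cos_ge_0; lra.
  - apply COS_bound.
  - apply cos_ge2.
  - apply cos_le4.
  - unfold Gn. fold u. rewrite Hu. field. split; lra.
  - unfold Gn. fold u. rewrite Hu. field. split; lra.
  - unfold Gn. fold u. rewrite Hu. field. split; lra.
  - unfold Gn. fold u. rewrite Hu. field. split; lra.
Qed.

(** This makes a table free of [N] possible. With [u = z / (2N)] the relative error is at most
    [1.2 u^2], and [2N >= 332] gives [u^2 <= z^2 / 110224]; the final constant is rounded to
    [2^16]. *)
Lemma Gn_near N j z : (166 <= N)%nat -> (j <= 3)%nat -> 0 < z <= 8 ->
  Rabs (z ^ (3 + j) * Gn N j z - 1) <= z ^ 2 / 65536.
Proof.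
  intros HN Hj Hz.
  assert (HN' : 166 <= INR N) by (replace 166 with (INR 166) by (simpl; lra); apply le_INR; lia).
  pose proof PI_lower.
  destruct (Gn_normal N z) as (p & c & Hp1 & Hp2 & _ & Hc & Hc' & E0 & E1 & E2 & E3);
    [lia|split; [lra|nra]|].
  set (y := (z / (2 * INR N)) ^ 2) in *.
  assert (Hy0 : 0 <= y) by apply pow2_ge_0.
  assert (Hy : y <= z ^ 2 / 110224).
  { unfold y, Rdiv. rewrite Rpow_mult_distr. apply Rmult_le_compat_l; [apply pow2_ge_0|].
    rewrite pow_inv. apply Rinv_le_contravar; [lra|]. nra. }
  assert (Hy1 : y <= 6 / 10000) by nra.
  assert (Hp : p <= 1 + y / 5) by nra.
  assert (Q1 : 1 <= p ^ 2) by nra.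
  assert (Q2 : p ^ 2 <= 1 + 41 / 100 * y) by nra.
  clearbody y.
  apply Rle_trans with (12 / 10 * y); [|lra].
  assert (R1 : 1 <= p ^ 4 <= 1 + 83 / 100 * y)
    by (replace (p ^ 4) with (p ^ 2 * p ^ 2) by ring; nra).
  destruct j as [|[|[|[|j]]]]; [| | | |lia]; cbn [Nat.add]; apply Rabs_le.
  - rewrite E0. replace (p ^ 3) with (p * p ^ 2) by ring.
    assert (1 <= p * p ^ 2 <= 1 + 62 / 100 * y) by nra. nra.
  - rewrite E1. nra.
  - rewrite E2.
    assert (1 - y / 2 <= p ^ 4 - p ^ 2 * y / 3 <= 1 + 83 / 100 * y) by nra.
    assert (1 - y / 2 <= p * (p ^ 4 - p ^ 2 * y / 3) <= 1 + 11 / 10 * y) by nra.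
    nra.
  - rewrite E3. replace (p ^ 6) with (p ^ 4 * p ^ 2) by ring.
    assert (1 <= p ^ 4 * p ^ 2 <= 1 + 125 / 100 * y) by nra.
    assert (0 <= p ^ 2 * y ^ 2 <= y / 1000) by nra. nra.
Qed.

Lemma Rabs_le_scaled a b q : 0 < q -> Rabs (a * q) <= b * q -> Rabs a <= b.
Proof.
  intros Hq H. rewrite Rabs_mult, (Rabs_pos_eq q) in H by lra.
  apply (Rmult_le_reg_r q); auto.
Qed.

(** For [j > 0] these lie slightly above [8^-j], the value of [z^-j] at the start of the tail; the
    excess covers the growth of [u / sin u] as [u] approaches [PI / 2]. *)
Definition Gn_tail_const (j : nat) : R :=
  match j with 0%nat => 1 | 1%nat => 147 / 1000 | 2%nat => 158 / 10000 | _ => 2 / 1000 end.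

Lemma Gn_tail N j z : (166 <= N)%nat -> (j <= 3)%nat -> 8 <= z <= PI * INR N ->
  Rabs (z ^ 3 * Gn N j z) <= Gn_tail_const j.
Proof.
  intros HN Hj Hz.
  assert (HN' : 166 <= INR N) by (replace 166 with (INR 166) by (simpl; lra); apply le_INR; lia).
  pose proof PI_lower. pose proof PI_upper.
  destruct (Gn_normal N z) as (p & c & Hp1 & Hp2 & Hyp & Hc & Hc' & E0 & E1 & E2 & E3);
    [lia|lra|].
  set (y := (z / (2 * INR N)) ^ 2) in *.
  assert (Hy0 : 0 <= y) by apply pow2_ge_0.
  assert (Hu : 0 <= z / (2 * INR N) <= 1575 / 1000).
  { split; [apply Rlt_le, Rdiv_lt_0_compat; lra|].
    apply (Rmult_le_reg_r (2 * INR N)); [lra|].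
    unfold Rdiv at 1. rewrite Rmult_assoc, Rinv_l by lra. nra. }
  assert (Hy : y <= 249 / 100) by (unfold y; nra).
  (* One factor of [y = u^2] is bounded by 1.575, the other is [z / (2N)]. As [u] is large only when
     [z] is of order [N], a bound linear in [z] absorbs the growth of [u / sin u]. *)
  assert (Hyz : y <= 48 / 10000 * z).
  { replace y with (z / (2 * INR N) * / (2 * INR N) * z) by (unfold y; field; lra).
    apply Rmult_le_compat_r; [lra|].
    assert (/ (2 * INR N) <= / 332) by (apply Rinv_le_contravar; lra).
    assert (0 < / (2 * INR N)) by (apply Rinv_0_lt_compat; lra). nra. }
  assert (Hyz2 : y <= z ^ 2 / 110224).
  { unfold y, Rdiv. rewrite Rpow_mult_distr. apply Rmult_le_compat_l; [apply pow2_ge_0|].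
    rewrite pow_inv. apply Rinv_le_contravar; [lra|]. nra. }
  clearbody y.
  assert (Q0 : 1 <= p ^ 2) by nra.
  (* Follows from [p (1 - y/6) <= 1] and the factorisation [(1 + y) (1 - y/6)^2 - 1 = y (8 - y) (3 -
     y) / 36]. *)
  assert (Q : p ^ 2 <= 1 + y).
  { assert (0 < 1 - y / 6) by lra.
    apply (Rmult_le_reg_r ((1 - y / 6) ^ 2)); [apply pow_lt; auto|].
    apply Rle_trans with 1.
    - rewrite <- Rpow_mult_distr. assert (0 <= p * (1 - y / 6)) by nra. nra.
    - assert (0 <= y * (8 - y) * (3 - y)) by (repeat apply Rmult_le_pos; lra). nra. }
  assert (Q2 : 1 <= p ^ 4 <= (1 + y) ^ 2)
    by (replace (p ^ 4) with (p ^ 2 * p ^ 2) by ring; nra).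
  assert (Q3 : 1 <= p ^ 6 <= (1 + y) ^ 3).
  { replace (p ^ 6) with (p ^ 2 * p ^ 4) by ring. split; [nra|].
    replace ((1 + y) ^ 3) with ((1 + y) * (1 + y) ^ 2) by ring.
    apply Rmult_le_compat; lra. }
  assert (P6 : p ^ 6 <= 158 / 10000 * z ^ 2).
  { assert (64 <= z ^ 2) by nra.
    assert (y * (3 + 3 * y + y ^ 2) <= 167 / 10 * y)
      by (rewrite (Rmult_comm (167 / 10)); apply Rmult_le_compat_l; auto; nra). nra. }
  assert (P4 : p ^ 4 <= 147 / 1000 * z).
  { assert (y * (2 + y) <= 449 / 100 * y) by nra. nra. }
  assert (Hp5 : p * p ^ 4 <= p ^ 6).
  { replace (p ^ 6) with (p ^ 2 * p ^ 4) by ring. apply Rmult_le_compat_r; nra. }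
  assert (Hz3 : 0 < z ^ 3) by (apply pow_lt; lra).
  assert (A0 : 0 <= p ^ 2 * y <= p ^ 4).
  { replace (p ^ 4) with (p ^ 2 * p ^ 2) by ring.
    split; [apply Rmult_le_pos|apply Rmult_le_compat_l]; lra. }
  destruct j as [|[|[|[|j]]]]; [| | | |lia]; unfold Gn_tail_const.
  - rewrite E0. rewrite Rabs_pos_eq by (apply Rmult_le_pos; [apply pow_le|]; lra).
    (* [cos u <= (1 - y/6)^3], while [p (1 - y/6) <= 1] *)
    apply Rle_trans with ((p * (1 - y / 6)) ^ 3).
    + rewrite Rpow_mult_distr. apply Rmult_le_compat_l; [apply pow_le; lra|].
      assert (0 <= y ^ 2 * (9 - y)) by (apply Rmult_le_pos; [apply pow2_ge_0|lra]).
      nra.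
    + apply Rle_trans with (1 ^ 3); [|lra].
      apply pow_incr. split; [|auto]. apply Rmult_le_pos; lra.
  - apply (Rabs_le_scaled _ _ z); [lra|].
    replace (z ^ 3 * Gn N 1 z * z) with (z ^ 4 * Gn N 1 z) by ring. rewrite E1.
    replace (p ^ 4 - 2 / 3 * p ^ 2 * y) with (p ^ 4 - 2 / 3 * (p ^ 2 * y)) by ring.
    apply Rabs_le. lra.
  - apply (Rabs_le_scaled _ _ (z ^ 2)); [apply pow_lt; lra|].
    replace (z ^ 3 * Gn N 2 z * z ^ 2) with (z ^ 5 * Gn N 2 z) by ring. rewrite E2.
    assert (A : 0 <= p * (p ^ 4 - p ^ 2 * y / 3) <= p * p ^ 4)
      by (split; [apply Rmult_le_pos|apply Rmult_le_compat_l]; lra).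
    rewrite Rabs_pos_eq by (apply Rmult_le_pos; lra).
    apply Rle_trans with (p * (p ^ 4 - p ^ 2 * y / 3) * 1); [apply Rmult_le_compat_l|]; lra.
  - apply (Rabs_le_scaled _ _ (z ^ 3)); [auto|].
    replace (z ^ 3 * Gn N 3 z * z ^ 3) with (z ^ 6 * Gn N 3 z) by ring. rewrite E3.
    assert (A1 : 0 <= p ^ 2 * (p ^ 4 - p ^ 2 * y)) by (apply Rmult_le_pos; lra).
    assert (A2 : 0 <= y * (p ^ 4 - p ^ 2 * y)) by (apply Rmult_le_pos; lra).
    assert (A3 : 0 <= y * (p ^ 2 * y)) by (apply Rmult_le_pos; lra).
    assert (A4 : 0 <= 8 * z ^ 2 <= z ^ 3)
      by (replace (z ^ 3) with (z * z ^ 2) by ring; split; [nra|apply Rmult_le_compat_r; nra]).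
    replace (p ^ 6 - p ^ 4 * y + 2 / 15 * p ^ 2 * y ^ 2)
      with (p ^ 2 * (p ^ 4 - p ^ 2 * y) + 2 / 15 * (y * (p ^ 2 * y))) by ring.
    rewrite Rabs_pos_eq by lra.
    replace (p ^ 2 * (p ^ 4 - p ^ 2 * y)) with (p ^ 6 - p ^ 4 * y) in * by ring.
    replace (y * (p ^ 4 - p ^ 2 * y)) with (p ^ 4 * y - y * (p ^ 2 * y)) in * by ring.
    lra.
Qed.

(** One thirtieth of the Leibniz sum with every term replaced by its bound, rounded up. For [k = 1]
    that sum is [12 + 3 * 4 * 0.147]. *)
Definition tail_const (k : nat) : R :=
  match k with
  | 0%nat => 1374 / 10000 | 1%nat => 4635 / 10000 | 2%nat => 20515 / 10000 | _ => 109 / 10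
  end.

Lemma K_tail N k z : (166 <= N)%nat -> (k <= 3)%nat -> 8 <= z <= PI * INR N ->
  Rabs (K N k z) <= tail_const k / z ^ 3.
Proof.
  intros HN Hk Hz.
  assert (HN' : 166 <= INR N) by (replace 166 with (INR 166) by (simpl; lra); apply le_INR; lia).
  assert (Hz3 : 0 < z ^ 3) by (apply pow_lt; lra). pose proof PI_RGT_0.
  apply (Rabs_le_scaled _ _ (30 * z ^ 3)); [lra|].
  replace (tail_const k / z ^ 3 * (30 * z ^ 3)) with (30 * tail_const k) by (field; lra).
  replace (K N k z * (30 * z ^ 3)) with (z ^ 3 * (30 * K N k z)) by ring.
  rewrite K_closed by (auto; try lia; split; nra).
  unfold leibniz_sum. rewrite <- lsum_scal.
  eapply Rle_trans; [apply lsum_abs|].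
  apply Rle_trans with (lsum (fun p => Rabs (IZR (fst p)) *
    ((1 + 2 ^ fst (snd p) + 3 ^ fst (snd p) + 6 ^ fst (snd p)) * Gn_tail_const (snd (snd p))))
    (leibniz k)).
  - apply lsum_le. intros p Hp.
    assert (snd (snd p) <= 3)%nat.
    { destruct k as [|[|[|[|k]]]]; [| | | |lia]; unfold leibniz in Hp; simpl in Hp;
        intuition (subst; simpl; lia). }
    replace (z ^ 3 * (IZR (fst p) * (F (fst (snd p)) z * Gn N (snd (snd p)) z)))
      with (IZR (fst p) * (F (fst (snd p)) z * (z ^ 3 * Gn N (snd (snd p)) z))) by ring.
    rewrite !Rabs_mult. apply Rmult_le_compat_l; [apply Rabs_pos|].
    apply Rmult_le_compat; try apply Rabs_pos; [apply Rmult_le_pos; apply Rabs_pos| apply abs_F_le|].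
    rewrite <- Rabs_mult. apply Gn_tail; auto.
  - destruct k as [|[|[|[|k]]]]; [| | | |lia]; unfold leibniz, tail_const, Gn_tail_const;
      cbn [lsum fold_right fst snd];
      rewrite ?(Rabs_left (-3)), ?(Rabs_left (-6)), ?(Rabs_left (-9)), ?(Rabs_left (-60)) by lra;
      rewrite ?(Rabs_pos_eq 1), ?(Rabs_pos_eq 12), ?(Rabs_pos_eq 36) by lra; lra.
Qed.

(** * Ball arithmetic on scaled integers *)

Definition scale : Z := (2 ^ 48)%Z.

Lemma scale_pos : 0 < IZR scale.
Proof. unfold scale. apply IZR_lt. reflexivity. Qed.

(* The ball [(m, r)] has centre [m / scale] and radius [r / scale]. *)
Definition zball := (Z * Z)%type.

Definition approx (b : zball) (x : R) : Prop :=
  Rabs (x * IZR scale - IZR (fst b)) <= IZR (snd b).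

Definition badd (a b : zball) : zball := (fst a + fst b, snd a + snd b)%Z.
Definition bsub (a b : zball) : zball := (fst a - fst b, snd a + snd b)%Z.
Definition bscal (k : Z) (a : zball) : zball := (k * fst a, Z.abs k * snd a)%Z.
(** Both shifts round down; the [+ 2] pays for less than one unit lost in the centre and less than
    one in the radius. *)
Definition bmul (a b : zball) : zball :=
  (Z.shiftr (fst a * fst b) 48,
   Z.shiftr (Z.abs (fst a) * snd b + Z.abs (fst b) * snd a + snd a * snd b) 48 + 2)%Z.
Definition bupper (a : zball) : Z := (Z.abs (fst a) + snd a)%Z.

Lemma approx_add a b x y : approx a x -> approx b y -> approx (badd a b) (x + y).
Proof.
  unfold approx, badd; simpl. intros Ha Hb. rewrite !plus_IZR.
  eapply Rle_trans; [|apply Rplus_le_compat; [exact Ha|exact Hb]].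
  eapply Rle_trans; [|apply Rabs_triang]. right. f_equal. ring.
Qed.

Lemma approx_sub a b x y : approx a x -> approx b y -> approx (bsub a b) (x - y).
Proof.
  unfold approx, bsub; simpl. intros Ha Hb. rewrite plus_IZR, minus_IZR.
  eapply Rle_trans; [|apply Rplus_le_compat; [exact Ha|exact Hb]].
  rewrite <- (Rabs_Ropp (y * _ - _)).
  eapply Rle_trans; [|apply Rabs_triang]. right. f_equal. ring.
Qed.

Lemma approx_scal k a x : approx a x -> approx (bscal k a) (IZR k * x).
Proof.
  unfold approx, bscal; cbn [fst snd]. intros Ha. rewrite !mult_IZR, abs_IZR.
  replace (IZR k * x * IZR scale - IZR k * IZR (fst a))
    with (IZR k * (x * IZR scale - IZR (fst a))) by ring.
  rewrite Rabs_mult. apply Rmult_le_compat_l; [apply Rabs_pos|auto].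
Qed.

Lemma shiftr_bounds x :
  IZR (Z.shiftr x 48) * IZR scale <= IZR x < (IZR (Z.shiftr x 48) + 1) * IZR scale.
Proof.
  rewrite Z.shiftr_div_pow2 by lia. fold scale.
  pose proof (Z.mul_div_le x scale eq_refl). pose proof (Z.mul_succ_div_gt x scale eq_refl).
  rewrite <- plus_IZR, <- !mult_IZR. split; [apply IZR_le|apply IZR_lt]; lia.
Qed.

Lemma approx_mul a b x y : approx a x -> approx b y -> approx (bmul a b) (x * y).
Proof.
  unfold approx, bmul. destruct a as [m r], b as [n s]. cbn [fst snd]. intros Ha Hb.
  pose proof scale_pos as Hs.
  pose proof (shiftr_bounds (m * n)) as B1.
  pose proof (shiftr_bounds (Z.abs m * s + Z.abs n * r + r * s)) as B2.
  set (u := Z.shiftr (m * n) 48) in *.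
  set (v := Z.shiftr (Z.abs m * s + Z.abs n * r + r * s) 48) in *. clearbody u v.
  rewrite !plus_IZR, !mult_IZR, !abs_IZR in *.
  set (X := x * IZR scale) in *. set (Y := y * IZR scale) in *.
  assert (E : Rabs (X * Y - IZR m * IZR n)
              <= Rabs (IZR m) * IZR s + Rabs (IZR n) * IZR r + IZR r * IZR s).
  { replace (X * Y - IZR m * IZR n) with
      (IZR m * (Y - IZR n) + (IZR n * (X - IZR m) + (X - IZR m) * (Y - IZR n))) by ring.
    eapply Rle_trans; [apply Rabs_triang|].
    rewrite Rplus_assoc. apply Rplus_le_compat.
    { rewrite Rabs_mult. apply Rmult_le_compat_l; [apply Rabs_pos|auto]. }
    eapply Rle_trans; [apply Rabs_triang|]. apply Rplus_le_compat; rewrite Rabs_mult.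
    - apply Rmult_le_compat_l; [apply Rabs_pos|auto].
    - apply Rmult_le_compat; auto using Rabs_pos. }
  apply (Rabs_le_scaled _ _ (IZR scale)); auto.
  replace ((x * y * IZR scale - IZR u) * IZR scale)
    with ((X * Y - IZR m * IZR n) + (IZR m * IZR n - IZR u * IZR scale))
    by (unfold X, Y; ring).
  eapply Rle_trans; [apply Rabs_triang|].
  rewrite (Rabs_pos_eq (IZR m * IZR n - IZR u * IZR scale)) by lra.
  replace (IZR v + 2) with (IZR v + 1 + 1) by ring. lra.
Qed.

Lemma approx_upper a x : approx a x -> Rabs x * IZR scale <= IZR (bupper a).
Proof.
  unfold approx, bupper. intros Ha. pose proof scale_pos.
  rewrite plus_IZR, abs_IZR, <- (Rabs_pos_eq (IZR scale)), <- Rabs_mult by lra.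
  replace (x * IZR scale) with (IZR (fst a) + (x * IZR scale - IZR (fst a))) by ring.
  eapply Rle_trans; [apply Rabs_triang|]. lra.
Qed.

(* [cball] approximates [exp (i x)]. *)
Definition cball := (zball * zball)%type.

Definition capprox (e : cball) (x : R) : Prop := approx (fst e) (cos x) /\ approx (snd e) (sin x).

Definition cmul (e f : cball) : cball :=
  (bsub (bmul (fst e) (fst f)) (bmul (snd e) (snd f)),
   badd (bmul (snd e) (fst f)) (bmul (fst e) (snd f))).

Lemma capprox_mul e f x y : capprox e x -> capprox f y -> capprox (cmul e f) (x + y).
Proof.
  intros [Ec Es] [Fc Fs]. split; unfold cmul; cbn [fst snd].
  - rewrite cos_plus. apply approx_sub; apply approx_mul; auto.
  - rewrite sin_plus. apply approx_add; apply approx_mul; auto.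
Qed.

(** The rotations [exp (i / 256)] and [exp (i / 128)]: the first belongs to the centre of cell 0,
    the second leads from one centre to the next. *)
Definition half_step : cball := ((281472829229738, 4), (1099508831575, 4))%Z.
Definition full_step : cball := ((281466386819754, 4), (2199000885998, 4))%Z.

Lemma trig_small_approx (c s : Z) x : 0 <= x <= 1 / 100 ->
  IZR c - 4 <= (1 - x ^ 2 / 2 + x ^ 4 / 24 - x ^ 6 / 720) * IZR scale ->
  (1 - x ^ 2 / 2 + x ^ 4 / 24) * IZR scale <= IZR c + 4 ->
  IZR s - 4 <= (x - x ^ 3 / 6 + x ^ 5 / 120 - x ^ 7 / 5040) * IZR scale ->
  (x - x ^ 3 / 6 + x ^ 5 / 120) * IZR scale <= IZR s + 4 ->
  capprox ((c, 4), (s, 4))%Z x.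
Proof.
  intros Hx C1 C2 S1 S2. pose proof scale_pos.
  pose proof (cos_ge6 x ltac:(lra)). pose proof (cos_le4 x).
  pose proof (sin_ge7 x ltac:(lra)). pose proof (sin_le5 x ltac:(lra)).
  split; unfold approx; cbn [fst snd]; apply Rabs_le; nra.
Qed.

Lemma half_step_approx : capprox half_step (1 / 256).
Proof. apply trig_small_approx; change scale with 281474976710656%Z; lra. Qed.

Lemma full_step_approx : capprox full_step (1 / 128).
Proof. apply trig_small_approx; change scale with 281474976710656%Z; lra. Qed.

(** * Certified bounds for the kernel on a grid *)

(* The cell with index [i] is [i/128, (i+1)/128]. *)
Definition center (i : nat) : R := IZR (2 * Z.of_nat i + 1) / 256.

Definition inverse_ball (i : nat) : zball := (scale * 256 / (2 * Z.of_nat i + 1), 1)%Z.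

Lemma div_bounds a b : (0 < b)%Z -> IZR (a / b) * IZR b <= IZR a < (IZR (a / b) + 1) * IZR b.
Proof.
  intros Hb. pose proof (Z.mul_div_le a b Hb). pose proof (Z.mul_succ_div_gt a b Hb).
  rewrite <- plus_IZR, <- !mult_IZR. split; [apply IZR_le|apply IZR_lt]; lia.
Qed.

Lemma center_pos i : 0 < center i.
Proof. unfold center. apply Rdiv_lt_0_compat; [apply IZR_lt; lia|lra]. Qed.

Lemma inverse_ball_approx i : approx (inverse_ball i) (/ center i).
Proof.
  unfold approx, inverse_ball, center. cbn [fst snd].
  assert (Hb : (0 < 2 * Z.of_nat i + 1)%Z) by lia.
  pose proof (IZR_lt _ _ Hb) as Hb'.
  pose proof (div_bounds (scale * 256) _ Hb) as [B1 B2]. rewrite mult_IZR in *.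
  set (b := IZR (2 * Z.of_nat i + 1)) in *.
  replace (/ (b / 256) * IZR scale) with (IZR scale * 256 / b) by (field; lra).
  apply (Rabs_le_scaled _ _ b); [lra|].
  set (m := IZR (scale * 256 / (2 * Z.of_nat i + 1))) in *.
  replace ((IZR scale * 256 / b - m) * b) with (IZR scale * 256 - m * b) by (field; lra).
  rewrite Rabs_pos_eq by lra. lra.
Qed.

Definition one_ball : zball := (scale, 0%Z).

Lemma one_ball_approx : approx one_ball 1.
Proof. unfold approx, one_ball. cbn [fst snd]. rewrite Rabs_pos_eq; lra. Qed.

Definition inverse_powers (i : nat) : list zball :=
  let v := inverse_ball i in
  let v2 := bmul v v in
  [one_ball; v; v2; bmul v2 v].

Lemma inverse_powers_approx i j : (j <= 3)%nat ->
  approx (nth j (inverse_powers i) one_ball) (/ center i ^ j).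
Proof.
  intros Hj. pose proof (center_pos i). pose proof (inverse_ball_approx i) as V.
  pose proof (approx_mul _ _ _ _ V V) as V2. pose proof (approx_mul _ _ _ _ V2 V) as V3.
  destruct j as [|[|[|[|j]]]]; [| | | |lia]; unfold inverse_powers; cbn [nth].
  - simpl. rewrite Rinv_1. apply one_ball_approx.
  - rewrite pow_1. exact V.
  - replace (/ center i ^ 2) with (/ center i * / center i) by (field; lra). exact V2.
  - replace (/ center i ^ 3) with (/ center i * / center i * / center i) by (field; lra). exact V3.
Qed.

(** The angles [2z], [3z], [6z] come from products of [exp (i z)], so no further trigonometric
    evaluation occurs. Entry [j] has coefficients [m^j], with the sign of the [j]-th derivative of
    the sine. *)
Definition F_balls (e : cball) : list zball :=
  let e2 := cmul e e in
  let e3 := cmul e2 e in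
  let e6 := cmul e3 e3 in
  [bsub (badd (badd (snd e) (snd e2)) (snd e3)) (snd e6);
   bsub (badd (badd (fst e) (bscal 2 (fst e2))) (bscal 3 (fst e3))) (bscal 6 (fst e6));
   bsub (badd (badd (bscal (-1) (snd e)) (bscal (-4) (snd e2))) (bscal (-9) (snd e3)))
        (bscal (-36) (snd e6));
   bsub (badd (badd (bscal (-1) (fst e)) (bscal (-8) (fst e2))) (bscal (-27) (fst e3)))
        (bscal (-216) (fst e6))].

Lemma sin_shift0 x : sin (x + INR 0 * (PI / 2)) = sin x.
Proof. simpl. rewrite Rmult_0_l, Rplus_0_r. reflexivity. Qed.

Lemma sin_shift1 x : sin (x + INR 1 * (PI / 2)) = cos x.
Proof. simpl. rewrite Rmult_1_l, sin_plus, cos_PI2, sin_PI2. ring. Qed.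

Lemma sin_shift2 x : sin (x + INR 2 * (PI / 2)) = - sin x.
Proof.
  replace (x + INR 2 * (PI / 2)) with (x + PI) by (simpl INR; lra). apply neg_sin.
Qed.

Lemma sin_shift3 x : sin (x + INR 3 * (PI / 2)) = - cos x.
Proof.
  replace (x + INR 3 * (PI / 2)) with (x + INR 1 * (PI / 2) + PI) by (simpl INR; lra).
  now rewrite neg_sin, sin_shift1.
Qed.

Lemma F_balls_approx e z j : (j <= 3)%nat -> capprox e z ->
  approx (nth j (F_balls e) one_ball) (F j z).
Proof.
  intros Hj E1.
  assert (E2 := capprox_mul _ _ _ _ E1 E1). assert (E3 := capprox_mul _ _ _ _ E2 E1).
  assert (E6 := capprox_mul _ _ _ _ E3 E3).
  replace (z + z) with (2 * z) in * by ring. replace (2 * z + z) with (3 * z) in * by ring.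
  replace (3 * z + 3 * z) with (6 * z) in * by ring.
  destruct E1 as [C1 S1], E2 as [C2 S2], E3 as [C3 S3], E6 as [C6 S6].
  unfold F. destruct j as [|[|[|[|j]]]]; [| | | |lia]; unfold F_balls; cbn [nth].
  - rewrite !sin_shift0. simpl pow. rewrite !Rmult_1_l.
    apply approx_sub; [apply approx_add; [apply approx_add|]|]; auto.
  - rewrite !sin_shift1. simpl pow. rewrite !Rmult_1_r.
    apply approx_sub; [apply approx_add; [apply approx_add|]|]; auto; apply approx_scal; auto.
  - rewrite !sin_shift2.
    replace (- sin z + 2 ^ 2 * - sin (2 * z) + 3 ^ 2 * - sin (3 * z) - 6 ^ 2 * - sin (6 * z))
      with (-1 * sin z + -4 * sin (2 * z) + -9 * sin (3 * z) - -36 * sin (6 * z)) by ring.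
    apply approx_sub; [apply approx_add; [apply approx_add|]|]; apply approx_scal; auto.
  - rewrite !sin_shift3.
    replace (- cos z + 2 ^ 3 * - cos (2 * z) + 3 ^ 3 * - cos (3 * z) - 6 ^ 3 * - cos (6 * z))
      with (-1 * cos z + -8 * cos (2 * z) + -27 * cos (3 * z) - -216 * cos (6 * z)) by ring.
    apply approx_sub; [apply approx_add; [apply approx_add|]|]; apply approx_scal; auto.
Qed.

Definition leibniz_ball (Fs Is : list zball) (l : list (Z * (nat * nat))) : zball :=
  fold_right (fun p acc => badd (bscal (fst p)
    (bmul (nth (fst (snd p)) Fs one_ball) (nth (snd (snd p)) Is one_ball))) acc) (0, 0)%Z l.

Definition leibniz_upper (Fs Is : list zball) (l : list (Z * (nat * nat))) : Z :=
  fold_right (fun p acc => (Z.abs (fst p) *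
    (Z.shiftr (bupper (nth (fst (snd p)) Fs one_ball)
               * bupper (nth (snd (snd p)) Is one_ball)) 48 + 1) + acc)%Z) 0%Z l.

(* Bounds [scale * Rabs (K N k (center i))]; the second summand accounts for
   the relative error in [Gn_near]. *)
Definition value_bound (Fs Is : list zball) (k : nat) : Z :=
  ((bupper (bmul (nth 3 Is one_ball) (leibniz_ball Fs Is (leibniz k)))
    + (Z.shiftr (leibniz_upper Fs Is (leibniz k) * bupper (nth 1 Is one_ball)) 48 / 65536 + 1) + 1)
   / 30 + 1)%Z.

Lemma leibniz_indices k p : In p (leibniz k) -> (fst (snd p) <= 3 /\ snd (snd p) <= 3)%nat.
Proof.
  destruct k as [|[|[|k]]]; unfold leibniz; simpl; intuition (subst; simpl; lia).
Qed.

Lemma leibniz_ball_approx Fs Is (f g : nat -> R) l :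
  (forall p, In p l -> (fst (snd p) <= 3 /\ snd (snd p) <= 3)%nat) ->
  (forall i, (i <= 3)%nat -> approx (nth i Fs one_ball) (f i)) ->
  (forall j, (j <= 3)%nat -> approx (nth j Is one_ball) (g j)) ->
  approx (leibniz_ball Fs Is l)
    (lsum (fun p => IZR (fst p) * (f (fst (snd p)) * g (snd (snd p)))) l).
Proof.
  intros Hl Hf Hg. induction l as [|p l IH]; unfold leibniz_ball, lsum; cbn [fold_right].
  - unfold approx. cbn [fst snd]. rewrite Rmult_0_l, Rminus_diag, Rabs_R0. lra.
  - destruct (Hl p) as [H1 H2]; [left; auto|].
    apply approx_add; [apply approx_scal, approx_mul; auto|].
    apply IH. intros; apply Hl; right; auto.
Qed.

Lemma leibniz_upper_bound Fs Is (f g : nat -> R) l :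
  (forall p, In p l -> (fst (snd p) <= 3 /\ snd (snd p) <= 3)%nat) ->
  (forall i, (i <= 3)%nat -> approx (nth i Fs one_ball) (f i)) ->
  (forall j, (j <= 3)%nat -> approx (nth j Is one_ball) (g j)) ->
  lsum (fun p => Rabs (IZR (fst p)) * (Rabs (f (fst (snd p))) * Rabs (g (snd (snd p))))) l
    * IZR scale <= IZR (leibniz_upper Fs Is l).
Proof.
  intros Hl Hf Hg. pose proof scale_pos as Hs.
  induction l as [|p l IH]; unfold leibniz_upper, lsum; cbn [fold_right].
  - lra.
  - destruct (Hl p) as [H1 H2]; [left; auto|].
    rewrite Rmult_plus_distr_r, plus_IZR. apply Rplus_le_compat.
    2:{ apply IH. intros; apply Hl; right; auto. }
    rewrite mult_IZR, abs_IZR, Rmult_assoc. apply Rmult_le_compat_l; [apply Rabs_pos|].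
    rewrite plus_IZR.
    pose proof (approx_upper _ _ (Hf _ H1)) as U1. pose proof (approx_upper _ _ (Hg _ H2)) as U2.
    set (u1 := bupper _) in *. set (u2 := bupper (nth (snd _) _ _)) in *.
    pose proof (shiftr_bounds (u1 * u2)) as [_ B]. rewrite mult_IZR in B.
    apply (Rmult_le_reg_r (IZR scale)); auto.
    apply Rle_trans with (IZR u1 * IZR u2); [|lra].
    set (x := Rabs (f _)) in *. set (y := Rabs (g _)) in *.
    replace (x * y * IZR scale * IZR scale) with ((x * IZR scale) * (y * IZR scale)) by ring.
    apply Rmult_le_compat; auto; apply Rmult_le_pos; try lra; apply Rabs_pos.
Qed.

Lemma value_bound_correct N k i e : (166 <= N)%nat -> (k <= 3)%nat -> (i < 1024)%nat ->
  capprox e (center i) ->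
  Rabs (K N k (center i)) * IZR scale
    <= IZR (value_bound (F_balls e) (inverse_powers i) k).
Proof.
  intros HN Hk Hi He. pose proof (center_pos i) as Hz. pose proof scale_pos as Hs.
  assert (Hz8 : center i <= 8).
  { unfold center. assert (IZR (2 * Z.of_nat i + 1) <= 2048) by (apply IZR_le; lia). lra. }
  assert (HN' : 166 <= INR N) by (replace 166 with (INR 166) by (simpl; lra); apply le_INR; lia).
  pose proof PI_lower.
  set (Fs := F_balls e). set (Is := inverse_powers i). set (z := center i) in *.
  assert (HF : forall i, (i <= 3)%nat -> approx (nth i Fs one_ball) (F i z))
    by (intros; apply F_balls_approx; auto).
  assert (HI : forall j, (j <= 3)%nat -> approx (nth j Is one_ball) (/ z ^ j))
    by (intros; apply inverse_powers_approx; auto).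
  assert (HL := leibniz_indices k).
  pose proof (leibniz_ball_approx Fs Is (fun i => F i z) (fun j => / z ^ j) _ HL HF HI) as P.
  pose proof (leibniz_upper_bound Fs Is (fun i => F i z) (fun j => / z ^ j) _ HL HF HI) as U.
  cbv beta in P, U.
  pose proof (approx_upper _ _ (approx_mul _ _ _ _ (HI 3%nat ltac:(lia)) P)) as V.
  pose proof (approx_upper _ _ (HI 1%nat ltac:(lia))) as W.
  unfold value_bound. fold Fs Is.
  set (pb := bupper (bmul _ _)) in *. set (up := leibniz_upper _ _ _) in *.
  set (w := bupper (nth 1 Is one_ball)) in *.
  set (Sg := lsum (fun p => IZR (fst p) * (F (fst (snd p)) z * / z ^ snd (snd p))) (leibniz k)) in *.
  set (Sa := lsum (fun p => Rabs (IZR (fst p)) * (Rabs (F (fst (snd p)) z)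
     * Rabs (/ z ^ snd (snd p)))) (leibniz k)) in *.
  assert (HSa : 0 <= Sa).
  { apply lsum_nonneg. intros. repeat apply Rmult_le_pos; apply Rabs_pos. }
  (* Each [Gn N j z] is [z^-(3+j)] times [1 + eps] with [|eps| <= z^2 / 65536]; the errors add up to
     [z^-3 * z^2 / 65536] times the sum [Sa] of absolute values. *)
  assert (M : Rabs (30 * K N k z) <= Rabs (/ z ^ 3 * Sg) + Sa * / z / 65536).
  { rewrite K_closed by (auto; try lia; split; nra).
    unfold leibniz_sum, Sg. unfold Sa. unfold Rdiv. rewrite Rmult_assoc, (Rmult_comm Sa).
    replace (lsum _ (leibniz k)) with (/ z ^ 3 * Sg +
      lsum (fun p => / z ^ 3 * (IZR (fst p) * (F (fst (snd p)) z * / z ^ snd (snd p))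
         * (z ^ (3 + snd (snd p)) * Gn N (snd (snd p)) z - 1))) (leibniz k)).
    2:{ unfold Sg. rewrite <- lsum_scal, <- lsum_plus. apply lsum_ext. intros p _.
        rewrite pow_add. field. split; [apply pow_nonzero|]; lra. }
    eapply Rle_trans; [apply Rabs_triang|]. apply Rplus_le_compat_l.
    eapply Rle_trans; [apply lsum_abs|]. unfold Sa. rewrite <- lsum_scal.
    apply lsum_le. intros p Hp. destruct (HL p Hp) as [H1 H2].
    pose proof (Gn_near N (snd (snd p)) z HN H2 ltac:(lra)) as G.
    rewrite !Rabs_mult. rewrite (Rabs_pos_eq (/ z ^ 3)) by (apply Rlt_le, Rinv_0_lt_compat, pow_lt; lra).
    set (a := Rabs (IZR (fst p)) * (Rabs (F (fst (snd p)) z) * Rabs (/ z ^ snd (snd p)))).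
    assert (0 <= a) by (unfold a; repeat apply Rmult_le_pos; apply Rabs_pos).
    apply Rle_trans with (/ z ^ 3 * (a * (z ^ 2 / 65536))).
    - apply Rmult_le_compat_l; [apply Rlt_le, Rinv_0_lt_compat, pow_lt; lra|].
      apply Rmult_le_compat_l; auto.
    - right. field. lra. }
  assert (Hw : / z * IZR scale <= IZR w).
  { rewrite pow_1, Rabs_pos_eq in W by (apply Rlt_le, Rinv_0_lt_compat; lra). auto. }
  assert (Hz' : 0 < / z) by (apply Rinv_0_lt_compat; lra).
  pose proof (shiftr_bounds (up * w)) as [_ B1]. rewrite mult_IZR in B1.
  set (sh := Z.shiftr (up * w) 48) in *.
  pose proof (div_bounds sh 65536 eq_refl) as [_ B2].
  set (dv := (sh / 65536)%Z) in *.
  (* Two nested roundings down, the shift and the division, lose less than 2; hence the two separate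
     [+ 1] in [value_bound]. *)
  assert (B3 : Sa * / z / 65536 * IZR scale <= IZR dv + 2).
  { assert (Sa * IZR scale * (/ z * IZR scale) <= IZR up * IZR w).
    { apply Rmult_le_compat; auto; apply Rmult_le_pos; lra. }
    assert (Sa * / z * IZR scale < IZR sh + 1).
    { apply (Rmult_lt_reg_r (IZR scale)); auto.
      replace (Sa * / z * IZR scale * IZR scale) with (Sa * IZR scale * (/ z * IZR scale)) by ring.
      lra. }
    lra. }
  pose proof (div_bounds (pb + (dv + 1) + 1) 30 eq_refl) as [_ B4].
  rewrite !plus_IZR in B4. rewrite plus_IZR.
  rewrite Rabs_mult, (Rabs_pos_eq 30) in M by lra.
  apply (Rmult_le_compat_r (IZR scale)) in M; [|lra]. rewrite Rmult_plus_distr_r in M.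
  set (res := IZR ((pb + (dv + 1) + 1) / 30)) in *.
  lra.
Qed.

(** * Taylor bounds, from the centre of a cell to the whole cell *)

Lemma derive_le_increment (f f' : R -> R) a b m :
  a <= b -> (forall x, is_derive f x (f' x)) -> (forall x, a <= x <= b -> f' x <= m) ->
  f b <= f a + m * (b - a).
Proof.
  intros Hab Hd Hm. destruct (MVT_gen f a b f') as (c & Hc & E).
  - intros; apply Hd.
  - intros y _. apply continuity_pt_filterlim.
    apply (ex_derive_continuous (K := R_AbsRing) (V := R_NormedModule)).
    eexists; apply Hd.
  - rewrite Rmin_left, Rmax_right in Hc by lra.
    assert (f' c * (b - a) <= m * (b - a)) by (apply Rmult_le_compat_r; [lra|auto]). lra.
Qed.

Lemma taylor2_upper (f f' f'' : R -> R) a b m :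
  a <= b -> (forall x, is_derive f x (f' x)) -> (forall x, is_derive f' x (f'' x)) ->
  (forall x, a <= x <= b -> f'' x <= m) ->
  f' b <= f' a + m * (b - a) /\ f b <= f a + f' a * (b - a) + m * (b - a) ^ 2 / 2.
Proof.
  intros Hab D1 D2 Hm. split; [apply (derive_le_increment f' f''); auto|].
  pose proof (derive_le_increment (fun x => f x - (f' a * (x - a) + m * (x - a) ^ 2 / 2))
    (fun x => f' x - (f' a + m * (x - a))) a b 0 Hab) as H.
  assert (D : forall x, is_derive (fun x => f x - (f' a * (x - a) + m * (x - a) ^ 2 / 2)) x
      (f' x - (f' a + m * (x - a)))).
  { intros x. apply (is_derive_minus f); [apply D1|]. auto_derive; auto. field. }
  specialize (H D). cbv beta in H.
  assert (f b - (f' a * (b - a) + m * (b - a) ^ 2 / 2)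
    <= f a - (f' a * (a - a) + m * (a - a) ^ 2 / 2) + 0 * (b - a)).
  { apply H. intros x Hx.
    pose proof (derive_le_increment f' f'' a x m ltac:(lra) D2) as Q.
    assert (f' x <= f' a + m * (x - a)) by (apply Q; intros; apply Hm; lra). lra. }
  replace (a - a) with 0 in H0 by ring. lra.
Qed.

(** Reduces to the one-sided estimate applied to [x |-> s * f (c + t * x)]: the sign [s] selects [f]
    or [-f], and the sign [t] the side of [c] on which [z] lies. *)
Lemma abs_taylor2 (f f' f'' : R -> R) m c z :
  (forall x, is_derive f x (f' x)) -> (forall x, is_derive f' x (f'' x)) ->
  (forall x, Rabs (f'' x) <= m) ->
  Rabs (f z) <= Rabs (f c) + Rabs (f' c) * Rabs (z - c) + m * (z - c) ^ 2 / 2.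
Proof.
  intros D1 D2 Hm.
  assert (P : forall s t, Rabs s = 1 -> Rabs t = 1 -> 0 <= t * (z - c) ->
     s * f z <= Rabs (f c) + Rabs (f' c) * Rabs (z - c) + m * (z - c) ^ 2 / 2).
  { intros s t Hs Ht Hz.
    assert (Ht2 : t * t = 1) by (rewrite <- (Rabs_pos_eq (t * t)) by nra;
      rewrite Rabs_mult, Ht; ring).
    destruct (taylor2_upper (fun x => s * f (c + t * x)) (fun x => s * t * f' (c + t * x))
      (fun x => s * f'' (c + t * x)) 0 (t * (z - c)) m Hz) as [_ Q].
    - intros x.
      evar_last; [apply (is_derive_scal (fun x => f (c + t * x)));
        apply (is_derive_comp f); [apply D1|]; auto_derive; auto|].
      unfold scal; simpl; unfold mult; simpl. ring.
    - intros x.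
      evar_last; [apply (is_derive_scal (fun x => f' (c + t * x)));
        apply (is_derive_comp f'); [apply D2|]; auto_derive; auto|].
      unfold scal; simpl; unfold mult; simpl.
      replace (s * f'' (c + t * x)) with (s * (t * t) * f'' (c + t * x)) by (rewrite Ht2; ring).
      ring.
    - intros x _. eapply Rle_trans; [apply Rle_abs|]. rewrite Rabs_mult, Hs, Rmult_1_l. auto.
    - rewrite Rmult_0_r, Rplus_0_r, Rminus_0_r in Q.
      replace (c + t * (t * (z - c))) with (c + (t * t) * (z - c)) in Q by ring.
      rewrite Ht2 in Q. replace (c + 1 * (z - c)) with z in Q by ring.
      eapply Rle_trans; [exact Q|].
      replace ((t * (z - c)) ^ 2) with (t * t * (z - c) ^ 2) by ring. rewrite Ht2, Rmult_1_l.
      apply Rplus_le_compat_r, Rplus_le_compat.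
      + eapply Rle_trans; [apply Rle_abs|]. rewrite Rabs_mult, Hs. lra.
      + eapply Rle_trans; [apply Rle_abs|]. rewrite !Rabs_mult, Hs, Ht. lra. }
  assert (Q : forall s, Rabs s = 1 ->
     s * f z <= Rabs (f c) + Rabs (f' c) * Rabs (z - c) + m * (z - c) ^ 2 / 2).
  { intros s Hs. destruct (Rle_lt_dec 0 (z - c)).
    - apply (P s 1); auto; [apply Rabs_R1|lra].
    - apply (P s (-1)); auto; [rewrite Rabs_left; lra|lra]. }
  apply Rabs_le. pose proof (Q 1 Rabs_R1). pose proof (Q (-1) ltac:(rewrite Rabs_left; lra)). lra.
Qed.

(** Second-order Taylor bounds on a cell of half-width 1/256, with [131072 = 2 * 256^2] and the
    global bounds 25/6, 13.6, 44.08 for the last derivative. The third derivative gets only a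
    first-order bound, as no value of the fourth is tabulated. *)
Definition cell_row (i : nat) (e : cball) : list Z :=
  let Fs := F_balls e in
  let Is := inverse_powers i in
  let v0 := value_bound Fs Is 0 in
  let v1 := value_bound Fs Is 1 in
  let v2 := value_bound Fs Is 2 in
  let v3 := value_bound Fs Is 3 in
  [v0 + v1 / 256 + 1 + (scale * 25 / (6 * 131072) + 1);
   v1 + v2 / 256 + 1 + (scale * 136 / (10 * 131072) + 1);
   v2 + v3 / 256 + 1 + (scale * 4408 / (100 * 131072) + 1);
   v3 + (scale * 4408 / (100 * 256) + 1)]%Z.

Lemma cell_second_order N k M c z V V1 (rem : Z) :
  (forall x, Rabs (K N (S (S k)) x) <= M) -> Rabs (z - c) <= / 256 ->
  Rabs (K N k c) * IZR scale <= IZR V -> Rabs (K N (S k) c) * IZR scale <= IZR V1 ->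
  M * IZR scale <= 131072 * IZR rem ->
  Rabs (K N k z) * IZR scale <= IZR (V + V1 / 256 + 1 + rem).
Proof.
  intros HM Hz H0 H1 Hr. pose proof scale_pos.
  pose proof (abs_taylor2 (K N k) (K N (S k)) (K N (S (S k))) M c z
    (is_derive_K N k) (is_derive_K N (S k)) HM) as T.
  pose proof (div_bounds V1 256 eq_refl) as [_ B].
  rewrite !plus_IZR. set (d := IZR (V1 / 256)) in *.
  assert (HM0 : 0 <= M) by (eapply Rle_trans; [apply Rabs_pos|apply (HM 0)]).
  assert (Q : Rabs (K N k z) <= Rabs (K N k c) + Rabs (K N (S k) c) * / 256 + M / 131072).
  { eapply Rle_trans; [exact T|]. apply Rplus_le_compat; [apply Rplus_le_compat_l|].
    - apply Rmult_le_compat_l; [apply Rabs_pos|auto].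
    - assert ((z - c) ^ 2 <= / 65536).
      { rewrite <- (Rabs_pos_eq ((z - c) ^ 2)), <- RPow_abs by apply pow2_ge_0.
        pose proof (Rabs_pos (z - c)). nra. }
      assert (M * (z - c) ^ 2 <= M * / 65536) by (apply Rmult_le_compat_l; auto). lra. }
  apply (Rmult_le_compat_r (IZR scale)) in Q; [|lra]. lra.
Qed.

Lemma ceil_bound a b : (0 < b)%Z -> IZR a <= IZR b * IZR (a / b + 1).
Proof. intros Hb. rewrite plus_IZR. pose proof (div_bounds a b Hb). lra. Qed.

Lemma cell_row_correct N k i e z : (166 <= N)%nat -> (k <= 3)%nat -> (i < 1024)%nat ->
  capprox e (center i) -> INR i / 128 <= z <= INR (S i) / 128 ->
  Rabs (K N k z) * IZR scale <= IZR (nth k (cell_row i e) 0%Z).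
Proof.
  intros HN Hk Hi He Hz. pose proof scale_pos.
  assert (Hc : Rabs (z - center i) <= / 256).
  { unfold center. rewrite plus_IZR, mult_IZR, <- INR_IZR_INZ. rewrite S_INR in Hz.
    apply Rabs_le. lra. }
  pose proof (fun k Hk => value_bound_correct N k i e HN Hk Hi He) as V.
  set (c := center i) in *. unfold cell_row.
  destruct k as [|[|[|[|k]]]]; [| | | |lia]; cbn [nth].
  - apply (cell_second_order N 0 (25 / 6) c); auto; [intros; apply abs_K2_le; lia|].
    pose proof (ceil_bound (scale * 25) (6 * 131072) eq_refl) as Q. rewrite !mult_IZR in Q. lra.
  - apply (cell_second_order N 1 (136 / 10) c); auto; [intros; apply abs_K3_le; lia|].
    pose proof (ceil_bound (scale * 136) (10 * 131072) eq_refl) as Q. rewrite !mult_IZR in Q. lra.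
  - apply (cell_second_order N 2 (4408 / 100) c); auto; [intros; apply abs_K4_le; lia|].
    pose proof (ceil_bound (scale * 4408) (100 * 131072) eq_refl) as Q. rewrite !mult_IZR in Q. lra.
  - pose proof (ceil_bound (scale * 4408) (100 * 256) eq_refl) as Q. rewrite !mult_IZR in Q.
    rewrite plus_IZR. specialize (V 3%nat Hk).
    assert (T : Rabs (K N 3 z) <= Rabs (K N 3 c) + 4408 / 100 * / 256).
    { replace (K N 3 z) with (K N 3 c + (K N 3 z - K N 3 c)) by ring.
      eapply Rle_trans; [apply Rabs_triang|]. apply Rplus_le_compat_l.
      destruct (MVT_gen (K N 3) c z (K N 4)) as (x & _ & E).
      - intros; apply is_derive_K.
      - intros y _. apply continuity_pt_filterlim.
        apply (ex_derive_continuous (K := R_AbsRing) (V := R_NormedModule)).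
        eexists; apply is_derive_K.
      - rewrite E, Rabs_mult. apply Rmult_le_compat; auto using Rabs_pos.
        apply abs_K4_le; auto. }
    apply (Rmult_le_compat_r (IZR scale)) in T; [|lra]. lra.
Qed.

(** * The table of all cells and its monotone envelopes *)

Fixpoint rows (n i : nat) (e : cball) : list (list Z) :=
  match n with
  | O => []
  | S n => cell_row i e :: rows n (S i) (cmul e full_step)
  end.

Lemma rows_nth n i e j : capprox e (center i) -> (j < n)%nat ->
  exists e', capprox e' (center (i + j)) /\ nth j (rows n i e) [] = cell_row (i + j) e'.
Proof.
  revert i e j. induction n as [|n IH]; intros i e j He Hj; [lia|].
  destruct j as [|j]; cbn [rows nth].
  - exists e. rewrite Nat.add_0_r. auto.
  - destruct (IH (S i) (cmul e full_step) j) as (e' & H1 & H2); [|lia|].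
    + replace (center (S i)) with (center i + 1 / 128)
        by (unfold center; rewrite Nat2Z.inj_succ, !plus_IZR, !mult_IZR, succ_IZR; field).
      apply capprox_mul; [auto|apply full_step_approx].
    + exists e'. replace (i + S j)%nat with (S i + j)%nat by lia. auto.
Qed.

Lemma rows_length n i e : length (rows n i e) = n.
Proof. revert i e; induction n; intros; simpl; auto. Qed.

Definition table : list (list Z) := rows 1024 0 half_step.

Definition cell (k i : nat) : Z := nth k (nth i table []) 0%Z.

Lemma cell_correct N k i z : (166 <= N)%nat -> (k <= 3)%nat -> (i < 1024)%nat ->
  INR i / 128 <= z <= INR (S i) / 128 ->
  Rabs (K N k z) * IZR scale <= IZR (cell k i).
Proof.
  intros HN Hk Hi Hz.
  destruct (rows_nth 1024 0 half_step i) as (e & He & E); [|auto|].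
  - replace (center 0) with (1 / 256) by (unfold center; simpl; lra). apply half_step_approx.
  - unfold cell, table. rewrite E. apply (cell_row_correct N k i e); auto.
Qed.

(** Maxima over suffixes turn oscillating cell bounds into a nonincreasing sequence, each entry of
    which bounds everything to its right. [init] becomes one extra entry at index [length l]. *)
Fixpoint suffix_max (init : Z) (l : list Z) : list Z :=
  match l with
  | [] => [init]
  | x :: l => let m := suffix_max init l in Z.max x (hd 0%Z m) :: m
  end.

Lemma suffix_max_init init l i : (i <= length l)%nat ->
  (init <= nth i (suffix_max init l) 0)%Z.
Proof.
  revert i. induction l as [|x l IH]; intros i Hi; cbn [suffix_max] in *.
  - destruct i; [reflexivity|simpl in Hi; lia].
  - destruct i as [|i]; cbn [nth]; [|apply IH; simpl in Hi; lia].
    pose proof (IH 0%nat ltac:(lia)) as H. destruct (suffix_max init l); simpl in *; lia.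
Qed.

Lemma suffix_max_nth init l i j : (i <= j)%nat -> (j < length l)%nat ->
  (nth j l 0 <= nth i (suffix_max init l) 0)%Z.
Proof.
  revert i j. induction l as [|x l IH]; intros i j Hij Hj; simpl in Hj; [lia|].
  cbn [suffix_max]. destruct i as [|i], j as [|j]; cbn [nth]; try lia.
  - pose proof (IH 0%nat j ltac:(lia) ltac:(lia)) as H.
    destruct (suffix_max init l); simpl in *; lia.
  - apply IH; lia.
Qed.

Definition tail_num (k : nat) : Z :=
  match k with 0%nat => 1374 | 1%nat => 4635 | 2%nat => 20515 | _ => 109000 end%Z.

Lemma tail_const_num k : tail_const k = IZR (tail_num k) / 10000.
Proof. destruct k as [|[|[|k]]]; unfold tail_const, tail_num; lra. Qed.

(** The initial value is the tail bound at [z = 8], where [z^3 = 512], so that every entry also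
    covers the range beyond the table. *)
Definition envelope_list (k : nat) : list Z :=
  suffix_max (scale * tail_num k / (10000 * 512) + 1) (map (fun r => nth k r 0%Z) table).

(* A nonincreasing bound for [Rabs (K N k z)] on [i/128 <= z <= PI N]. *)
Definition envelope (k i : nat) : R :=
  if Nat.ltb i 1024 then IZR (nth i (envelope_list k) 0%Z) / IZR scale
  else tail_const k / (INR i / 128) ^ 3.

Lemma table_length : length table = 1024%nat.
Proof. apply rows_length. Qed.

Lemma tail_const_pos k : 0 < tail_const k.
Proof. destruct k as [|[|[|k]]]; unfold tail_const; lra. Qed.

Lemma envelope_correct N k i z : (166 <= N)%nat -> (k <= 3)%nat ->
  INR i / 128 <= z <= PI * INR N -> Rabs (K N k z) <= envelope k i.
Proof.
  intros HN Hk Hz. pose proof scale_pos as Hs. pose proof (tail_const_pos k) as Hc.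
  unfold envelope. destruct (Nat.ltb_spec i 1024) as [Hi|Hi].
  - apply (Rmult_le_reg_r (IZR scale)); auto.
    unfold Rdiv. rewrite Rmult_assoc, Rinv_l, Rmult_1_r by lra.
    destruct (Rlt_le_dec z 8) as [H8|H8].
    + assert (Hz0 : 0 <= z).
      { pose proof (pos_INR i). lra. }
      destruct (nfloor_ex (128 * z)) as [j Hj]; [lra|].
      assert (i <= j)%nat.
      { apply INR_le. assert (H : INR i < INR (S j)) by (rewrite S_INR; lra).
        apply INR_lt in H. apply le_INR. lia. }
      assert (j < 1024)%nat.
      { apply INR_lt. replace (INR 1024) with 1024 by (rewrite INR_IZR_INZ; reflexivity). lra. }
      eapply Rle_trans; [apply (cell_correct N k j); auto; rewrite S_INR; lra|].
      apply IZR_le. unfold envelope_list, cell.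
      rewrite <- (map_nth (fun r => nth k r 0%Z) table [] j).
      replace (nth k [] 0%Z) with 0%Z by (destruct k; reflexivity).
      apply suffix_max_nth; [auto|]. rewrite length_map, table_length. auto.
    + apply Rle_trans with (IZR (scale * tail_num k / (10000 * 512) + 1)).
      2:{ apply IZR_le, suffix_max_init. rewrite length_map, table_length. lia. }
      apply Rle_trans with (tail_const k / z ^ 3 * IZR scale).
      { apply Rmult_le_compat_r; [lra|]. apply K_tail; auto; lra. }
      pose proof (ceil_bound (scale * tail_num k) (10000 * 512) eq_refl) as Q.
      rewrite !mult_IZR in Q.
      assert (tail_const k / z ^ 3 <= tail_const k / 512).
      { apply Rmult_le_compat_l; [lra|]. apply Rinv_le_contravar; [lra|].
        replace 512 with (8 ^ 3) by ring. apply pow_incr; lra. }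
      apply Rle_trans with (tail_const k / 512 * IZR scale);
        [apply Rmult_le_compat_r; lra|].
      rewrite tail_const_num. lra.
  - assert (H1024 : 1024 <= INR i).
    { replace 1024 with (INR 1024) by (rewrite INR_IZR_INZ; reflexivity). apply le_INR; auto. }
    eapply Rle_trans; [apply K_tail; auto; lra|].
    apply Rmult_le_compat_l; [lra|]. apply Rinv_le_contravar; [apply pow_lt; lra|].
    apply pow_incr; lra.
Qed.

(** * Sums over separated points *)

Lemma lsum_seq_shift (f : nat -> R) n :
  lsum f (seq 0 (S n)) = f 0%nat + lsum (fun j => f (S j)) (seq 0 n).
Proof. simpl seq. simpl lsum. rewrite <- seq_shift. f_equal. apply lsum_map. Qed.

(** Allows a sum over occupied bins to be enlarged to a sum over all bins. *)
Lemma lsum_incl {A} (f : A -> R) l l' :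
  (forall x, 0 <= f x) -> NoDup l -> incl l l' -> lsum f l <= lsum f l'.
Proof.
  intros Hf. revert l'. induction l as [|x l IH]; intros l' Hl Hi.
  - apply lsum_nonneg. auto.
  - inversion Hl as [|? ? Hx Hl']; subst.
    destruct (in_split x l') as (l1 & l2 & ->); [apply Hi; left; auto|].
    assert (lsum f l <= lsum f (l1 ++ l2)).
    { apply IH; auto. intros y Hy. assert (y <> x) by (intros ->; auto).
      specialize (Hi y (or_intror Hy)). apply in_app_iff in Hi. apply in_app_iff.
      destruct Hi as [|[|]]; auto; congruence. }
    rewrite lsum_app in *. simpl. lra.
Qed.

(* 168 cells make up the minimal distance of the nodes, and 1024 cells the
   tabulated range [z <= 8]. *)
Fixpoint bin_sum (fuel : nat) (E : list Z) (tail : Z) (i : nat) : Z :=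
  match fuel with
  | O => tail
  | S fuel => if Nat.ltb i 1024 then (nth i E 0 + bin_sum fuel E tail (i + 168))%Z else tail
  end.

(** 141 is a lower bound for [2 d (8 - d/2)^2] with [d = 168/128], the denominator in the telescoped
    sum of inverse cubes from [z = 8] on. *)
Definition tail_sum (k : nat) : Z := (scale * tail_num k / (10000 * 141) + 1)%Z.

(** Seven steps leave the table from any starting cell, since [7 * 168 = 1176 > 1024]. *)
Definition envelope_sum (k i : nat) : Z := bin_sum 7 (envelope_list k) (tail_sum k) i.

(** By convexity [z^-3] is at most its mean over the interval of length [d] centred at [z], and that
    mean is a difference of consecutive values of [/ (2 d (z - d/2)^2)]. *)
Lemma inverse_cube_telescope z d : 0 < d -> d < z ->
  / z ^ 3 + / (2 * d * (z + d - d / 2) ^ 2) <= / (2 * d * (z - d / 2) ^ 2).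
Proof.
  intros Hd Hz. apply Rminus_le.
  replace (/ z ^ 3 + / (2 * d * (z + d - d / 2) ^ 2) - / (2 * d * (z - d / 2) ^ 2))
    with (- (d ^ 2 * (z ^ 2 / 2 - d ^ 2 / 16)
             / (z ^ 3 * (z + d - d / 2) ^ 2 * (z - d / 2) ^ 2))) by (field; repeat split; lra).
  apply Rge_le, Ropp_0_le_ge_contravar. apply Rdiv_le_0_compat.
  - apply Rmult_le_pos; [apply pow2_ge_0|nra].
  - repeat apply Rmult_lt_0_compat; try apply pow_lt; lra.
Qed.

Lemma envelope_tail_sum k i m : (1024 <= i)%nat ->
  lsum (fun n => envelope k (i + 168 * n)) (seq 0 m) <= IZR (tail_sum k) / IZR scale.
Proof.
  intros Hi. pose proof scale_pos as Hs. pose proof (tail_const_pos k) as Hc.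
  set (d := 168 / 128).
  assert (P : forall m i, (1024 <= i)%nat ->
     lsum (fun n => envelope k (i + 168 * n)) (seq 0 m)
     <= tail_const k * / (2 * d * (INR i / 128 - d / 2) ^ 2)).
  { clear m i Hi. induction m as [|m IH]; intros i Hi;
      assert (H1024 : 1024 <= INR i)
        by (replace 1024 with (INR 1024) by (rewrite INR_IZR_INZ; reflexivity); apply le_INR; auto).
    - unfold lsum. cbn [seq fold_right]. apply Rmult_le_pos; [lra|]. apply Rlt_le, Rinv_0_lt_compat.
      apply Rmult_lt_0_compat; [unfold d; lra|apply pow_lt; unfold d; lra].
    - rewrite lsum_seq_shift.
      rewrite (lsum_ext _ (fun n => envelope k (i + 168 + 168 * n)))
        by (intros; f_equal; lia).
      specialize (IH (i + 168)%nat ltac:(lia)).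
      eapply Rle_trans; [apply Rplus_le_compat_l; exact IH|].
      rewrite Nat.mul_0_r, Nat.add_0_r. unfold envelope.
      destruct (Nat.ltb_spec i 1024); [lia|]. unfold Rdiv at 1.
      rewrite <- Rmult_plus_distr_l. apply Rmult_le_compat_l; [lra|].
      rewrite plus_INR. replace (INR 168) with 168 by (rewrite INR_IZR_INZ; reflexivity).
      replace ((INR i + 168) / 128) with (INR i / 128 + d) by (unfold d; field).
      apply inverse_cube_telescope; unfold d; lra. }
  eapply Rle_trans; [apply P; auto|].
  assert (H1024 : 1024 <= INR i)
    by (replace 1024 with (INR 1024) by (rewrite INR_IZR_INZ; reflexivity); apply le_INR; auto).
  apply Rle_trans with (tail_const k * / 141).
  - apply Rmult_le_compat_l; [lra|]. apply Rinv_le_contravar; [lra|]. unfold d. nra.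
  - pose proof (ceil_bound (scale * tail_num k) (10000 * 141) eq_refl) as Q.
    fold (tail_sum k) in Q. rewrite !mult_IZR in Q.
    apply (Rmult_le_reg_r (IZR scale)); auto.
    unfold Rdiv. rewrite (Rmult_assoc (IZR (tail_sum k))), Rinv_l, Rmult_1_r by lra.
    rewrite tail_const_num. lra.
Qed.

Lemma tail_num_pos k : (0 < tail_num k)%Z.
Proof. destruct k as [|[|[|k]]]; reflexivity. Qed.

Lemma envelope_list_nonneg k i : (i <= 1024)%nat -> (0 <= nth i (envelope_list k) 0)%Z.
Proof.
  intros Hi. eapply Z.le_trans; [|apply suffix_max_init].
  - pose proof (tail_num_pos k).
    assert (0 <= scale * tail_num k / (10000 * 512))%Z; [|lia].
    apply Z.div_pos; [|reflexivity]. apply Z.mul_nonneg_nonneg; [|lia]. discriminate.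
  - rewrite length_map, table_length. auto.
Qed.

Lemma envelope_nonneg k i : 0 <= envelope k i.
Proof.
  pose proof scale_pos. unfold envelope. destruct (Nat.ltb_spec i 1024).
  - apply Rdiv_le_0_compat; [|auto]. apply IZR_le, envelope_list_nonneg. lia.
  - apply Rdiv_le_0_compat; [apply Rlt_le, tail_const_pos|].
    apply pow_lt. assert (0 < INR i) by (apply lt_0_INR; lia). lra.
Qed.

Lemma tail_sum_nonneg k : (0 <= tail_sum k)%Z.
Proof.
  pose proof (tail_num_pos k). unfold tail_sum.
  assert (0 <= scale * tail_num k / (10000 * 141))%Z; [|lia].
  apply Z.div_pos; [|reflexivity]. apply Z.mul_nonneg_nonneg; [|lia]. discriminate.
Qed.

Lemma bin_sum_nonneg E tail fuel i :
  (0 <= tail)%Z -> (forall i, (i < 1024)%nat -> (0 <= nth i E 0)%Z) ->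
  (0 <= bin_sum fuel E tail i)%Z.
Proof.
  intros Ht HE. revert i. induction fuel as [|fuel IH]; intros i; cbn [bin_sum]; auto.
  destruct (Nat.ltb_spec i 1024); auto. apply Z.add_nonneg_nonneg; auto.
Qed.

Lemma bin_sum_correct (g : nat -> R) E tail fuel i m :
  (forall i, 0 <= g i) -> (0 <= tail)%Z -> (forall i, (i < 1024)%nat -> (0 <= nth i E 0)%Z) ->
  (forall i, (i < 1024)%nat -> g i = IZR (nth i E 0%Z) / IZR scale) ->
  (forall i m, (1024 <= i)%nat ->
     lsum (fun n => g (i + 168 * n)%nat) (seq 0 m) <= IZR tail / IZR scale) ->
  (1024 <= i + 168 * fuel)%nat ->
  lsum (fun n => g (i + 168 * n)%nat) (seq 0 m) <= IZR (bin_sum fuel E tail i) / IZR scale.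
Proof.
  intros Hg Ht HE Eg Htail. pose proof scale_pos as Hs.
  revert i m. induction fuel as [|fuel IH]; intros i m H; cbn [bin_sum].
  - apply Htail. lia.
  - destruct (Nat.ltb_spec i 1024) as [Hi|Hi]; [|apply Htail; lia].
    assert (Hn : 0 <= IZR (bin_sum fuel E tail (i + 168)) / IZR scale).
    { apply Rdiv_le_0_compat; auto. apply IZR_le, bin_sum_nonneg; auto. }
    rewrite plus_IZR. unfold Rdiv in *. rewrite Rmult_plus_distr_r, <- Eg by auto.
    destruct m as [|m].
    + unfold lsum. cbn [seq fold_right]. specialize (Hg i). lra.
    + rewrite lsum_seq_shift, Nat.mul_0_r, Nat.add_0_r.
      apply Rplus_le_compat_l.
      rewrite (lsum_ext _ (fun n => g (i + 168 + 168 * n)%nat)) by (intros; f_equal; lia).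
      apply IH. lia.
Qed.

Lemma envelope_sum_correct k i m :
  lsum (fun n => envelope k (i + 168 * n)) (seq 0 m) <= IZR (envelope_sum k i) / IZR scale.
Proof.
  unfold envelope_sum. apply bin_sum_correct.
  - apply envelope_nonneg.
  - apply tail_sum_nonneg.
  - intros j Hj. apply envelope_list_nonneg. lia.
  - intros j Hj. unfold envelope. destruct (Nat.ltb_spec j 1024); [|lia].
    reflexivity.
  - intros. apply envelope_tail_sum; auto.
  - lia.
Qed.

Definition separated {A} (w : A -> R) (l : list A) : Prop :=
  forall x y, In x l -> In y l -> x <> y -> 168 / 128 <= Rabs (w x - w y).

(* Each half-open bin of length [168/128] contains at most one of the points. *)
Lemma one_sided_sum {A} N k (w : A -> R) l i : (166 <= N)%nat -> (k <= 3)%nat ->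
  NoDup l -> separated w l ->
  (forall x, In x l -> INR i / 128 <= w x <= PI * INR N) ->
  lsum (fun x => Rabs (K N k (w x))) l <= IZR (envelope_sum k i) / IZR scale.
Proof.
  intros HN Hk Hl Hsep Hw.
  set (idx := fun x => Z.to_nat (Int_part ((w x - INR i / 128) * 128 / 168))).
  assert (Hidx : forall x, In x l ->
    INR (idx x) <= (w x - INR i / 128) * 128 / 168 < INR (idx x) + 1).
  { intros x Hx. destruct (Hw x Hx) as [H1 _].
    destruct (base_Int_part ((w x - INR i / 128) * 128 / 168)) as [B1 B2].
    unfold idx. rewrite INR_IZR_INZ, Z2Nat.id; [lra|].
    apply le_IZR. assert (0 <= (w x - INR i / 128) * 128 / 168) by lra.
    assert (-1 < IZR (Int_part ((w x - INR i / 128) * 128 / 168))) by lra.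
    apply IZR_le. apply lt_IZR in H0. lia. }
  assert (Hle : forall x, In x l -> Rabs (K N k (w x)) <= envelope k (i + 168 * idx x)).
  { intros x Hx. apply (envelope_correct N k); auto. split; [|apply Hw; auto].
    destruct (Hidx x Hx) as [H1 _]. rewrite plus_INR, mult_INR.
    replace (INR 168) with 168 by (rewrite INR_IZR_INZ; reflexivity). lra. }
  eapply Rle_trans; [apply lsum_le; exact Hle|].
  rewrite <- (lsum_map (fun n => envelope k (i + 168 * n)) idx l).
  set (m := S (list_max (map idx l))).
  eapply Rle_trans; [|apply (envelope_sum_correct k i m)].
  apply lsum_incl.
  - intros; apply envelope_nonneg.
  - clear Hle m. revert Hidx Hsep. induction l as [|x l IH]; intros Hidx Hsep; simpl; constructor.
    + intros Hin. apply in_map_iff in Hin as (y & E & Hy).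
      inversion Hl; subst. assert (x <> y) by (intros ->; auto).
      specialize (Hsep x y (or_introl eq_refl) (or_intror Hy) H).
      pose proof (Hidx x (or_introl eq_refl)) as Ix. pose proof (Hidx y (or_intror Hy)) as Iy.
      rewrite E in Iy. revert Hsep. apply Rlt_not_le. apply Rabs_def1; lra.
    + inversion Hl; subst. apply IH; auto.
      * intros y Hy; apply Hw; right; auto.
      * intros y Hy; apply Hidx; right; auto.
      * intros y z Hy Hz; apply Hsep; right; auto.
  - intros n Hn. apply in_seq. split; [lia|]. simpl. unfold m. apply Nat.lt_succ_r.
    pose proof (list_max_le (map idx l) (list_max (map idx l))) as [Q _].
    specialize (Q (le_n _)). rewrite Forall_forall in Q. auto.
Qed.

Lemma lsum_filter {A} (f : A -> R) (b : A -> bool) l :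
  lsum f l = lsum f (filter b l) + lsum f (filter (fun x => negb (b x)) l).
Proof.
  induction l as [|x l IH]; simpl; [lra|]. destruct (b x); simpl; lra.
Qed.

Lemma two_sided_sum {A} N k (w : A -> R) l i1 i2 : (166 <= N)%nat -> (k <= 3)%nat ->
  NoDup l -> separated w l ->
  (forall x, In x l -> Rabs (w x) <= PI * INR N) ->
  (forall x, In x l -> INR i1 / 128 <= w x \/ w x <= - (INR i2 / 128)) ->
  lsum (fun x => Rabs (K N k (w x))) l
  <= (IZR (envelope_sum k i1) + IZR (envelope_sum k i2)) / IZR scale.
Proof.
  intros HN Hk Hl Hsep Hw Hside.
  set (b := fun x => if Rle_lt_dec (INR i1 / 128) (w x) then true else false).
  rewrite (lsum_filter _ b). unfold Rdiv. rewrite Rmult_plus_distr_r. apply Rplus_le_compat.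
  - apply (one_sided_sum N k w _ i1); auto.
    + apply NoDup_filter; auto.
    + intros x y Hx Hy. apply filter_In in Hx, Hy. apply Hsep; tauto.
    + intros x Hx. apply filter_In in Hx as [Hx Hb]. unfold b in Hb.
      destruct (Rle_lt_dec (INR i1 / 128) (w x)); [|discriminate].
      split; auto. eapply Rle_trans; [apply Rle_abs|auto].
  - rewrite (lsum_ext _ (fun x => Rabs (K N k (- w x)))) by (intros; symmetry; apply abs_K_opp).
    apply (one_sided_sum N k (fun x => - w x) _ i2); auto.
    + apply NoDup_filter; auto.
    + intros x y Hx Hy Hxy. apply filter_In in Hx, Hy.
      replace (- w x - - w y) with (- (w x - w y)) by ring. rewrite Rabs_Ropp.
      apply Hsep; tauto.
    + intros x Hx. apply filter_In in Hx as [Hx Hb]. unfold b in Hb.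
      destruct (Rle_lt_dec (INR i1 / 128) (w x)); [discriminate|].
      destruct (Hside x Hx); [lra|]. split; [lra|].
      eapply Rle_trans; [apply Rle_abs|]. rewrite Rabs_Ropp. auto.
Qed.

(** * The numerical conditions *)

(* Throughout, [10280/10000] bounds the coefficients of the kernel in the
   interpolant, [539/10000] those of its derivative, and [280/10000] the
   deviation of the former from the prescribed values; [S k i] bounds the sum of
   [Rabs (K N k)] over the nodes beyond [i/128] on one side. *)
Definition far_check (S : nat -> nat -> Z) (i : nat) : bool :=
  (10280 * (cell 0%nat i + (S 0%nat (167 - i)%nat + S 0%nat (168 + i)%nat))
   + 539 * (cell 1%nat i + (S 1%nat (167 - i)%nat + S 1%nat (168 + i)%nat)) <=? 9990 * scale)%Z.

(** Bounds, in units of [1 / (10000 * scale)], the second derivative of the interpolant minus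
    [a t * K]. The second derivative of the node's own kernel cancels, so the node itself enters
    only through [g t] times the third derivative, bounded by [m3]. *)
Definition curvature (S : nat -> nat -> Z) (m3 : Z) (i1 i2 : nat) : Z :=
  (10280 * (S 2%nat i1 + S 2%nat i2) + 539 * (m3 + (S 3%nat i1 + S 3%nat i2)))%Z.

(* Integrates the curvature twice over cells of length [1/128]; [R1] and [R] are
   in units of [1/(128 * 10000 * scale)] and [1/(2 * 128^2 * 10000 * scale)]. *)
Fixpoint near_check (S : nat -> nat -> Z) (n i : nat) (R1 R : Z) : bool :=
  match n with
  | O => true
  | Datatypes.S n =>
      let e := curvature S (cell 3 i) (167 - i) (168 + i) in
      let R' := (R + 2 * R1 + e)%Z in
      ((32768 * (280 * scale + 9720 * cell 0 i) + R' <=? 32768 * (9999 * scale))%Z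
       && near_check S n (Datatypes.S i) (R1 + e)%Z R')%bool
  end.

(** For [0 <= z <= 1/16] the linear bound on the third derivative gives [44.08 / 16 = 2.755]. *)
Definition first_m3 : Z := (scale * 276 / 100 + 1)%Z.

Definition first_curvature (S : nat -> nat -> Z) : Z := curvature S first_m3 160 168.

(** Distances to a node are counted in cells of length 1/128. Up to 8 cells the curvature bound 3.5
    gives a quadratic estimate; from 8 to 56, [near_check] takes 48 steps; from 56 to 84,
    [far_check] applies. Points at least 84 cells, half the separation, from every node are covered
    by the fourth line. The first three lines control the interpolation system. *)
Definition grid_check (S : nat -> nat -> Z) : bool :=
  ((10000 * (2 * S 0%nat 168%nat) <=? 207 * scale)%Z
   && (10000 * (2 * S 1%nat 168%nat) <=? 1236 * scale)%Z
   && (10000 * (2 * S 2%nat 168%nat) <=? 18050 * scale)%Z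
   && (10280 * (2 * S 0%nat 84%nat) + 539 * (2 * S 1%nat 84%nat) <=? 9990 * scale)%Z
   && forallb (far_check S) (seq 56 28)
   && (first_curvature S <=? 35000 * scale)%Z
   && near_check S 48 8 (8 * first_curvature S) (64 * first_curvature S))%bool.

(** The envelopes are arguments so that evaluation by value computes each list once, not at every
    lookup. *)
Definition sums_of (E0 E1 E2 E3 : list Z) (k i : nat) : Z :=
  bin_sum 7 (nth k [E0; E1; E2; E3] []) (tail_sum k) i.

Lemma grid_check_ok :
  grid_check (sums_of (envelope_list 0) (envelope_list 1) (envelope_list 2) (envelope_list 3))
  = true.
Proof. vm_compute. reflexivity. Qed.

Lemma sums_of_eq (E : nat -> list Z) k i : (k <= 3)%nat ->
  sums_of (E 0%nat) (E 1%nat) (E 2%nat) (E 3%nat) k i = bin_sum 7 (E k) (tail_sum k) i.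
Proof. intros Hk. destruct k as [|[|[|[|k]]]]; [| | | |lia]; reflexivity. Qed.

(** Hides the evaluated sums behind a variable, so that later proofs use only equations and the
    outcome of the check. *)
Lemma grid_sums_exist : exists S : nat -> nat -> Z,
  (forall k i, (k <= 3)%nat -> S k i = envelope_sum k i) /\ grid_check S = true.
Proof.
  exists (sums_of (envelope_list 0) (envelope_list 1) (envelope_list 2) (envelope_list 3)).
  split; [|exact grid_check_ok]. intros k i Hk. unfold envelope_sum.
  rewrite <- (sums_of_eq envelope_list k i Hk). reflexivity.
Qed.

Definition esum (k i : nat) : R := IZR (envelope_sum k i) / IZR scale.

Lemma Z_leb_scaled a b c d : (a <=? b)%Z = true -> IZR a = c * IZR scale ->
  IZR b = d * IZR scale -> c <= d.
Proof.
  intros H Ha Hb. pose proof scale_pos. apply Z.leb_le, IZR_le in H.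
  rewrite Ha, Hb in H. apply (Rmult_le_reg_r (IZR scale)); auto.
Qed.

Lemma esum_scale k i : IZR (envelope_sum k i) = esum k i * IZR scale.
Proof. pose proof scale_pos. unfold esum. field. lra. Qed.

Lemma grid_facts S :
  (forall k i, (k <= 3)%nat -> S k i = envelope_sum k i) -> grid_check S = true ->
  2 * esum 0 168 <= 207 / 10000 /\ 2 * esum 1 168 <= 1236 / 10000 /\
  2 * esum 2 168 <= 1805 / 1000 /\
  1028 / 1000 * (2 * esum 0 84) + 539 / 10000 * (2 * esum 1 84) <= 999 / 1000 /\
  (forall i, (56 <= i < 84)%nat -> far_check S i = true) /\
  (first_curvature S <=? 35000 * scale)%Z = true /\
  near_check S 48 8 (8 * first_curvature S) (64 * first_curvature S) = true.
Proof.
  intros HS H. unfold grid_check in H.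
  apply andb_prop in H as [H H7]. apply andb_prop in H as [H H6].
  apply andb_prop in H as [H H5]. apply andb_prop in H as [H H4].
  apply andb_prop in H as [H H3]. apply andb_prop in H as [H1 H2].
  rewrite (HS 0%nat) in H1, H4 by lia. rewrite (HS 1%nat) in H2, H4 by lia.
  rewrite (HS 2%nat) in H3 by lia.
  split; [|split; [|split; [|split; [|split; [|split; [exact H6|exact H7]]]]]].
  - apply (Z_leb_scaled _ _ (10000 * (2 * esum 0 168)) 207) in H1; [lra|rewrite !mult_IZR, esum_scale; ring|apply mult_IZR].
  - apply (Z_leb_scaled _ _ (10000 * (2 * esum 1 168)) 1236) in H2; [lra|rewrite !mult_IZR, esum_scale; ring|apply mult_IZR].
  - apply (Z_leb_scaled _ _ (10000 * (2 * esum 2 168)) 18050) in H3; [lra|rewrite !mult_IZR, esum_scale; ring|apply mult_IZR].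
  - apply (Z_leb_scaled _ _ (10280 * (2 * esum 0 84) + 539 * (2 * esum 1 84)) 9990) in H4; [lra|rewrite plus_IZR, !mult_IZR, !esum_scale; ring|apply mult_IZR].
  - intros i Hi. rewrite forallb_forall in H5. apply H5, in_seq. lia.
Qed.

(** * Signed displacements on the circle *)

(** [up r] is the integer in [(r, r + 1]], so this is the representative of [x] modulo 1 in
    [[-1/2, 1/2)]. *)
Definition centered (x : R) : R := x - IZR (up (x - 1 / 2)).

Lemma centered_bound x : -1 / 2 <= centered x < 1 / 2.
Proof. unfold centered. pose proof (archimed (x - 1 / 2)). lra. Qed.

Lemma centered_id x : -1 / 2 <= x < 1 / 2 -> centered x = x.
Proof.
  intros H. unfold centered. rewrite <- (tech_up (x - 1 / 2) 0); simpl; lra.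
Qed.

(* [N] kernel periods of length [2 PI] make up the circle. *)
Definition circumference (N : nat) : R := 2 * PI * INR N.

(** Mixed units: [z] is in the kernel variable, while the node [s] is a circle coordinate. This is
    [z - circumference N * s] reduced modulo the circumference. *)
Definition disp (N : nat) (z s : R) : R :=
  circumference N * centered (z / circumference N - s).

Lemma circumference_large N : (166 <= N)%nat -> 1042 <= circumference N.
Proof.
  intros HN. assert (HN' : 166 <= INR N)
    by (replace 166 with (INR 166) by (simpl; lra); apply le_INR; lia).
  pose proof PI_lower. unfold circumference. nra.
Qed.

Lemma abs_disp_le N z s : (166 <= N)%nat -> Rabs (disp N z s) <= PI * INR N.
Proof.
  intros HN. pose proof (circumference_large N HN).
  pose proof (centered_bound (z / circumference N - s)).
  unfold disp. rewrite Rabs_mult, (Rabs_pos_eq (circumference N)) by lra.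
  replace (PI * INR N) with (circumference N * (1 / 2)) by (unfold circumference; lra).
  apply Rmult_le_compat_l; [lra|]. apply Rabs_le. lra.
Qed.

Lemma K_disp N k z s : (166 <= N)%nat ->
  K N k (z - circumference N * s) = K N k (disp N z s).
Proof.
  intros HN. pose proof (circumference_large N HN). unfold disp, centered.
  set (n := up _).
  rewrite <- (K_period N k n (circumference N * (z / circumference N - s - IZR n))) by lia.
  f_equal. fold (circumference N). field. lra.
Qed.

Lemma disp_local N t y : (166 <= N)%nat -> Rabs y <= 1 ->
  disp N (circumference N * t + y) t = y.
Proof.
  intros HN Hy. pose proof (circumference_large N HN) as HC. unfold disp.
  replace ((circumference N * t + y) / circumference N - t) with (y / circumference N)
    by (field; lra).
  apply Rabs_le_between in Hy.
  rewrite centered_id; [field; lra|].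
  assert (E : y / circumference N * circumference N = y) by (field; lra).
  set (q := y / circumference N) in *. clearbody q. split; nra.
Qed.

(** Required from every viewpoint [z]: cutting the circle opposite to [z] then gives separated
    points on a line, to which the bin argument applies. *)
Definition spread (N : nat) (L : list R) : Prop :=
  NoDup L /\ forall z, separated (disp N z) L.

Definition others (t : R) (L : list R) : list R := remove Req_EM_T t L.

Lemma lsum_others f t L : NoDup L -> In t L -> lsum f L = f t + lsum f (others t L).
Proof.
  unfold others. intros HL Ht. induction L as [|s L IH]; [destruct Ht|].
  inversion HL; subst. simpl. destruct (Req_EM_T t s) as [<-|Hts].
  - rewrite notin_remove by auto. reflexivity.
  - destruct Ht as [<-|Ht]; [congruence|]. simpl. rewrite IH by auto. lra.
Qed.

Lemma NoDup_others t L : NoDup L -> NoDup (others t L).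
Proof.
  unfold others. intros HL. induction L as [|s L IH]; simpl; auto.
  inversion HL; subst. destruct (Req_EM_T t s); auto. constructor; auto.
  intros H. apply in_remove in H. tauto.
Qed.

(** Let [w] be the displacement of [z] from [t], say [w >= 0]. Every other displacement is at least
    [w + 168/128] or at most [w - 168/128]. For [w] in cell [i] this gives the starting cells
    [168 + i] and [167 - i], the latter from the right end of the cell. *)
Lemma others_sum N k L z t lo hi i1 i2 : (166 <= N)%nat -> (k <= 3)%nat ->
  spread N L -> In t L -> lo <= Rabs (disp N z t) <= hi ->
  INR i1 / 128 <= 168 / 128 + lo -> INR i2 / 128 <= 168 / 128 - hi ->
  lsum (fun s => Rabs (K N k (disp N z s))) (others t L) <= esum k i1 + esum k i2.
Proof.
  intros HN Hk [HL Hsep] Ht Hw H1 H2.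
  assert (Hsep' : separated (disp N z) (others t L)).
  { intros x y Hx Hy. apply in_remove in Hx, Hy. apply (Hsep z); tauto. }
  assert (Hb : forall s, In s (others t L) -> Rabs (disp N z s) <= PI * INR N)
    by (intros; apply abs_disp_le; auto).
  assert (Hd : forall s, In s (others t L) -> 168 / 128 <= Rabs (disp N z s - disp N z t)).
  { intros s Hs. apply in_remove in Hs as [Hs Hst]. apply (Hsep z); auto. }
  pose proof (NoDup_others t L HL) as Hnd. pose proof scale_pos.
  unfold esum. unfold Rdiv. rewrite <- Rmult_plus_distr_r.
  destruct (Rle_lt_dec 0 (disp N z t)) as [Hp|Hp].
  - rewrite Rabs_pos_eq in Hw by auto.
    apply (two_sided_sum N k (disp N z) _ i1 i2); auto.
    intros s Hs. specialize (Hd s Hs). unfold Rabs in Hd. destruct (Rcase_abs _); [right|left]; lra.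
  - rewrite Rabs_left in Hw by auto. rewrite (Rplus_comm (IZR (envelope_sum k i1))).
    apply (two_sided_sum N k (disp N z) _ i2 i1); auto.
    intros s Hs. specialize (Hd s Hs). unfold Rabs in Hd. destruct (Rcase_abs _); [right|left]; lra.
Qed.

(** * The size of the interpolant *)

(* The [k]-th derivative of a real combination of shifted kernels and kernel
   derivatives. *)
Definition psi (N : nat) (a g : R -> R) (L : list R) (k : nat) (z : R) : R :=
  lsum (fun s => a s * K N k (z - circumference N * s)
                 + g s * K N (S k) (z - circumference N * s)) L.

Lemma is_derive_shifted N k c b z :
  is_derive (fun z => c * K N k (z - b)) z (c * K N (S k) (z - b)).
Proof.
  evar_last.
  - apply (is_derive_scal (fun z => K N k (z - b)) z c).
    apply (is_derive_comp (K N k) (fun z => z - b) z); [apply is_derive_K|].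
    apply (is_derive_minus (fun z : R => z) (fun _ => b) z 1 0);
      [apply (is_derive_id (K := R_AbsRing))|apply (is_derive_const (V := R_NormedModule))].
  - unfold scal, minus, plus, opp; simpl; unfold mult; simpl. ring.
Qed.

Lemma is_derive_psi N a g L k z : is_derive (psi N a g L k) z (psi N a g L (S k) z).
Proof.
  unfold psi. apply (is_derive_lsum (fun s z => a s * K N k (z - circumference N * s)
                 + g s * K N (S k) (z - circumference N * s))). intros s _.
  apply (is_derive_plus (fun z => a s * K N k (z - circumference N * s))
    (fun z => g s * K N (S k) (z - circumference N * s))); apply is_derive_shifted.
Qed.

Definition bounded_coeffs (a g : R -> R) (L : list R) : Prop :=
  forall s, In s L -> Rabs (a s) <= 1028 / 1000 /\ Rabs (g s) <= 539 / 10000.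

Lemma weighted_sum_le N a g L L' k z : (166 <= N)%nat -> bounded_coeffs a g L -> incl L' L ->
  Rabs (lsum (fun s => a s * K N k (z - circumference N * s)
                 + g s * K N (S k) (z - circumference N * s)) L')
  <= 1028 / 1000 * lsum (fun s => Rabs (K N k (disp N z s))) L'
     + 539 / 10000 * lsum (fun s => Rabs (K N (S k) (disp N z s))) L'.
Proof.
  intros HN Hb Hi. rewrite <- !lsum_scal, <- lsum_plus.
  eapply Rle_trans; [apply lsum_abs|]. apply lsum_le. intros s Hs.
  destruct (Hb s (Hi s Hs)) as [Ha Hg].
  rewrite !K_disp by auto.
  eapply Rle_trans; [apply Rabs_triang|]. rewrite !Rabs_mult.
  apply Rplus_le_compat; apply Rmult_le_compat_r; auto using Rabs_pos.
Qed.

Lemma abs_psi_split N a g L k z t i1 i2 lo hi : (166 <= N)%nat -> (k <= 2)%nat ->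
  spread N L -> bounded_coeffs a g L -> In t L -> lo <= Rabs (disp N z t) <= hi ->
  INR i1 / 128 <= 168 / 128 + lo -> INR i2 / 128 <= 168 / 128 - hi ->
  Rabs (psi N a g L k z - (a t * K N k (disp N z t) + g t * K N (S k) (disp N z t)))
  <= 1028 / 1000 * (esum k i1 + esum k i2) + 539 / 10000 * (esum (S k) i1 + esum (S k) i2).
Proof.
  intros HN Hk HL Hb Ht Hw H1 H2. unfold psi.
  rewrite (lsum_others _ t L) by (try apply HL; auto). cbv beta. rewrite !(K_disp N _ z t) by auto.
  match goal with |- Rabs (?x + ?y - ?x) <= _ => replace (x + y - x) with y by ring end.
  eapply Rle_trans; [apply (weighted_sum_le N a g L)|]; auto.
  - intros s Hs. apply in_remove in Hs. tauto.
  - pose proof (others_sum N k L z t lo hi i1 i2 HN ltac:(lia) HL Ht Hw H1 H2).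
    pose proof (others_sum N (S k) L z t lo hi i1 i2 HN ltac:(lia) HL Ht Hw H1 H2). lra.
Qed.

(** With [phi'] scaled by 128 and [phi] by [2 * 128^2 = 32768], a Taylor step over one cell with
    curvature [e] sends [R1] to [R1 + e] and [R] to [R + 2 R1 + e]. *)
Lemma near_loop S (f phi phi' phi'' : R -> R) n :
  (forall x, is_derive phi x (phi' x)) -> (forall x, is_derive phi' x (phi'' x)) ->
  (forall i y, (i < 84)%nat -> INR i / 128 <= y <= INR (Datatypes.S i) / 128 ->
     Rabs (phi'' y) * (10000 * IZR scale) <= IZR (curvature S (cell 3 i) (167 - i) (168 + i))) ->
  (forall i y, (i < 84)%nat -> INR i / 128 <= y <= INR (Datatypes.S i) / 128 ->
     f y * (10000 * IZR scale) <= IZR (280 * scale + 9720 * cell 0 i)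
       + phi y * (10000 * IZR scale)) ->
  forall i R1 R, near_check S n i R1 R = true -> (i + n <= 84)%nat -> (0 <= R1)%Z ->
  phi' (INR i / 128) * (128 * (10000 * IZR scale)) <= IZR R1 ->
  phi (INR i / 128) * (32768 * (10000 * IZR scale)) <= IZR R ->
  forall y, INR i / 128 <= y < INR (i + n) / 128 -> f y <= 9999 / 10000.
Proof.
  intros D1 D2 Hcurv Hval. pose proof scale_pos as Hs.
  induction n as [|n IH]; intros i R1 R Hc Hi HR1 H1 H0 y Hy.
  - rewrite Nat.add_0_r in Hy. lra.
  - cbn [near_check] in Hc. apply andb_prop in Hc as [Hc1 Hc2].
    apply Z.leb_le, IZR_le in Hc1.
    set (e := curvature S (cell 3 i) (167 - i) (168 + i)) in *.
    assert (He : 0 <= IZR e).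
    { eapply Rle_trans; [|apply (Hcurv i (INR i / 128)); [lia|rewrite S_INR; lra]].
      apply Rmult_le_pos; [apply Rabs_pos|lra]. }
    set (u := 10000 * IZR scale) in *. assert (Hu : 0 < u) by (unfold u; lra).
    assert (T : forall x, INR i / 128 <= x <= INR (Datatypes.S i) / 128 ->
      phi' x * (128 * u) <= IZR R1 + IZR e * (128 * x - INR i) /\
      phi x * (32768 * u) <= IZR R + 2 * IZR R1 * (128 * x - INR i)
         + IZR e * (128 * x - INR i) ^ 2).
    { intros x Hx.
      destruct (taylor2_upper phi phi' phi'' (INR i / 128) x (IZR e / u)) as [T1 T2]; auto; [lra| |].
      - intros w Hw. eapply Rle_trans; [apply Rle_abs|].
        apply (Rmult_le_reg_r u); auto.
        replace (IZR e / u * u) with (IZR e) by (field; lra).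
        apply Hcurv; [lia|lra].
      - set (h := 128 * x - INR i). assert (Hh : 0 <= h) by (unfold h; lra).
        replace (x - INR i / 128) with (h / 128) in * by (unfold h; field).
        split.
        + apply (Rmult_le_compat_r (128 * u)) in T1; [|lra].
          replace ((phi' (INR i / 128) + IZR e / u * (h / 128)) * (128 * u))
            with (phi' (INR i / 128) * (128 * u) + IZR e * h) in T1 by (field; lra). lra.
        + apply (Rmult_le_compat_r (32768 * u)) in T2; [|lra].
          replace ((phi (INR i / 128) + phi' (INR i / 128) * (h / 128)
              + IZR e / u * (h / 128) ^ 2 / 2) * (32768 * u))
            with (phi (INR i / 128) * (32768 * u) + 2 * (phi' (INR i / 128) * (128 * u)) * h
                  + IZR e * h ^ 2) in T2 by (field; lra).
          assert (2 * (phi' (INR i / 128) * (128 * u)) * h <= 2 * IZR R1 * h)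
            by (apply Rmult_le_compat_r; lra). lra. }
    destruct (Rle_lt_dec (INR (Datatypes.S i) / 128) y) as [Hy'|Hy'].
    + destruct (T (INR (Datatypes.S i) / 128)) as [T1 T2]; [rewrite S_INR; lra|].
      replace (128 * (INR (Datatypes.S i) / 128) - INR i) with 1 in * by (rewrite S_INR; field).
      apply (IH (Datatypes.S i) (R1 + e)%Z (R + 2 * R1 + e)%Z); auto.
      * lia.
      * apply le_IZR in He. lia.
      * rewrite plus_IZR. lra.
      * rewrite !plus_IZR, mult_IZR. lra.
      * replace (Datatypes.S i + n)%nat with (i + Datatypes.S n)%nat by lia. lra.
    + destruct (T y) as [_ T2]; [lra|].
      pose proof (Hval i y ltac:(lia) ltac:(lra)) as V.
      set (h := 128 * y - INR i) in *. assert (Hh : 0 <= h <= 1) by (unfold h; rewrite S_INR in Hy'; lra).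
      rewrite !plus_IZR, !mult_IZR, !plus_IZR, !mult_IZR in Hc1. rewrite !plus_IZR, !mult_IZR in V.
      assert (HR1' : 0 <= IZR R1) by (apply IZR_le; auto).
      (* As [R1] and [e] are nonnegative, the bound increases along the cell, so the check at its
         right end covers all of it. *)
      assert (2 * IZR R1 * h <= 2 * IZR R1) by nra.
      assert (IZR e * h ^ 2 <= IZR e) by (assert (h ^ 2 <= 1) by nra; nra).
      apply (Rmult_le_reg_r u); auto. unfold u in *. lra.
Qed.

Lemma curvature_real S m i1 i2 :
  (forall k i, (k <= 3)%nat -> S k i = envelope_sum k i) ->
  IZR (curvature S m i1 i2)
  = (1028 / 1000 * (esum 2 i1 + esum 2 i2)
     + 539 / 10000 * (IZR m / IZR scale + (esum 3 i1 + esum 3 i2))) * (10000 * IZR scale).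
Proof.
  intros HS. pose proof scale_pos. unfold curvature.
  rewrite (HS 2%nat i1), (HS 2%nat i2), (HS 3%nat i1), (HS 3%nat i2) by lia.
  rewrite !plus_IZR, !mult_IZR, !plus_IZR, !esum_scale. field. lra.
Qed.

Lemma K_sign_even N k s y : (s = 1 \/ s = -1) -> (k = 0 \/ k = 2)%nat -> K N k (s * y) = K N k y.
Proof.
  intros [-> | ->] Hk.
  - now rewrite Rmult_1_l.
  - replace (-1 * y) with (- y) by ring. rewrite K_opp.
    destruct Hk as [-> | ->]; simpl; ring.
Qed.

Lemma abs_sign_mult s y : (s = 1 \/ s = -1) -> 0 <= y -> Rabs (s * y) = y.
Proof.
  intros [-> | ->] Hy.
  - rewrite Rmult_1_l. apply Rabs_pos_eq; auto.
  - replace (-1 * y) with (- y) by ring. rewrite Rabs_Ropp. apply Rabs_pos_eq; auto.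
Qed.

Lemma K0_cell_bound N i y : (166 <= N)%nat -> (i < 84)%nat ->
  INR i / 128 <= y <= INR (S i) / 128 -> 0 <= K N 0 y /\ K N 0 y * IZR scale <= IZR (cell 0 i).
Proof.
  intros HN Hi Hy. pose proof scale_pos.
  assert (INR (S i) <= 84)
    by (replace 84 with (INR 84) by (rewrite INR_IZR_INZ; reflexivity); apply le_INR; lia).
  pose proof (pos_INR i). pose proof (K0_ge N y ltac:(lia)).
  (* At distance at most 84/128 the quadratic lower bound is still positive:
     [25/12 * (84/128)^2 < 0.9]. *)
  assert (0 <= K N 0 y) by nra. split; auto.
  pose proof (cell_correct N 0 i y HN ltac:(lia) ltac:(lia) Hy) as C.
  rewrite Rabs_pos_eq in C by auto. auto.
Qed.

Section NearZone.

(* [t] is an interpolation point, [s] a sign selecting a side of [t]. *)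
Context (N : nat) (a g : R -> R) (L : list R) (t nu s : R).
Context (HN : (166 <= N)%nat) (HL : spread N L) (Hb : bounded_coeffs a g L) (Ht : In t L).
Context (Hs : s = 1 \/ s = -1) (Hnu : Rabs nu <= 1) (Ha : Rabs (a t - nu) <= 28 / 1000).
Context (Hval : psi N a g L 0 (circumference N * t) = nu).
Context (Hder : psi N a g L 1 (circumference N * t) = 0).
Context (S : nat -> nat -> Z) (HS : forall k i, (k <= 3)%nat -> S k i = envelope_sum k i).

Definition branch (k : nat) (y : R) : R := psi N a g L k (circumference N * t + s * y).
(** Subtracting [nu + a t * (K - 1)] rather than [a t * K] makes the remainder and its derivative
    vanish exactly at the node, so a bound on [rem2] is all that has to be integrated. *)
Definition rem0 (y : R) : R := branch 0 y - nu - a t * (K N 0 y - 1).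
Definition rem1 (y : R) : R := s * branch 1 y - a t * K N 1 y.
Definition rem2 (y : R) : R := branch 2 y - a t * K N 2 y.

Lemma is_derive_branch k y : is_derive (branch k) y (s * branch (Datatypes.S k) y).
Proof.
  unfold branch.
  apply (is_derive_comp (psi N a g L k) (fun y => circumference N * t + s * y) y).
  - apply is_derive_psi.
  - auto_derive; auto. ring.
Qed.

Lemma is_derive_rem0 y : is_derive rem0 y (rem1 y).
Proof.
  unfold rem0, rem1. pose proof (is_derive_branch 0 y) as D1. pose proof (is_derive_K N 0 y) as D2.
  evar_last.
  - apply (is_derive_minus (fun y => branch 0 y - nu) (fun y => a t * (K N 0 y - 1))).
    + apply (is_derive_minus (branch 0) (fun _ => nu)); [exact D1|].
      apply (is_derive_const (V := R_NormedModule)).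
    + apply (is_derive_scal (fun y => K N 0 y - 1)).
      apply (is_derive_minus (K N 0) (fun _ => 1)); [exact D2|].
      apply (is_derive_const (V := R_NormedModule)).
  - unfold scal, minus, plus, opp, zero; simpl; unfold mult; simpl. ring.
Qed.

Lemma is_derive_rem1 y : is_derive rem1 y (rem2 y).
Proof.
  unfold rem1, rem2. pose proof (is_derive_branch 1 y) as D1. pose proof (is_derive_K N 1 y) as D2.
  evar_last.
  - apply (is_derive_minus (fun y => s * branch 1 y) (fun y => a t * K N 1 y)).
    + apply (is_derive_scal (branch 1)); exact D1.
    + apply (is_derive_scal (K N 1)); exact D2.
  - unfold scal, minus, plus, opp, zero; simpl; unfold mult; simpl.
    destruct Hs as [-> | ->]; ring.
Qed.

Lemma rem0_at_0 : rem0 0 = 0.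
Proof.
  unfold rem0, branch. rewrite Rmult_0_r, Rplus_0_r, Hval, K_at_0 by lia. ring.
Qed.

Lemma rem1_at_0 : rem1 0 = 0.
Proof. unfold rem1, branch. rewrite Rmult_0_r, Rplus_0_r, Hder, K1_at_0. ring. Qed.

Lemma abs_rem2 y lo hi i1 i2 : 0 <= lo -> lo <= y <= hi -> hi <= 1 ->
  INR i1 / 128 <= 168 / 128 + lo -> INR i2 / 128 <= 168 / 128 - hi ->
  Rabs (rem2 y) <= 1028 / 1000 * (esum 2 i1 + esum 2 i2)
    + 539 / 10000 * (Rabs (K N 3 y) + (esum 3 i1 + esum 3 i2)).
Proof.
  intros Hlo Hy Hhi H1 H2.
  assert (D : disp N (circumference N * t + s * y) t = s * y).
  { apply disp_local; auto. rewrite abs_sign_mult by (auto; lra). lra. }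
  pose proof (abs_psi_split N a g L 2 (circumference N * t + s * y) t i1 i2 lo hi
    HN (le_n _) HL Hb Ht) as P.
  rewrite D, abs_sign_mult in P by (auto; lra). specialize (P Hy H1 H2).
  rewrite K_sign_even in P by auto. fold (branch 2 y) in P.
  destruct (Hb t Ht) as [_ Hg].
  assert (E : Rabs (K N 3 (s * y)) = Rabs (K N 3 y)).
  { rewrite <- abs_K_abs, abs_sign_mult by (auto; lra). reflexivity. }
  assert (Rabs (g t * K N 3 (s * y)) <= 539 / 10000 * Rabs (K N 3 y)).
  { rewrite Rabs_mult, E. apply Rmult_le_compat_r; auto using Rabs_pos. }
  unfold rem2.
  replace (branch 2 y - a t * K N 2 y) with
    ((branch 2 y - (a t * K N 2 y + g t * K N 3 (s * y))) + g t * K N 3 (s * y)) by ring.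
  eapply Rle_trans; [apply Rabs_triang|]. lra.
Qed.

Lemma rem2_cell i y : (i < 84)%nat -> INR i / 128 <= y <= INR (Datatypes.S i) / 128 ->
  Rabs (rem2 y) * (10000 * IZR scale) <= IZR (curvature S (cell 3 i) (167 - i) (168 + i)).
Proof.
  intros Hi Hy. pose proof scale_pos as Hsc. rewrite curvature_real by auto.
  apply Rmult_le_compat_r; [lra|].
  assert (INR (Datatypes.S i) <= 84)
    by (replace 84 with (INR 84) by (rewrite INR_IZR_INZ; reflexivity); apply le_INR; lia).
  pose proof (pos_INR i).
  pose proof (abs_rem2 y (INR i / 128) (INR (Datatypes.S i) / 128) (168 + i) (167 - i)
    ltac:(lra) Hy ltac:(lra)) as R2.
  rewrite plus_INR, minus_INR, (S_INR i) in R2 by lia.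
  replace (INR 168) with 168 in R2 by (rewrite INR_IZR_INZ; reflexivity).
  replace (INR 167) with 167 in R2 by (rewrite INR_IZR_INZ; reflexivity).
  specialize (R2 ltac:(lra) ltac:(lra)).
  pose proof (cell_correct N 3 i y HN (le_n _) ltac:(lia) Hy) as C.
  assert (Rabs (K N 3 y) <= IZR (cell 3 i) / IZR scale).
  { apply (Rmult_le_reg_r (IZR scale)); auto.
    unfold Rdiv. rewrite Rmult_assoc, Rinv_l by lra. lra. }
  lra.
Qed.

Lemma rem2_first y : 0 <= y <= 1 / 16 ->
  Rabs (rem2 y) * (10000 * IZR scale) <= IZR (first_curvature S).
Proof.
  intros Hy. pose proof scale_pos as Hsc. unfold first_curvature. rewrite curvature_real by auto.
  apply Rmult_le_compat_r; [lra|].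
  pose proof (abs_rem2 y 0 (1 / 16) 168 160 ltac:(lra) Hy ltac:(lra)) as R2.
  replace (INR 168) with 168 in R2 by (rewrite INR_IZR_INZ; reflexivity).
  replace (INR 160) with 160 in R2 by (rewrite INR_IZR_INZ; reflexivity).
  specialize (R2 ltac:(lra) ltac:(lra)).
  pose proof (abs_K3_le_abs N y HN) as C. rewrite (Rabs_pos_eq y) in C by lra.
  assert (276 / 100 <= IZR first_m3 / IZR scale).
  { apply (Rmult_le_reg_r (IZR scale)); auto.
    unfold Rdiv at 2. rewrite Rmult_assoc, Rinv_l by lra.
    unfold first_m3. pose proof (ceil_bound (scale * 276) 100 eq_refl) as Q.
    rewrite mult_IZR in Q. lra. }
  lra.
Qed.

Lemma branch_decomposition y :
  branch 0 y = nu * K N 0 y + (a t - nu) * (K N 0 y - 1) + rem0 y.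
Proof. unfold rem0. ring. Qed.

(** For [0 <= K <= 1] the worst case is [nu = 1] with [a t = nu - 0.028]; the weight 0.972 is
    [1 - 0.028]. *)
Lemma branch_upper y : 0 <= K N 0 y ->
  branch 0 y <= 28 / 1000 + 972 / 1000 * K N 0 y + rem0 y.
Proof.
  intros HK. rewrite branch_decomposition.
  pose proof (abs_K0_le N y ltac:(lia)) as H1. rewrite Rabs_pos_eq in H1 by auto.
  apply Rabs_le_between in Hnu, Ha. nra.
Qed.

(** The kernel contributes [-0.972 * 25/12 = -2.025] to the coefficient of [y^2] and the remainder
    at most [3.5 / 2 = 1.75]; what is left exceeds 1/4 even after the quartic term. From below,
    [1.028 * 25/12 + 1.75 < 4]. *)
Lemma near_quadratic y : (first_curvature S <=? 35000 * scale)%Z = true -> 0 <= y <= 1 / 16 ->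
  branch 0 y <= 1 - y ^ 2 / 4 /\ (nu = 1 -> 1 - 4 * y ^ 2 <= branch 0 y).
Proof.
  intros Hc Hy. pose proof scale_pos as Hsc.
  assert (B : forall x, 0 <= x <= y -> Rabs (rem2 x) <= 35 / 10).
  { intros x Hx. apply (Rmult_le_reg_r (10000 * IZR scale)); [lra|].
    apply Z.leb_le, IZR_le in Hc. rewrite mult_IZR in Hc.
    pose proof (rem2_first x ltac:(lra)). lra. }
  pose proof (K0_ge N y ltac:(lia)) as G1. pose proof (K0_le N y HN) as G2.
  assert (Hy2 : 0 <= y ^ 2 <= 1 / 256) by nra.
  assert (Hy4 : y ^ 4 <= y ^ 2 / 256) by (replace (y ^ 4) with (y ^ 2 * y ^ 2) by ring; nra).
  split.
  - destruct (taylor2_upper rem0 rem1 rem2 0 y (35 / 10) ltac:(lra) is_derive_rem0 is_derive_rem1)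
      as [_ T].
    { intros x Hx. eapply Rle_trans; [apply Rle_abs|auto]. }
    rewrite rem0_at_0, rem1_at_0, Rminus_0_r in T.
    pose proof (branch_upper y ltac:(lra)). lra.
  - intros E.
    destruct (taylor2_upper (fun x => -1 * rem0 x) (fun x => -1 * rem1 x) (fun x => -1 * rem2 x)
      0 y (35 / 10) ltac:(lra)) as [_ T].
    { intros x. apply (is_derive_scal rem0), is_derive_rem0. }
    { intros x. apply (is_derive_scal rem1), is_derive_rem1. }
    { intros x Hx. specialize (B x Hx). apply Rabs_le_between in B. lra. }
    rewrite rem0_at_0, rem1_at_0, Rminus_0_r in T.
    rewrite branch_decomposition, E. rewrite E in Ha. apply Rabs_le_between in Ha.
    assert (K N 0 y <= 1) by (pose proof (abs_K0_le N y ltac:(lia)) as H1;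
      apply Rabs_le_between in H1; lra).
    nra.
Qed.

Lemma near_strict y :
  near_check S 48 8 (8 * first_curvature S) (64 * first_curvature S) = true ->
  1 / 16 <= y < 56 / 128 -> branch 0 y <= 9999 / 10000.
Proof.
  intros Hc Hy. pose proof scale_pos as Hsc.
  set (e := first_curvature S) in *.
  assert (He : 0 <= IZR e).
  { eapply Rle_trans; [|apply (rem2_first 0); lra].
    apply Rmult_le_pos; [apply Rabs_pos|lra]. }
  assert (E8 : INR 8 / 128 = 1 / 16) by (simpl; lra).
  destruct (taylor2_upper rem0 rem1 rem2 0 (1 / 16) (IZR e / (10000 * IZR scale)) ltac:(lra)
    is_derive_rem0 is_derive_rem1) as [T1 T0].
  { intros x Hx. eapply Rle_trans; [apply Rle_abs|].
    apply (Rmult_le_reg_r (10000 * IZR scale)); [lra|].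
    unfold Rdiv. rewrite (Rmult_assoc (IZR e)), Rinv_l, Rmult_1_r by lra.
    apply rem2_first; auto. }
  rewrite rem0_at_0, rem1_at_0, Rminus_0_r in T0. rewrite rem1_at_0, Rminus_0_r in T1.
  (* Starting data at 1/16, that is 8 cells: curvature [e] gives derivative [e/16] and value
     [e/512], which are [8e] and [64e] after scaling by 128 and 32768. *)
  apply (near_loop S (branch 0) rem0 rem1 rem2 48 is_derive_rem0 is_derive_rem1)
    with (i := 8%nat) (R1 := (8 * e)%Z) (R := (64 * e)%Z).
  - intros; apply rem2_cell; auto.
  - intros i x Hi Hx. destruct (K0_cell_bound N i x HN Hi Hx) as [H0 H1].
    pose proof (branch_upper x H0). rewrite plus_IZR, !mult_IZR.
    apply Rle_trans with ((28 / 1000 + 972 / 1000 * K N 0 x + rem0 x) * (10000 * IZR scale));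
      [apply Rmult_le_compat_r; lra|]. lra.
  - exact Hc.
  - lia.
  - apply le_IZR in He. lia.
  - rewrite E8, mult_IZR.
    apply (Rmult_le_compat_r (128 * (10000 * IZR scale))) in T1; [|lra].
    replace ((0 + IZR e / (10000 * IZR scale) * (1 / 16)) * (128 * (10000 * IZR scale)))
      with (8 * IZR e) in T1 by (field; lra). lra.
  - rewrite E8, mult_IZR.
    apply (Rmult_le_compat_r (32768 * (10000 * IZR scale))) in T0; [|lra].
    replace ((0 + 0 * (1 / 16) + IZR e / (10000 * IZR scale) * (1 / 16) ^ 2 / 2)
       * (32768 * (10000 * IZR scale)))
      with (64 * IZR e) in T0 by (field; lra). lra.
  - rewrite E8. replace (INR (8 + 48)) with 56 by (rewrite INR_IZR_INZ; reflexivity). lra.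
Qed.

End NearZone.

Lemma far_zone N a g L t z S i : (166 <= N)%nat -> spread N L -> bounded_coeffs a g L -> In t L ->
  (forall k i, (k <= 3)%nat -> S k i = envelope_sum k i) -> far_check S i = true -> (i < 84)%nat ->
  INR i / 128 <= Rabs (disp N z t) <= INR (Datatypes.S i) / 128 ->
  Rabs (psi N a g L 0 z) <= 999 / 1000.
Proof.
  intros HN HL Hb Ht HS Hc Hi Hd. pose proof scale_pos as Hsc.
  unfold far_check in Hc. rewrite (HS 0%nat (167 - i)%nat), (HS 0%nat (168 + i)%nat) in Hc by lia.
  rewrite (HS 1%nat (167 - i)%nat), (HS 1%nat (168 + i)%nat) in Hc by lia.
  apply Z.leb_le, IZR_le in Hc.
  rewrite !plus_IZR, !mult_IZR, !plus_IZR, !esum_scale in Hc.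
  pose proof (abs_psi_split N a g L 0 z t (168 + i) (167 - i) (INR i / 128)
    (INR (Datatypes.S i) / 128) HN ltac:(lia) HL Hb Ht Hd) as P.
  rewrite plus_INR, minus_INR, (S_INR i) in P by lia.
  replace (INR 168) with 168 in P by (rewrite INR_IZR_INZ; reflexivity).
  replace (INR 167) with 167 in P by (rewrite INR_IZR_INZ; reflexivity).
  specialize (P ltac:(lra) ltac:(lra)).
  destruct (Hb t Ht) as [Ha Hg].
  pose proof (cell_correct N 0 i _ HN ltac:(lia) ltac:(lia) Hd) as C0. rewrite abs_K_abs in C0.
  pose proof (cell_correct N 1 i _ HN ltac:(lia) ltac:(lia) Hd) as C1. rewrite abs_K_abs in C1.
  set (x := disp N z t) in *. set (p := psi N a g L 0 z) in *.
  assert (T : Rabs p <= Rabs (p - (a t * K N 0 x + g t * K N 1 x))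
     + (Rabs (a t) * Rabs (K N 0 x) + Rabs (g t) * Rabs (K N 1 x))).
  { rewrite <- !Rabs_mult.
    replace p with ((p - (a t * K N 0 x + g t * K N 1 x)) + (a t * K N 0 x + g t * K N 1 x)) at 1
      by ring.
    eapply Rle_trans; [apply Rabs_triang|]. apply Rplus_le_compat_l, Rabs_triang. }
  assert (Rabs (a t) * Rabs (K N 0 x) <= 1028 / 1000 * Rabs (K N 0 x))
    by (apply Rmult_le_compat_r; auto using Rabs_pos).
  assert (Rabs (g t) * Rabs (K N 1 x) <= 539 / 10000 * Rabs (K N 1 x))
    by (apply Rmult_le_compat_r; auto using Rabs_pos).
  apply (Rmult_le_reg_r (10000 * IZR scale)); [lra|].
  apply Rle_trans with ((1028 / 1000 * (esum 0 (168 + i) + esum 0 (167 - i))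
     + 539 / 10000 * (esum 1 (168 + i) + esum 1 (167 - i))
     + (1028 / 1000 * Rabs (K N 0 x) + 539 / 10000 * Rabs (K N 1 x))) * (10000 * IZR scale)).
  - apply Rmult_le_compat_r; lra.
  - lra.
Qed.

(** No node needs separate treatment here: all of them lie at least half a separation away, on one
    side or the other. *)
Lemma middle_zone N a g L z : (166 <= N)%nat -> spread N L -> bounded_coeffs a g L ->
  1028 / 1000 * (2 * esum 0 84) + 539 / 10000 * (2 * esum 1 84) <= 999 / 1000 ->
  (forall s, In s L -> 84 / 128 <= Rabs (disp N z s)) ->
  Rabs (psi N a g L 0 z) <= 999 / 1000.
Proof.
  intros HN [HL Hsep] Hb Hc Hd.
  eapply Rle_trans; [apply (weighted_sum_le N a g L L 0 z HN Hb (incl_refl _))|].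
  assert (P : forall k, (k <= 3)%nat ->
    lsum (fun s => Rabs (K N k (disp N z s))) L <= 2 * esum k 84).
  { intros k Hk. unfold esum.
    rewrite <- Rplus_diag, <- Rdiv_plus_distr.
    apply (two_sided_sum N k (disp N z) L 84 84); auto.
    - intros; apply abs_disp_le; auto.
    - intros s Hs. specialize (Hd s Hs).
      replace (INR 84) with 84 by (rewrite INR_IZR_INZ; reflexivity).
      unfold Rabs in Hd. destruct (Rcase_abs _); [right|left]; lra. }
  pose proof (P 0%nat ltac:(lia)). pose proof (P 1%nat ltac:(lia)). lra.
Qed.

(** * The interpolation system *)

(** Gaussian elimination with pivot [p]. The sum in the hypothesis includes the diagonal, hence the
    factor 2. Dominance survives: row [x] gains at most [|M x p / M p p|] times the off-diagonal sum
    of row [p], which is at most [|M x p|], the entry that disappears. *)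
Lemma diag_dominant_solvable {A} (l : list A) : NoDup l ->
  forall (M : A -> A -> R) (b : A -> R),
  (forall x, In x l -> lsum (fun y => Rabs (M x y)) l < 2 * Rabs (M x x)) ->
  exists u, forall x, In x l -> lsum (fun y => M x y * u y) l = b x.
Proof.
  induction l as [|p l IH]; intros Hnd M b Hdom; [exists (fun _ => 0); intros x []|].
  inversion Hnd as [|? ? Hp Hnd']; subst.
  assert (Hpp : lsum (fun y => Rabs (M p y)) l < Rabs (M p p)).
  { pose proof (Hdom p (or_introl eq_refl)) as H. simpl in H. lra. }
  assert (H0 : 0 <= lsum (fun y => Rabs (M p y)) l)
    by (apply lsum_nonneg; intros; apply Rabs_pos).
  assert (Hpos : 0 < Rabs (M p p)) by lra.
  assert (Hne : M p p <> 0) by (intros E; rewrite E, Rabs_R0 in Hpos; lra).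
  set (M' := fun x y => M x y - M x p / M p p * M p y).
  destruct (IH Hnd' M' (fun x => b x - M x p / M p p * b p)) as [u Hu].
  - intros x Hx. destruct (in_split x l Hx) as (l1 & l2 & E). subst l.
    pose proof (Hdom x (or_intror Hx)) as Hdx. simpl in Hdx.
    rewrite lsum_app in *. simpl in *.
    set (c := M x p / M p p) in *.
    assert (Ec : Rabs c * Rabs (M p p) = Rabs (M x p))
      by (rewrite <- Rabs_mult; f_equal; unfold c; field; auto).
    assert (Q : forall l', lsum (fun y => Rabs (M' x y)) l'
      <= lsum (fun y => Rabs (M x y)) l' + Rabs c * lsum (fun y => Rabs (M p y)) l').
    { intros l'. rewrite <- lsum_scal, <- lsum_plus. apply lsum_le. intros y _.
      unfold M'. fold c. unfold Rminus. eapply Rle_trans; [apply Rabs_triang|].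
      rewrite Rabs_Ropp, Rabs_mult. lra. }
    pose proof (Q l1). pose proof (Q l2).
    assert (Hxx : Rabs (M x x) - Rabs c * Rabs (M p x) <= Rabs (M' x x)).
    { unfold M'. fold c. rewrite <- Rabs_mult. apply Rabs_triang_inv. }
    pose proof (Rabs_pos c).
    assert (Rabs c * (lsum (fun y => Rabs (M p y)) l1 + Rabs (M p x)
      + lsum (fun y => Rabs (M p y)) l2) <= Rabs c * Rabs (M p p))
      by (apply Rmult_le_compat_l; lra).
    lra.
  (* Back substitution at the pivot; equality on the index type is decided classically. *)
  - exists (fun y => match excluded_middle_informative (y = p) with
      | left _ => (b p - lsum (fun y => M p y * u y) l) / M p p
      | right _ => u y end).
    assert (E : forall x, lsum (fun y => M x y * match excluded_middle_informative (y = p) with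
      | left _ => (b p - lsum (fun y => M p y * u y) l) / M p p
      | right _ => u y end) l = lsum (fun y => M x y * u y) l).
    { intros x. apply lsum_ext. intros y Hy.
      destruct (excluded_middle_informative (y = p)); [subst; contradiction|reflexivity]. }
    intros x Hx. simpl. rewrite E.
    destruct (excluded_middle_informative (p = p)) as [_|]; [|congruence].
    destruct Hx as [<-|Hx].
    + field. auto.
    + specialize (Hu x Hx). unfold M' in Hu.
      rewrite (lsum_ext _ (fun y => M x y * u y + - (M x p / M p p) * (M p y * u y))) in Hu
        by (intros; ring).
      rewrite lsum_plus, lsum_scal in Hu.
      apply (Rplus_eq_reg_r (- (M x p / M p p) * b p)).
      replace (b x + - (M x p / M p p) * b p) with (b x - M x p / M p p * b p) by ring.
      rewrite <- Hu. field. auto.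
Qed.

Definition interpolates (N : nat) (L : list R) (r a g : R -> R) : Prop :=
  forall t, In t L -> psi N a g L 0 (circumference N * t) = r t
                      /\ psi N a g L 1 (circumference N * t) = 0.

Lemma others_sum_at_node N k L t : (166 <= N)%nat -> (k <= 3)%nat -> spread N L -> In t L ->
  lsum (fun s => Rabs (K N k (circumference N * t - circumference N * s))) (others t L)
  <= 2 * esum k 168.
Proof.
  intros HN Hk HL Ht.
  rewrite (lsum_ext _ (fun s => Rabs (K N k (disp N (circumference N * t) s))))
    by (intros; rewrite K_disp; auto).
  assert (D : disp N (circumference N * t) t = 0).
  { pose proof (disp_local N t 0 HN) as D. rewrite Rabs_R0, Rplus_0_r in D. apply D. lra. }
  pose proof (others_sum N k L (circumference N * t) t 0 0 168 168 HN Hk HL Ht) as Q.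
  rewrite D, Rabs_R0 in Q.
  replace (INR 168) with 168 in Q by (rewrite INR_IZR_INZ; reflexivity). lra.
Qed.

Definition small_sums : Prop :=
  2 * esum 0 168 <= 207 / 10000 /\ 2 * esum 1 168 <= 1236 / 10000 /\
  2 * esum 2 168 <= 1805 / 1000.

Lemma small_sums_hold : small_sums.
Proof.
  destruct grid_sums_exist as (S & HS & HC).
  destruct (grid_facts S HS HC) as (H1 & H2 & H3 & _). split; [|split]; assumption.
Qed.

Lemma sum_at_node N k L t : (166 <= N)%nat -> (k <= 3)%nat -> spread N L -> In t L ->
  lsum (fun s => Rabs (K N k (circumference N * t - circumference N * s))) L
  <= Rabs (K N k 0) + 2 * esum k 168.
Proof.
  intros HN Hk HL Ht. rewrite (lsum_others _ t L) by (try apply HL; auto). cbv beta.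
  rewrite Rminus_diag. apply Rplus_le_compat_l. apply others_sum_at_node; auto.
Qed.

Lemma interpolation_exists N L r : (166 <= N)%nat -> spread N L ->
  exists a g, interpolates N L r a g.
Proof.
  intros HN HL. destruct small_sums_hold as (S0 & S1 & S2).
  set (c := circumference N).
  (* Index [(true, s)] is the unknown [a s] or the value equation at [s], and [(false, s)] is [g s]
     or the derivative equation; an entry is the kernel derivative of order row plus column. The
     diagonal entries are 1 and -25/6. *)
  set (order := fun p : bool * R => if fst p then 0%nat else 1%nat).
  set (M := fun p q : bool * R => K N (order p + order q) (c * snd p - c * snd q)).
  set (l := map (pair true) L ++ map (pair false) L).
  assert (Hsum : forall f : bool * R -> R,
    lsum f l = lsum (fun s => f (true, s)) L + lsum (fun s => f (false, s)) L).
  { intros f. unfold l. rewrite lsum_app, !lsum_map. reflexivity. }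
  assert (Hl : forall p, In p l -> In (snd p) L).
  { intros p Hp. apply in_app_iff in Hp as [Hp|Hp]; apply in_map_iff in Hp as (s & <- & Hs); auto. }
  destruct (diag_dominant_solvable l) with (M := M) (b := fun p : bool * R => if fst p then r (snd p) else 0)
    as [u Hu].
  - assert (Hnd : forall b : bool, NoDup (map (pair b) L)).
    { intros b. apply FinFun.Injective_map_NoDup; [|apply HL]. intros x y E. congruence. }
    unfold l. apply NoDup_app; auto.
    intros p H1 H2. apply in_map_iff in H1 as (? & <- & _).
    apply in_map_iff in H2 as (? & E & _). discriminate.
  - intros [b t] Hp. apply Hl in Hp. cbn [snd] in Hp. rewrite Hsum.
    unfold M, order. cbn [fst snd].
    pose proof (sum_at_node N 0 L t HN ltac:(lia) HL Hp) as Q0.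
    pose proof (sum_at_node N 1 L t HN ltac:(lia) HL Hp) as Q1.
    pose proof (sum_at_node N 2 L t HN ltac:(lia) HL Hp) as Q2.
    fold c in Q0, Q1, Q2.
    rewrite K_at_0, Rabs_R1 in Q0 by lia. rewrite K1_at_0, Rabs_R0 in Q1.
    rewrite K2_at_0, Rabs_Ropp, Rabs_pos_eq in Q2 by (lra || lia).
    destruct b; cbn [Nat.add]; rewrite Rminus_diag.
    + rewrite K_at_0, Rabs_R1 by lia. lra.
    + rewrite K2_at_0, Rabs_Ropp, Rabs_pos_eq by (lra || lia). lra.
  - exists (fun s => u (true, s)), (fun s => u (false, s)). intros t Ht. unfold psi. fold c.
    assert (H1 : In (true, t) l) by (apply in_app_iff; left; apply in_map; auto).
    assert (H2 : In (false, t) l) by (apply in_app_iff; right; apply in_map; auto).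
    pose proof (Hu _ H1) as E1. pose proof (Hu _ H2) as E2. rewrite Hsum in E1, E2.
    unfold M, order in E1, E2. cbn [fst snd Nat.add] in E1, E2.
    rewrite <- lsum_plus in E1, E2.
    split; [rewrite <- E1|eapply eq_trans; [|exact E2]]; apply lsum_ext; intros; ring.
Qed.

Definition lmax (f : R -> R) (L : list R) : R := fold_right (fun x m => Rmax (f x) m) 0 L.

Lemma lmax_ge f L x : In x L -> f x <= lmax f L.
Proof.
  induction L as [|y L IH]; simpl; [intros []|]. intros [<-|H]; [apply Rmax_l|].
  eapply Rle_trans; [apply IH; auto|apply Rmax_r].
Qed.

Lemma lmax_le f L m : 0 <= m -> (forall x, In x L -> f x <= m) -> lmax f L <= m.
Proof.
  intros Hm. induction L as [|y L IH]; simpl; intros H; auto.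
  apply Rmax_lub; auto.
Qed.

Lemma lmax_nonneg f L : 0 <= lmax f L.
Proof.
  induction L as [|y L IH]; simpl; [lra|]. eapply Rle_trans; [exact IH|apply Rmax_r].
Qed.

(** The maxima of the two coefficient families satisfy [A <= 1 + 0.0207 A + 0.1236 G] and
    [G <= 6/25 * (0.1236 A + 1.805 G)]. Solving this linear system gives 1.028 and 0.0539, and
    inserting them gives the deviation 0.028. *)
Lemma interpolation_bounds N L r a g : (166 <= N)%nat -> spread N L ->
  (forall t, In t L -> Rabs (r t) <= 1) -> interpolates N L r a g ->
  bounded_coeffs a g L /\ forall t, In t L -> Rabs (a t - r t) <= 28 / 1000.
Proof.
  intros HN HL Hr Hi. destruct small_sums_hold as (S0 & S1 & S2).
  set (A := lmax (fun s => Rabs (a s)) L). set (G := lmax (fun s => Rabs (g s)) L).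
  assert (HA : forall t, In t L -> Rabs (a t) <= A)
    by (intros; apply (lmax_ge (fun s => Rabs (a s))); auto).
  assert (HG : forall t, In t L -> Rabs (g t) <= G)
    by (intros; apply (lmax_ge (fun s => Rabs (g s))); auto).
  assert (A0 : 0 <= A) by apply lmax_nonneg. assert (G0 : 0 <= G) by apply lmax_nonneg.
  assert (E : forall t k, In t L -> (k <= 1)%nat ->
    Rabs (psi N a g L k (circumference N * t) - (a t * K N k 0 + g t * K N (S k) 0))
    <= A * (2 * esum k 168) + G * (2 * esum (S k) 168)).
  { intros t k Ht Hk. unfold psi. rewrite (lsum_others _ t L) by (try apply HL; auto).
    cbv beta. rewrite Rminus_diag.
    match goal with |- Rabs (?x + ?y - ?x) <= _ => replace (x + y - x) with y by ring end.
    eapply Rle_trans; [apply lsum_abs|].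
    apply Rle_trans with (A * lsum (fun s => Rabs (K N k (circumference N * t - circumference N * s))) (others t L)
      + G * lsum (fun s => Rabs (K N (S k) (circumference N * t - circumference N * s))) (others t L)).
    - rewrite <- !lsum_scal, <- lsum_plus. apply lsum_le. intros s Hs.
      apply in_remove in Hs as [Hs _].
      eapply Rle_trans; [apply Rabs_triang|]. rewrite !Rabs_mult.
      apply Rplus_le_compat; apply Rmult_le_compat_r; auto using Rabs_pos.
    - apply Rplus_le_compat; apply Rmult_le_compat_l; auto;
        apply others_sum_at_node; auto; lia. }
  assert (E0 : forall t, In t L -> Rabs (a t - r t) <= 207 / 10000 * A + 1236 / 10000 * G).
  { intros t Ht. destruct (Hi t Ht) as [H0 _]. pose proof (E t 0%nat Ht ltac:(lia)) as Q.
    rewrite H0, K_at_0, K1_at_0, Rabs_minus_sym in Q by lia.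
    rewrite Rmult_1_r, Rmult_0_r, Rplus_0_r in Q.
    eapply Rle_trans; [exact Q|].
    rewrite (Rmult_comm A), (Rmult_comm G). apply Rplus_le_compat; apply Rmult_le_compat_r; auto. }
  assert (E1 : forall t, In t L -> Rabs (g t) * (25 / 6) <= 1236 / 10000 * A + 1805 / 1000 * G).
  { intros t Ht. destruct (Hi t Ht) as [_ H1]. pose proof (E t 1%nat Ht ltac:(lia)) as Q.
    rewrite H1, K1_at_0, K2_at_0 in Q by lia.
    replace (0 - (a t * 0 + g t * - (25 / 6))) with (g t * (25 / 6)) in Q by ring.
    rewrite Rabs_mult, (Rabs_pos_eq (25 / 6)) in Q by lra.
    eapply Rle_trans; [exact Q|].
    rewrite (Rmult_comm A), (Rmult_comm G). apply Rplus_le_compat; apply Rmult_le_compat_r; auto. }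
  assert (BA : A <= 1 + (207 / 10000 * A + 1236 / 10000 * G)).
  { apply lmax_le; [lra|]. intros t Ht. specialize (E0 t Ht). specialize (Hr t Ht).
    replace (a t) with (r t + (a t - r t)) by ring.
    eapply Rle_trans; [apply Rabs_triang|]. lra. }
  assert (BG : G <= (1236 / 10000 * A + 1805 / 1000 * G) * (6 / 25)).
  { apply lmax_le; [lra|]. intros t Ht. specialize (E1 t Ht). lra. }
  split.
  - intros t Ht. specialize (HA t Ht). specialize (HG t Ht). lra.
  - intros t Ht. specialize (E0 t Ht). lra.
Qed.

Lemma psi_periodic N a g L k z (n : Z) : (166 <= N)%nat ->
  psi N a g L k (z + circumference N * IZR n) = psi N a g L k z.
Proof.
  intros HN. unfold psi. apply lsum_ext. intros s _.
  replace (z + circumference N * IZR n - circumference N * s)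
    with (z - circumference N * s + 2 * PI * INR N * IZR n) by (unfold circumference; ring).
  rewrite !K_period by lia. reflexivity.
Qed.

Lemma psi_disp N a g L k z t : (166 <= N)%nat ->
  psi N a g L k (circumference N * t + disp N z t) = psi N a g L k z.
Proof.
  intros HN. pose proof (circumference_large N HN). unfold disp, centered.
  set (n := up _). rewrite <- (psi_periodic N a g L k _ n HN). f_equal. field. lra.
Qed.

Lemma sign_abs x : exists s, (s = 1 \/ s = -1) /\ x = s * Rabs x.
Proof.
  destruct (Rle_lt_dec 0 x).
  - exists 1. rewrite Rabs_pos_eq by auto. split; [auto|ring].
  - exists (-1). rewrite Rabs_left by auto. split; [auto|ring].
Qed.

Lemma interpolant_near N L r a g z t : (166 <= N)%nat -> spread N L ->
  (forall t, In t L -> Rabs (r t) <= 1) -> interpolates N L r a g ->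
  In t L -> Rabs (disp N z t) <= 1 / 16 ->
  psi N a g L 0 z <= 1 - disp N z t ^ 2 / 4 /\
  (r t = 1 -> 1 - 4 * disp N z t ^ 2 <= psi N a g L 0 z).
Proof.
  intros HN HL Hr Hi Ht Hd.
  destruct (interpolation_bounds N L r a g HN HL Hr Hi) as [Hb Ha].
  destruct (Hi t Ht) as [H0 H1].
  destruct grid_sums_exist as (S & HS & HC).
  destruct (grid_facts S HS HC) as (_ & _ & _ & _ & _ & Hfc & _).
  destruct (sign_abs (disp N z t)) as (s & Hs & E).
  pose proof (near_quadratic N a g L t (r t) s HN HL Hb Ht Hs (Hr t Ht) (Ha t Ht) H0 H1 S HS
    (Rabs (disp N z t)) Hfc (conj (Rabs_pos _) Hd)) as Q.
  unfold branch in Q. rewrite <- E, psi_disp in Q by auto.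
  rewrite pow2_abs in Q. exact Q.
Qed.

Lemma interpolant_away N L r a g z : (166 <= N)%nat -> spread N L ->
  (forall t, In t L -> Rabs (r t) <= 1) -> interpolates N L r a g ->
  (forall t, In t L -> 1 / 16 <= Rabs (disp N z t)) ->
  psi N a g L 0 z <= 9999 / 10000.
Proof.
  intros HN HL Hr Hi Hd.
  destruct (interpolation_bounds N L r a g HN HL Hr Hi) as [Hb Ha].
  destruct grid_sums_exist as (S & HS & HC).
  destruct (grid_facts S HS HC) as (_ & _ & _ & Hmid & Hfar & _ & Hnear).
  destruct (classic (exists t, In t L /\ Rabs (disp N z t) < 84 / 128)) as [(t & Ht & Hlt)|Hno].
  - destruct (Hi t Ht) as [H0 H1]. specialize (Hd t Ht).
    destruct (Rlt_le_dec (Rabs (disp N z t)) (56 / 128)) as [Hlt'|Hge].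
    + destruct (sign_abs (disp N z t)) as (s & Hs & E).
      pose proof (near_strict N a g L t (r t) s HN HL Hb Ht Hs (Hr t Ht) (Ha t Ht) H0 H1 S HS
        (Rabs (disp N z t)) Hnear (conj Hd Hlt')) as Q.
      unfold branch in Q. rewrite <- E, psi_disp in Q by auto. exact Q.
    + destruct (nfloor_ex (128 * Rabs (disp N z t))) as [i Hi']; [lra|].
      assert (i < 84)%nat.
      { apply INR_lt. replace (INR 84) with 84 by (rewrite INR_IZR_INZ; reflexivity). lra. }
      assert (56 <= i)%nat.
      { apply INR_le. apply Rnot_lt_le. intros Hc. apply INR_lt in Hc.
        assert (INR i <= INR 55) by (apply le_INR; lia).
        replace (INR 55) with 55 in * by (rewrite INR_IZR_INZ; reflexivity). lra. }
      pose proof (far_zone N a g L t z S i HN HL Hb Ht HS (Hfar i (conj H2 H)) H) as Q.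
      rewrite S_INR in Q. specialize (Q ltac:(lra)).
      apply Rabs_le_between in Q. lra.
  - pose proof (middle_zone N a g L z HN HL Hb Hmid) as Q.
    assert (P : Rabs (psi N a g L 0 z) <= 999 / 1000).
    { apply Q. intros s Hs. apply Rnot_lt_le. intros Hc. apply Hno. exists s. auto. }
    apply Rabs_le_between in P. lra.
Qed.

(** * Trigonometric polynomials *)

Definition is_trig_poly (fc : nat) (q : R -> C) : Prop :=
  exists c, forall t, q t = trig_poly fc c t.

Lemma is_trig_poly_ext fc q q' : (forall t, q t = q' t) -> is_trig_poly fc q -> is_trig_poly fc q'.
Proof. intros E [c Hc]. exists c. intros t. rewrite <- E. auto. Qed.

Lemma is_trig_poly_zero fc : is_trig_poly fc (fun _ => RtoC 0).
Proof.
  exists (fun _ => RtoC 0). intros t. unfold trig_poly. induction (2 * fc)%nat as [|n IH].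
  - rewrite sum_O. cbv zeta. ring.
  - rewrite sum_Sn, <- IH. change plus with Cplus. cbv zeta. ring.
Qed.

Lemma is_trig_poly_plus fc q q' :
  is_trig_poly fc q -> is_trig_poly fc q' -> is_trig_poly fc (fun t => q t + q' t)%C.
Proof.
  intros [c Hc] [d Hd]. exists (fun k => c k + d k)%C. intros t. rewrite Hc, Hd.
  unfold trig_poly. induction (2 * fc)%nat as [|n IH].
  - rewrite !sum_O. cbv zeta. ring.
  - rewrite !sum_Sn, <- IH. change plus with Cplus. cbv zeta. ring.
Qed.

Lemma is_trig_poly_scal fc a q : is_trig_poly fc q -> is_trig_poly fc (fun t => a * q t)%C.
Proof.
  intros [c Hc]. exists (fun k => a * c k)%C. intros t. rewrite Hc.
  unfold trig_poly. induction (2 * fc)%nat as [|n IH].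
  - rewrite !sum_O. cbv zeta. ring.
  - rewrite !sum_Sn, <- IH. change plus with Cplus. cbv zeta. ring.
Qed.

Lemma sum_n_single (e : nat -> C) j0 n :
  sum_n (fun j => if Nat.eqb j j0 then e j else RtoC 0) n = if Nat.leb j0 n then e j0 else RtoC 0.
Proof.
  induction n as [|n IH].
  - rewrite sum_O. destruct j0; reflexivity.
  - rewrite sum_Sn, IH. change plus with Cplus.
    destruct (Nat.eqb_spec (S n) j0) as [<-|Hne].
    + rewrite Nat.leb_refl, (proj2 (Nat.leb_gt (S n) n)) by lia. apply Cplus_0_l.
    + destruct (Nat.leb_spec j0 n), (Nat.leb_spec j0 (S n)); try lia; apply Cplus_0_r.
Qed.

Lemma is_trig_poly_expi fc k : (Z.abs k <= Z.of_nat fc)%Z ->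
  is_trig_poly fc (fun t => expi (2 * PI * IZR k * t)).
Proof.
  intros Hk. exists (fun m => if Z.eqb m k then RtoC 1 else RtoC 0). intros t. unfold trig_poly.
  set (j0 := Z.to_nat (k + Z.of_nat fc)).
  rewrite (sum_n_ext _ (fun j => if Nat.eqb j j0
    then expi (2 * PI * IZR (Z.of_nat j - Z.of_nat fc) * t) else RtoC 0)).
  - rewrite sum_n_single, (proj2 (Nat.leb_le j0 (2 * fc))) by lia.
    replace (Z.of_nat j0 - Z.of_nat fc)%Z with k by lia. reflexivity.
  - intros j. cbv zeta.
    destruct (Nat.eqb_spec j j0), (Z.eqb_spec (Z.of_nat j - Z.of_nat fc) k); try lia;
      [apply Cmult_1_l|apply Cmult_0_l].
Qed.

Lemma is_trig_poly_cos fc k x phi : (Z.abs k <= Z.of_nat fc)%Z ->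
  is_trig_poly fc (fun t => RtoC (x * cos (2 * PI * IZR k * t + phi))).
Proof.
  intros Hk.
  apply (is_trig_poly_ext fc (fun t => (RtoC (x / 2) * expi phi) * expi (2 * PI * IZR k * t)
    + (RtoC (x / 2) * expi (- phi)) * expi (2 * PI * IZR (- k) * t))%C).
  - intros t. rewrite opp_IZR.
    replace (2 * PI * - IZR k * t) with (- (2 * PI * IZR k * t)) by ring.
    set (y := 2 * PI * IZR k * t). unfold expi, RtoC, Cmult, Cplus. simpl.
    rewrite cos_plus, !cos_neg, !sin_neg. f_equal; field.
  - apply is_trig_poly_plus; apply is_trig_poly_scal, is_trig_poly_expi; auto.
    rewrite Z.abs_opp. auto.
Qed.

Lemma is_trig_poly_lsum {A} fc (f h : A -> R -> R) l :
  (forall x, In x l -> is_trig_poly fc (fun t => (f x t, h x t))) ->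
  is_trig_poly fc (fun t => (lsum (fun x => f x t) l, lsum (fun x => h x t) l)).
Proof.
  induction l as [|x l IH]; intros H.
  - apply is_trig_poly_zero.
  - apply (is_trig_poly_ext fc (fun t => (f x t, h x t)
      + (lsum (fun x => f x t) l, lsum (fun x => h x t) l))%C); [reflexivity|].
    apply is_trig_poly_plus; [apply H; left; auto|apply IH]. intros; apply H; right; auto.
Qed.

(** In the variable [t] a frequency [m] of [ker N] becomes [m / 2], which is an integer because [m]
    is even, and is at most [6N - 1] in modulus. *)
Lemma is_trig_poly_K fc N k s : (0 < N)%nat -> (6 * N - 1 <= fc)%nat ->
  is_trig_poly fc (fun t => RtoC (K N k (circumference N * t - circumference N * s))).
Proof.
  intros HN Hfc. assert (0 < INR N) by (apply lt_0_INR; lia).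
  set (f := fun (p : R * Z) t => fst p * (IZR (snd p) / (2 * INR N)) ^ k *
    cos (IZR (snd p) / (2 * INR N) * (circumference N * t - circumference N * s)
         + INR k * (PI / 2))).
  apply (is_trig_poly_ext fc (fun t => (lsum (fun p => f p t) (ker N), lsum (fun p => 0) (ker N)))).
  - intros t. unfold RtoC. f_equal.
    induction (ker N) as [|p l IH]; simpl; [reflexivity|]. rewrite IH. ring.
  - apply (is_trig_poly_lsum fc f (fun _ _ => 0)). intros p Hp.
    destruct (even_ker N p Hp) as [m Em]. pose proof (degree_ker N p Hp) as Hd. cbv beta in Hd.
    apply (is_trig_poly_ext fc (fun t => RtoC (fst p * (IZR (snd p) / (2 * INR N)) ^ k *
      cos (2 * PI * IZR m * t + (INR k * (PI / 2) - 2 * PI * IZR m * s))))).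
    + intros t. unfold RtoC, f. f_equal. f_equal. f_equal.
      rewrite Em, mult_IZR. unfold circumference. field. lra.
    + apply is_trig_poly_cos. lia.
Qed.

Lemma is_trig_poly_psi fc N a1 g1 a2 g2 L : (0 < N)%nat -> (6 * N - 1 <= fc)%nat ->
  is_trig_poly fc (fun t => (psi N a1 g1 L 0 (circumference N * t),
                             psi N a2 g2 L 0 (circumference N * t))).
Proof.
  intros HN Hfc. unfold psi.
  set (u := fun k s t => K N k (circumference N * t - circumference N * s)).
  apply (is_trig_poly_lsum fc (fun s t => a1 s * u 0%nat s t + g1 s * u 1%nat s t)
    (fun s t => a2 s * u 0%nat s t + g2 s * u 1%nat s t)).
  intros s _.
  apply (is_trig_poly_ext fc (fun t => (a1 s, a2 s) * RtoC (u 0%nat s t)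
    + (g1 s, g2 s) * RtoC (u 1%nat s t))%C).
  - intros t. unfold RtoC, Cmult, Cplus. simpl. f_equal; ring.
  - apply is_trig_poly_plus; apply is_trig_poly_scal, is_trig_poly_K; auto.
Qed.

(** * Separated subsets of the circle *)

Lemma wrap_dist_shift x y (n : Z) : Rabs (x - y) < 1 ->
  wrap_dist x y <= Rabs (y - x + IZR n).
Proof.
  intros H. unfold wrap_dist. rewrite Rabs_minus_sym in *.
  set (d := y - x) in *. clearbody d. apply Rabs_def2 in H.
  destruct (Z.eq_dec n 0) as [->|Hn].
  - rewrite Rplus_0_r. apply Rmin_l.
  - eapply Rle_trans; [apply Rmin_r|].
    destruct (Z.lt_ge_cases n 0) as [Hn'|Hn'].
    + assert (IZR n <= -1) by (apply IZR_le; lia).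
      rewrite (Rabs_left (d + IZR n)) by lra. pose proof (Rle_abs (- d)).
      rewrite Rabs_Ropp in *. unfold Rabs in *. destruct (Rcase_abs d); lra.
    + assert (1 <= IZR n) by (apply IZR_le; lia).
      rewrite (Rabs_pos_eq (d + IZR n)) by lra.
      unfold Rabs. destruct (Rcase_abs d); lra.
Qed.

Lemma abs_centered x y : circle x -> circle y -> Rabs (centered (x - y)) = wrap_dist x y.
Proof.
  unfold circle. intros Hx Hy. pose proof (centered_bound (x - y)) as B.
  unfold wrap_dist. unfold centered in *. set (n := up _) in *. set (d := x - y) in *.
  assert (Hd : -1 < d < 1) by (unfold d; lra). clearbody d n.
  assert (Hn : (-2 < n < 2)%Z) by (split; apply lt_IZR; lra).
  assert (C : (n = -1 \/ n = 0 \/ n = 1)%Z) by lia.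
  unfold Rmin. destruct C as [-> | [-> | ->]];
    destruct (Rle_dec (Rabs d) (1 - Rabs d)) as [Hm|Hm]; unfold Rabs in *;
    destruct (Rcase_abs d); destruct (Rcase_abs _); lra.
Qed.

Lemma min_separation_le (T : R -> Prop) d t t' :
  Rbar_le (Finite d) (min_separation T) -> T t -> T t' -> t <> t' -> d <= wrap_dist t t'.
Proof.
  intros H Ht Ht' Hne. unfold min_separation in H.
  match type of H with Rbar_le _ (Glb_Rbar ?E) => destruct (Glb_Rbar_correct E) as [Hlb _] end.
  specialize (Hlb (wrap_dist t t')).
  assert (Q : Rbar_le d (wrap_dist t t')); [|exact Q].
  eapply Rbar_le_trans; [exact H|]. apply Hlb. exists t, t'. auto.
Qed.

(** Cut [[0, 1)] into intervals of length [/ INR M < d]. Each holds at most one point, and the list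
    grows by induction over the intervals. *)
Lemma separated_finite (T : R -> Prop) d : 0 < d ->
  (forall t, T t -> circle t) ->
  (forall t t', T t -> T t' -> t <> t' -> d <= wrap_dist t t') ->
  exists L, NoDup L /\ forall t, In t L <-> T t.
Proof.
  intros Hd Hc Hsep. destruct (archimed_cor1 d Hd) as (M & HM & HM0).
  assert (HM' : 0 < INR M) by (apply lt_0_INR; auto).
  assert (P : forall k, exists L, NoDup L /\ forall t, In t L <-> T t /\ t < INR k / INR M).
  { induction k as [|k (L & HL & HLT)].
    - exists []. split; [constructor|]. intros t. split; [intros []|]. simpl. intros [Ht Hlt].
      specialize (Hc t Ht). unfold circle in Hc. unfold Rdiv in Hlt. rewrite Rmult_0_l in Hlt. lra.
    - destruct (classic (exists t, T t /\ INR k / INR M <= t < INR (S k) / INR M))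
        as [(t0 & Ht0 & Hb)|Hno].
      + exists (t0 :: L). split.
        * constructor; auto. intros H. apply HLT in H. lra.
        * assert (Hk : INR k / INR M <= INR (S k) / INR M)
            by (apply Rmult_le_compat_r; [apply Rlt_le, Rinv_0_lt_compat; auto|rewrite S_INR; lra]).
          intros t. split.
          -- intros [<-|H]; [split; [auto|lra]|]. apply HLT in H. split; [tauto|lra].
          -- intros [Ht Hlt]. destruct (Rlt_le_dec t (INR k / INR M)) as [H|H].
             ++ right. apply HLT. auto.
             ++ left. apply NNPP. intros Hne.
                pose proof (Hsep t0 t Ht0 Ht Hne) as Hw. unfold wrap_dist in Hw.
                assert (Rabs (t0 - t) < / INR M).
                { rewrite S_INR in *.
                  replace ((INR k + 1) / INR M) with (INR k / INR M + / INR M) in * by (field; lra).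
                  apply Rabs_def1; lra. }
                pose proof (Rmin_l (Rabs (t0 - t)) (1 - Rabs (t0 - t))). lra.
      + exists L. split; auto. intros t. rewrite HLT. split; [intros [H1 H2]|intros [H1 H2]];
          split; auto.
        * eapply Rlt_le_trans; [exact H2|].
          apply Rmult_le_compat_r; [apply Rlt_le, Rinv_0_lt_compat; auto|rewrite S_INR; lra].
        * apply Rnot_le_lt. intros H3. apply Hno. exists t. auto. }
  destruct (P M) as (L & HL & HLT). exists L. split; auto. intros t. rewrite HLT.
  split; [tauto|]. intros Ht. split; auto. specialize (Hc t Ht). unfold circle in Hc.
  unfold Rdiv. rewrite Rinv_r; lra.
Qed.

(** Seen from any [z], two displacements differ by [y - x] plus an integer, up to the factor
    [circumference N], and [wrap_dist] is minimal among such shifts. *)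
Lemma spread_of_separated N (T : R -> Prop) L d : (166 <= N)%nat ->
  168 / 128 <= circumference N * d ->
  (forall t, T t -> circle t) ->
  (forall t t', T t -> T t' -> t <> t' -> d <= wrap_dist t t') ->
  NoDup L -> (forall t, In t L <-> T t) -> spread N L.
Proof.
  intros HN Hd Hc Hsep HL HLT. split; auto. intros z x y Hx Hy Hxy.
  apply HLT in Hx, Hy. pose proof (circumference_large N HN) as HC.
  unfold disp. rewrite <- Rmult_minus_distr_l, Rabs_mult, (Rabs_pos_eq (circumference N)) by lra.
  eapply Rle_trans; [exact Hd|]. apply Rmult_le_compat_l; [lra|].
  eapply Rle_trans; [apply (Hsep x y); auto|].
  unfold centered. set (n := up _). set (m := up _).
  replace (z / circumference N - x - IZR n - (z / circumference N - y - IZR m))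
    with (y - x + IZR (m - n)) by (rewrite minus_IZR; ring).
  apply wrap_dist_shift. specialize (Hc x Hx) as C1. specialize (Hc y Hy) as C2.
  unfold circle in *. apply Rabs_def1; lra.
Qed.

(** * Complex signs *)

(** The modulus is attained at the unit vector in the direction of [q] itself. When [q = 0], the
    rotation [(1, 0)] still shows [0 <= b]. *)
Lemma Cmod_le_of_rotations q1 q2 b :
  (forall c1 c2, c1 ^ 2 + c2 ^ 2 = 1 -> c1 * q1 + c2 * q2 <= b) -> Cmod (q1, q2) <= b.
Proof.
  intros H. pose proof (Cmod_ge_0 (q1, q2)) as H0.
  assert (E : Cmod (q1, q2) ^ 2 = q1 ^ 2 + q2 ^ 2).
  { unfold Cmod. simpl fst. simpl snd. rewrite pow2_sqrt; [reflexivity|].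
    pose proof (pow2_ge_0 q1). pose proof (pow2_ge_0 q2). lra. }
  set (m := Cmod (q1, q2)) in *. destruct H0 as [H0|H0].
  - specialize (H (q1 / m) (q2 / m)).
    replace (q1 / m * q1 + q2 / m * q2) with ((q1 ^ 2 + q2 ^ 2) / m) in H by (field; lra).
    rewrite <- E in H. replace (m ^ 2 / m) with m in H by (field; lra). apply H.
    replace ((q1 / m) ^ 2 + (q2 / m) ^ 2) with ((q1 ^ 2 + q2 ^ 2) / m ^ 2) by (field; lra).
    rewrite <- E. field. lra.
  - rewrite <- H0 in *. pose proof (pow2_ge_0 q1). pose proof (pow2_ge_0 q2).
    specialize (H 1 0 ltac:(ring)). nra.
Qed.

Lemma rotation_le_Cmod c1 c2 q1 q2 : c1 ^ 2 + c2 ^ 2 = 1 -> c1 * q1 + c2 * q2 <= Cmod (q1, q2).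
Proof.
  intros H. unfold Cmod. simpl fst. simpl snd. apply Rsqr_incr_0_var; [|apply sqrt_pos].
  rewrite Rsqr_sqrt by (pose proof (pow2_ge_0 q1); pose proof (pow2_ge_0 q2); lra).
  unfold Rsqr.
  replace (q1 ^ 2 + q2 ^ 2) with ((c1 ^ 2 + c2 ^ 2) * (q1 ^ 2 + q2 ^ 2)) by (rewrite H; ring).
  pose proof (pow2_ge_0 (c1 * q2 - c2 * q1)). nra.
Qed.

Lemma psi_linear N a1 g1 a2 g2 L k z c1 c2 :
  psi N (fun s => c1 * a1 s + c2 * a2 s) (fun s => c1 * g1 s + c2 * g2 s) L k z
  = c1 * psi N a1 g1 L k z + c2 * psi N a2 g2 L k z.
Proof.
  unfold psi. rewrite <- !lsum_scal, <- lsum_plus. apply lsum_ext. intros; ring.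
Qed.

Lemma interpolates_linear N L r1 r2 a1 g1 a2 g2 c1 c2 :
  interpolates N L r1 a1 g1 -> interpolates N L r2 a2 g2 ->
  interpolates N L (fun t => c1 * r1 t + c2 * r2 t)
    (fun s => c1 * a1 s + c2 * a2 s) (fun s => c1 * g1 s + c2 * g2 s).
Proof.
  intros H1 H2 t Ht. destruct (H1 t Ht) as [E1 D1]. destruct (H2 t Ht) as [E2 D2].
  rewrite !psi_linear, E1, E2, D1, D2. split; ring.
Qed.

Lemma abs_rotation_le c1 c2 (v : C) : c1 ^ 2 + c2 ^ 2 = 1 -> Cmod v = 1 ->
  Rabs (c1 * fst v + c2 * snd v) <= 1.
Proof.
  intros Hc Hv. destruct v as [v1 v2]. simpl fst. simpl snd.
  pose proof (rotation_le_Cmod c1 c2 v1 v2 Hc).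
  pose proof (rotation_le_Cmod (- c1) (- c2) v1 v2 ltac:(lra)). apply Rabs_le. lra.
Qed.

(** [N] is the largest integer with [6N - 1 <= fc], hence [6N >= fc - 4]. The last inequality fixes
    the bin length: [252/100 * 3.14 * (fc - 4) / 6 >= 168/128 * fc] for [fc >= 1000]. *)
Lemma circumference_bounds fc N : (1000 <= fc)%nat -> N = ((fc + 1) / 6)%nat ->
  (166 <= N)%nat /\ (6 * N - 1 <= fc)%nat /\
  INR fc <= circumference N <= 106 / 100 * INR fc /\
  168 / 128 <= circumference N * (126 / 100 / INR fc).
Proof.
  intros Hfc ->.
  pose proof (Nat.div_mod_eq (fc + 1) 6) as E. pose proof (Nat.mod_upper_bound (fc + 1) 6 ltac:(lia)).
  set (N := ((fc + 1) / 6)%nat) in *. clearbody N.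
  assert (H1 : (6 * N <= fc + 1)%nat) by lia. assert (H2 : (fc <= 6 * N + 4)%nat) by lia.
  apply le_INR in H1, H2. rewrite plus_INR, mult_INR in H1, H2.
  replace (INR 6) with 6 in * by (simpl; ring). replace (INR 4) with 4 in * by (simpl; ring).
  replace (INR 1) with 1 in * by reflexivity.
  assert (H3 : 1000 <= INR fc)
    by (replace 1000 with (INR 1000) by (rewrite INR_IZR_INZ; reflexivity); apply le_INR; auto).
  pose proof PI_lower. pose proof PI_upper.
  split; [lia|]. split; [lia|].
  unfold circumference. split; [split; nra|].
  apply (Rmult_le_reg_r (INR fc)); [lra|].
  replace (2 * PI * INR N * (126 / 100 / INR fc) * INR fc) with (252 / 100 * PI * INR N)
    by (field; lra).
  nra.
Qed.

Theorem proposition2p3 :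
  exists C0 C1 C2 : R,
    0 < C0 < 1 /\ 0 < C1 /\ 0 < C2 /\
    forall (fc : nat) (T : R -> Prop) (v : R -> C),
      (1000 <= fc)%nat ->
      (forall t : R, T t -> circle t) ->
      Rbar_le (Finite ((126 / 100) / INR fc)) (min_separation T) ->
      (forall tj : R, T tj -> Cmod (v tj) = 1) ->
      exists c : Z -> C,
        let q := trig_poly fc c in
        (forall tj : R, T tj -> q tj = v tj) /\
        (forall t : R, circle t -> ~ T t -> Cmod (q t) < 1) /\
        (forall tj t : R, T tj -> circle t ->
           wrap_dist t tj <= C0 * (1 / INR fc) ->
           1 - C1 * INR fc ^ 2 * wrap_dist t tj ^ 2 <= Cmod (q t) /\
           Cmod (q t) <= 1 - C2 * INR fc ^ 2 * wrap_dist t tj ^ 2).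
Proof.
  (* As [fc <= Cf <= 1.06 fc], a wrap distance up to [1 / (20 fc)] becomes at most [0.053 < 1/16];
     the lower constant is [4 * 1.06^2 < 5], and the upper one stays 1/4. *)
  exists (1 / 20), 5, (1 / 4). split; [lra|]. split; [lra|]. split; [lra|].
  intros fc T v Hfc Hcirc Hsep Hv.
  set (N := ((fc + 1) / 6)%nat).
  destruct (circumference_bounds fc N Hfc eq_refl) as (HN & HNfc & [HC1 HC2] & HCd).
  assert (Hfc' : 1000 <= INR fc)
    by (replace 1000 with (INR 1000) by (rewrite INR_IZR_INZ; reflexivity); apply le_INR; auto).
  set (d := 126 / 100 / INR fc) in *.
  assert (Hd : 0 < d) by (apply Rdiv_lt_0_compat; lra).
  assert (Hsep' : forall t t', T t -> T t' -> t <> t' -> d <= wrap_dist t t')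
    by (intros; apply (min_separation_le T); auto).
  destruct (separated_finite T d Hd Hcirc Hsep') as (L & HL & HLT).
  assert (HS : spread N L) by (apply (spread_of_separated N T L d); auto).
  destruct (interpolation_exists N L (fun t => fst (v t)) HN HS) as (a1 & g1 & I1).
  destruct (interpolation_exists N L (fun t => snd (v t)) HN HS) as (a2 & g2 & I2).
  destruct (is_trig_poly_psi fc N a1 g1 a2 g2 L ltac:(lia) HNfc) as [c Hc].
  exists c. cbv zeta.
  set (Cf := circumference N) in *.
  assert (Hnode : forall c1 c2 t, c1 ^ 2 + c2 ^ 2 = 1 -> In t L ->
    Rabs (c1 * fst (v t) + c2 * snd (v t)) <= 1)
    by (intros; apply abs_rotation_le; auto; apply Hv, HLT; auto).
  pose proof (fun c1 c2 => interpolates_linear N L _ _ a1 g1 a2 g2 c1 c2 I1 I2) as I.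
  assert (Hdisp : forall t s, circle t -> T s -> Rabs (disp N (Cf * t) s) = Cf * wrap_dist t s).
  { intros t s Ht Hs. unfold disp. fold Cf. replace (Cf * t / Cf) with t by (field; lra).
    rewrite Rabs_mult, (Rabs_pos_eq Cf), abs_centered by (auto; lra). reflexivity. }
  assert (Hnear : forall t s, circle t -> T s -> Rabs (disp N (Cf * t) s) <= 1 / 16 ->
    1 - 4 * (Cf * wrap_dist t s) ^ 2 <= Cmod (trig_poly fc c t)
      <= 1 - (Cf * wrap_dist t s) ^ 2 / 4).
  { intros t s Ht Hs Hw. rewrite <- Hc.
    assert (HsL : In s L) by (apply HLT; auto).
    assert (E : disp N (Cf * t) s ^ 2 = (Cf * wrap_dist t s) ^ 2)
      by (rewrite <- Hdisp, pow2_abs; auto).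
    rewrite <- E. split.
    - pose proof (Hv s Hs) as Hvs. destruct (v s) as [v1 v2] eqn:Ev.
      assert (Eu : v1 ^ 2 + v2 ^ 2 = 1).
      { replace (v1 ^ 2 + v2 ^ 2) with (Cmod (v1, v2) ^ 2); [rewrite Hvs; ring|].
        unfold Cmod. simpl fst. simpl snd. apply pow2_sqrt.
        pose proof (pow2_ge_0 v1). pose proof (pow2_ge_0 v2). lra. }
      (* The rotation by the conjugate of [v s] makes the real datum at [s] equal to
         [v1^2 + v2^2 = 1], the case in which the lower estimate is available. *)
      eapply Rle_trans; [|apply (rotation_le_Cmod v1 v2); exact Eu].
      rewrite <- psi_linear.
      apply (interpolant_near N L _ _ _ (Cf * t) s HN HS (fun x Hx => Hnode v1 v2 x Eu Hx)
        (I v1 v2) HsL Hw).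
      rewrite Ev. simpl. rewrite <- Eu. ring.
    - apply Cmod_le_of_rotations. intros c1 c2 Hcc. rewrite <- psi_linear.
      apply (interpolant_near N L _ _ _ (Cf * t) s HN HS (fun x Hx => Hnode c1 c2 x Hcc Hx)
        (I c1 c2) HsL Hw). }
  split; [|split].
  - intros t Ht. rewrite <- Hc. apply HLT in Ht.
    destruct (I1 t Ht) as [E1 _]. destruct (I2 t Ht) as [E2 _]. fold Cf in E1, E2.
    rewrite E1, E2. destruct (v t); reflexivity.
  - intros t Ht HnT.
    (* Within 1/16 of a node, strictness comes from the positive distance to it; elsewhere the
       uniform bound 0.9999 applies. *)
    destruct (classic (exists s, In s L /\ Rabs (disp N (Cf * t) s) < 1 / 16)) as [(s & Hs & Hlt)|Hno].
    + apply HLT in Hs. destruct (Hnear t s Ht Hs ltac:(lra)) as [_ U].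
      eapply Rle_lt_trans; [exact U|].
      assert (Hw : 0 < wrap_dist t s).
      { assert (t <> s) by (intros ->; auto). specialize (Hcirc s Hs). unfold circle in *.
        unfold wrap_dist. apply Rmin_glb_lt; [apply Rabs_pos_lt; lra|].
        assert (Rabs (t - s) < 1) by (apply Rabs_def1; lra). lra. }
      assert (0 < (Cf * wrap_dist t s) ^ 2) by (apply pow_lt, Rmult_lt_0_compat; lra). lra.
    + apply Rle_lt_trans with (9999 / 10000); [|lra]. rewrite <- Hc.
      apply Cmod_le_of_rotations. intros c1 c2 Hcc. rewrite <- psi_linear.
      apply (interpolant_away N L _ _ _ (Cf * t) HN HS (fun x Hx => Hnode c1 c2 x Hcc Hx) (I c1 c2)).
      intros s Hs. apply Rnot_lt_le. intros Hlt. apply Hno. exists s. auto.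
  - intros s t Hs Ht Hw.
    assert (Hw0 : 0 <= wrap_dist t s).
    { rewrite <- abs_centered; auto. apply Rabs_pos. }
    assert (Hw1 : INR fc * wrap_dist t s <= 1 / 20).
    { apply (Rmult_le_compat_l (INR fc)) in Hw; [|lra].
      replace (INR fc * (1 / 20 * (1 / INR fc))) with (1 / 20) in Hw by (field; lra). exact Hw. }
    set (w := wrap_dist t s) in *.
    assert (B1 : INR fc * w <= Cf * w) by (apply Rmult_le_compat_r; auto).
    assert (B2 : Cf * w <= 106 / 100 * (INR fc * w))
      by (rewrite <- Rmult_assoc; apply Rmult_le_compat_r; auto).
    assert (B0 : 0 <= INR fc * w) by (apply Rmult_le_pos; lra).
    destruct (Hnear t s Ht Hs) as [Lo Up]; [rewrite Hdisp by auto; fold w; lra|]. fold w in Lo, Up.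
    replace (5 * INR fc ^ 2 * w ^ 2) with (5 * (INR fc * w) ^ 2) by ring.
    replace (1 / 4 * INR fc ^ 2 * w ^ 2) with (1 / 4 * (INR fc * w) ^ 2) by ring.
    split; nra.
Qed.
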